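(* Let $p\ge 0$, $\lambda>0$, $\gamma,\vartheta,\upsilon\in\mathbb{C}$, $|t|<a$ and $\sigma\ne 1$. Then $$\sum_{n=0}^\infty\frac{(\sigma)_n}{n!}\,\Phi_{\gamma,\vartheta;\upsilon}(z,\sigma+n,a;p,\lambda)\,t^n=\Phi_{\gamma,\vartheta;\upsilon}(z,\sigma,a-t;p,\lambda),$$ where $\Phi_{\gamma,\vartheta;\upsilon}(z,\sigma,a;p,\lambda)$ is the extended Hurwitz-Lerch Zeta function.
   Context: $(\gamma)_n=\gamma(\gamma+1)\cdots(\gamma+n-1)$, $(\gamma)_0=1$, is the Pochhammer symbol; $B(x,y)$ is the classical beta function. The Mittag-Leffler function is $E_\lambda(w)=\sum_{n=0}^\infty \frac{w^n}{\Gamma(\lambda n+1)}$. For $\Re(x)>0$, $\Re(y)>0$ the extended beta function is $$B(x,y;p,\lambda)=\int_0^1 u^{x-1}(1-u)^{y-1}E_\lambda\Big(-\frac{p}{u(1-u)}\Big)du.$$ The extended Hurwitz-Lerch Zeta function is $$\Phi_{\gamma,\vartheta;\upsilon}(z,\sigma,a;p,\lambda)=\sum_{k=0}^\infty\frac{(\gamma)_k\,B(\vartheta+k,\upsilon-\vartheta;p,\lambda)}{B(\vartheta,\upsilon-\vartheta)\,k!}\frac{z^k}{(k+a)^\sigma},$$ for $p\ge0$, $\lambda>0$, $\gamma,\vartheta,\upsilon\in\mathbb{C}$, $a\in\mathbb{C}\setminus\{0,-1,-2,\dots\}$, with $\sigma\in\mathbb{C}$ when $|z|<1$ and $\Re(\sigma+\upsilon-\gamma-\vartheta)>1$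 when $|z|=1$. *)

(* Defs.v *)
From mathcomp Require Export all_boot all_order all_algebra.
From mathcomp Require Export all_classical all_reals all_analysis.
From mathcomp Require Export complex.

Set Implicit Arguments.
Unset Strict Implicit.
Unset Printing Implicit Defensive.

Import Order.TTheory GRing.Theory Num.Theory.
Export numFieldNormedType.Exports.

Local Open Scope classical_set_scope.
Local Open Scope ring_scope.
Local Open Scope complex_scope.

Section Defs.
Variable R : realType.
Implicit Types (w z s x y sigma a t : R[i]) (u : nat -> R[i]).

(* The topology on R[i] is the one given by the complex modulus; the library
   attaches it to R[i]^o, a copy of R[i]. *)
Definition has_csum u (l : R[i]) : Prop :=
  (series u : nat -> R[i]^o) @ \oo --> (l : R[i]^o).

Definition csum u : R[i] := limn (series u : nat -> R[i]^o).

Definition cexp z : R[i] :=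
  (expR (complex.Re z))%:C * (cos (complex.Im z) +i* sin (complex.Im z)).

(* Principal argument, with values in ]-pi, pi] for w != 0. *)
Definition carg w : R :=
  let theta := acos (complex.Re w / complex.Re `|w|) in
  if 0 <= complex.Im w then theta else - theta.

Definition clog w : R[i] := ln (complex.Re `|w|) +i* carg w.

(* Principal power w ^ s; only meaningful for w != 0. *)
Definition cpow w s : R[i] := cexp (s * clog w).

(* Lebesgue integral of a complex-valued function; its value is 0 when f is not
   integrable on D. *)
Definition cintegral (D : set R) (f : R -> R[i]) : R[i] :=
  let mu := @lebesgue_measure R in
  let re := fun r => complex.Re (f r) in
  let im := fun r => complex.Im (f r) in
  if `[< mu.-integrable D (EFin \o re) /\ mu.-integrable D (EFin \o im) >]
  then (\int[mu]_(r in D) re r)%R +i* (\int[mu]_(r in D) im r)%R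
  else 0.

(* Euler's Gamma function, for real arguments r > 0. *)
Definition Gamma (r : R) : R :=
  (\int[@lebesgue_measure R]_(v in `]0, +oo[) (v `^ (r - 1) * expR (- v)))%R.

Definition pochhammer w (n : nat) : R[i] := \prod_(i < n) (w + i%:R).

Definition mittag_leffler (lambda : R) w : R[i] :=
  csum (fun n => w ^+ n / (Gamma (lambda * n%:R + 1))%:C).

(* The classical and the extended beta functions, for 'Re x > 0, 'Re y > 0. *)
Definition beta x y : R[i] :=
  cintegral `]0, 1[
    (fun v => cpow v%:C (x - 1) * cpow (1 - v)%:C (y - 1)).

Definition ext_beta x y (p lambda : R) : R[i] :=
  cintegral `]0, 1[
    (fun v => cpow v%:C (x - 1) * cpow (1 - v)%:C (y - 1) *
              mittag_leffler lambda (- (p / (v * (1 - v))))%:C).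

Definition ext_Phi (gamma theta upsilon : R[i]) z sigma a (p lambda : R)
    : R[i] :=
  csum (fun k =>
    pochhammer gamma k * ext_beta (theta + k%:R) (upsilon - theta) p lambda
      / (beta theta (upsilon - theta) * k`!%:R)
      * (z ^+ k / cpow (k%:R + a) sigma)).

End Defs.

(* Main.v *)
Require Import Defs.
From mathcomp Require Import all_boot all_order all_algebra.
From mathcomp Require Import all_classical all_reals all_analysis complex.
From mathcomp Require Import measurable_realfun ring lra.

Set Implicit Arguments.
Unset Strict Implicit.
Unset Printing Implicit Defensive.

Import Order.TTheory GRing.Theory Num.Theory.
Import numFieldNormedType.Exports.

Local Open Scope classical_set_scope.
Local Open Scope ring_scope.
Local Open Scope complex_scope.

(** Since (k+a-t)^(-sigma) = (k+a)^(-sigma) (1 - t/(k+a))^(-sigma) and |t| < a <= k+a, the identity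
    is the binomial series in t/(k+a) summed over k, and the two summations may be exchanged as soon
    as the series defining Phi(z, sigma, a) converges absolutely. For |z| < 1 it suffices that the
    extended beta values are bounded. For |z| = 1 and d = Re (upsilon - theta) > 1 they must decay
    like k^(1-d), which is clear if E_lambda is bounded on the arguments that occur. That holds for
    p = 0 and for lambda <= 2, where |E_lambda(-x)| <= 1. For p > 0 and lambda > 2,
    E_lambda(-x) grows so fast that the beta integrand is not integrable, and the extended beta
    function takes the value 0 by convention.

    Growth for lambda > 2: otherwise s |-> E_lambda(-s^lambda) would have a Laplace transform
    analytic on the right half-plane, whereas term by term this transform is
    w^(lambda-1) / (w^lambda + 1), which has the pole exp(i pi / lambda). *)

(** * Complex series *)

Section ComplexModulus.
Variable R : realType.
Implicit Types (z w : R[i]).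

(** The contradiction for lambda > 2 is drawn without contour integrals or analytic continuation.
    The Laplace transform L is expanded at a real point q > 1, where termwise integration is
    legitimate. Subexponential growth makes this Taylor series converge for |w - q| < q, and the
    equation (w^lambda + 1) L = w^(lambda - 1) holds there because it is an identity between Taylor
    coefficients. For a suitable q the disc contains the pole, where the left side vanishes and the
    right side does not. The rate k^(1-d) comes from the supremum of the beta integrand. It is just
    enough: on |z| = 1 the k-th term of Phi then has order at most k^(- Re (sigma + upsilon - gamma
    - theta)), with exponent below -1. For d <= 1 boundedness of the beta values already gives an
    exponent below -1. The real part of theta may be negative, so the beta estimates start only at
    some index K. *)

Definition cabs (z : R[i]) : R := complex.Re `|z|.

Lemma cabsE z : `|z| = (cabs z)%:C.
Proof. by rewrite /cabs RRe_real// normr_real. Qed.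

Lemma cabs_ge0 z : 0 <= cabs z.
Proof. by rewrite -ler0c -cabsE. Qed.

Lemma cabs_eq0 z : (cabs z == 0) = (z == 0).
Proof. by rewrite -(inj_eq (@complexI R)) -cabsE normr_eq0. Qed.

Lemma cabs0 : cabs 0 = 0. Proof. by apply/eqP; rewrite cabs_eq0. Qed.

Lemma cabsM z w : cabs (z * w) = cabs z * cabs w.
Proof. by apply: complexI; rewrite rmorphM/= -!cabsE normrM. Qed.

Lemma cabsV z : cabs z^-1 = (cabs z)^-1.
Proof. by apply: complexI; rewrite fmorphV/= -!cabsE normfV. Qed.

Lemma cabsX z n : cabs (z ^+ n) = cabs z ^+ n.
Proof. by apply: complexI; rewrite rmorphXn/= -!cabsE normrX. Qed.

Lemma cabsN z : cabs (- z) = cabs z.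
Proof. by rewrite /cabs normrN. Qed.

Lemma cabsD z w : cabs (z + w) <= cabs z + cabs w.
Proof. by rewrite -lecR rmorphD/= -!cabsE ler_normD. Qed.

Lemma cabsB z w : cabs (z - w) <= cabs z + cabs w.
Proof. by rewrite (le_trans (cabsD _ _))// cabsN. Qed.

Lemma cabs_sum (I : Type) (r : seq I) (P : pred I) (F : I -> R[i]) :
  cabs (\sum_(i <- r | P i) F i) <= \sum_(i <- r | P i) cabs (F i).
Proof.
elim/big_ind2 : _ => //; first by rewrite cabs0.
by move=> x1 x2 y1 y2 h1 h2; rewrite (le_trans (cabsD _ _))// lerD.
Qed.

Lemma cabsR (r : R) : cabs r%:C = `|r|.
Proof. by rewrite /cabs normc_def/= expr0n addr0 sqrtr_sqr. Qed.

Lemma cabs_nat n : cabs (n%:R : R[i]) = n%:R.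
Proof. by rewrite -(rmorph_nat (real_complex R)) cabsR normr_nat. Qed.

Lemma cabs1 : cabs 1 = 1. Proof. exact: (cabs_nat 1). Qed.

Lemma sqr_cabs z : cabs z ^+ 2 = complex.Re z ^+ 2 + complex.Im z ^+ 2.
Proof. by rewrite /cabs normc_def/= sqr_sqrtr// addr_ge0// sqr_ge0. Qed.

Lemma Re_le_cabs z : `|complex.Re z| <= cabs z.
Proof. by rewrite -lecR -cabsE normc_ge_Re. Qed.

Lemma Im_le_cabs z : `|complex.Im z| <= cabs z.
Proof.
rewrite -(@ler_sqr R) ?nnegrE ?cabs_ge0// sqr_cabs real_normK ?num_real//.
by rewrite lerDr sqr_ge0.
Qed.

Lemma cabs_le_ReIm z : cabs z <= `|complex.Re z| + `|complex.Im z|.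
Proof.
have -> : z = (complex.Re z)%:C + 'i%C * (complex.Im z)%:C by exact: complexE.
rewrite (le_trans (cabsD _ _))// cabsM !cabsR.
suff -> : cabs 'i%C = 1 by rewrite mul1r -complexE.
by rewrite /cabs normc_def/= expr0n add0r expr1n sqrtr1.
Qed.

Lemma cReD z w : complex.Re (z + w) = complex.Re z + complex.Re w.
Proof. by case: z; case: w. Qed.
Lemma cImD z w : complex.Im (z + w) = complex.Im z + complex.Im w.
Proof. by case: z; case: w. Qed.
Lemma cReN z : complex.Re (- z) = - complex.Re z. Proof. by case: z. Qed.
Lemma cImN z : complex.Im (- z) = - complex.Im z. Proof. by case: z. Qed.
Lemma cReM z w : complex.Re (z * w) =
  complex.Re z * complex.Re w - complex.Im z * complex.Im w.
Proof. by case: z; case: w. Qed.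
Lemma cImM z w : complex.Im (z * w) =
  complex.Re z * complex.Im w + complex.Im z * complex.Re w.
Proof. by case: z; case: w => a b c d /=. Qed.
Lemma cReMr z (r : R) : complex.Re (z * r%:C) = complex.Re z * r.
Proof. by rewrite cReM/= mulr0 subr0. Qed.
Lemma cImMr z (r : R) : complex.Im (z * r%:C) = complex.Im z * r.
Proof. by rewrite cImM/= mulr0 add0r. Qed.
Lemma cRe_sum (I : Type) (r : seq I) (P : pred I) (F : I -> R[i]) :
  complex.Re (\sum_(i <- r | P i) F i) = \sum_(i <- r | P i) complex.Re (F i).
Proof. exact: (big_morph _ cReD). Qed.
Lemma cIm_sum (I : Type) (r : seq I) (P : pred I) (F : I -> R[i]) :
  complex.Im (\sum_(i <- r | P i) F i) = \sum_(i <- r | P i) complex.Im (F i).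
Proof. exact: (big_morph _ cImD). Qed.

Lemma complexP z w : complex.Re z = complex.Re w -> complex.Im z = complex.Im w ->
  z = w.
Proof. by case: z; case: w => a b c d /= -> ->. Qed.

End ComplexModulus.

Section ComplexSeries.
Variable R : realType.
Implicit Types (u v : nat -> R[i]) (l m c : R[i]).

Lemma cvg_complexP u l :
  (u : nat -> R[i]^o) @ \oo --> (l : R[i]^o) <->
  ((fun n => complex.Re (u n)) @ \oo --> complex.Re l) /\ ((fun n => complex.Im (u n)) @ \oo --> complex.Im l).
Proof.
split=> [/cvgrPdist_lt h|[/cvgrPdist_lt hr /cvgrPdist_lt hi]].
  split; apply/cvgrPdist_lt => e e0.
    have e0' : 0 < e%:C by rewrite ltcR.
    apply: filterS (h _ e0') => n /=.
    rewrite cabsE ltcR; apply: le_lt_trans.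
    by rewrite -cReN -cReD Re_le_cabs.
  have e0' : 0 < e%:C by rewrite ltcR.
  apply: filterS (h _ e0') => n /=.
  rewrite cabsE ltcR; apply: le_lt_trans.
  by rewrite -cImN -cImD Im_le_cabs.
apply/cvgrPdist_lt => e; rewrite ltcE => /andP[/eqP ie re].
have -> : e = (complex.Re e)%:C by apply: complexP.
have e2 : 0 < complex.Re e / 2 by rewrite divr_gt0.
apply: filterS2 (hr _ e2) (hi _ e2) => n /= h1 h2.
rewrite cabsE ltcR (le_lt_trans (cabs_le_ReIm _))//.
by rewrite !(cReD, cImD, cReN, cImN) [ltRHS]splitr ltrD.
Qed.

Lemma has_csumP u l : has_csum u l <->
  (series (fun n => complex.Re (u n)) @ \oo --> complex.Re l) /\
  (series (fun n => complex.Im (u n)) @ \oo --> complex.Im l).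
Proof.
rewrite /has_csum cvg_complexP.
suff [-> ->] : ((fun n => complex.Re (series u n)) = series (fun n => complex.Re (u n))) /\
  ((fun n => complex.Im (series u n)) = series (fun n => complex.Im (u n))) by [].
by split; apply/funext => n; rewrite /series/= (cRe_sum, cIm_sum).
Qed.

Lemma csum_unique u l : has_csum u l -> csum u = l.
Proof.
rewrite /has_csum /csum => h.
exact: (@cvg_lim R[i]^o (@norm_hausdorff _ _)).
Qed.

Definition acsum u := cvgn (series (fun n => cabs (u n))).

Lemma acsum_has u : acsum u -> has_csum u (csum u).
Proof.
move=> h.
have hr : cvgn (series (fun n => complex.Re (u n))).
  apply: normed_cvg; apply: series_le_cvg h => n /=; rewrite ?cabs_ge0//.
  exact: Re_le_cabs.
have hi : cvgn (series (fun n => complex.Im (u n))).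
  apply: normed_cvg; apply: series_le_cvg h => n /=; rewrite ?cabs_ge0//.
  exact: Im_le_cabs.
set l := limn (series (fun n => complex.Re (u n))) +i* limn (series (fun n => complex.Im (u n))).
suff hl : has_csum u l by rewrite (csum_unique hl).
by apply/has_csumP.
Qed.

Lemma has_csumD u v l m : has_csum u l -> has_csum v m ->
  has_csum (fun n => u n + v n) (l + m).
Proof.
move=> /has_csumP[a b] /has_csumP[c d]; apply/has_csumP; split.
  rewrite cReD (_ : (fun n => complex.Re _) = (fun n => complex.Re (u n)) + (fun n => complex.Re (v n))).
    by rewrite seriesD; exact: cvgD.
  by apply/funext => n /=; rewrite cReD.
rewrite cImD (_ : (fun n => complex.Im _) = (fun n => complex.Im (u n)) + (fun n => complex.Im (v n))).
  by rewrite seriesD; exact: cvgD.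
by apply/funext => n /=; rewrite cImD.
Qed.

Lemma has_csumZ u l c : has_csum u l -> has_csum (fun n => c * u n) (c * l).
Proof.
rewrite /has_csum => h.
rewrite (_ : series _ = (fun=> c) \* series u).
  by apply: (@cvgM R[i]) h; exact: cvg_cst.
by apply/funext => n; rewrite /series/= mulr_sumr.
Qed.

Lemma has_csum0 : has_csum (fun=> 0) (0 : R[i]).
Proof.
rewrite /has_csum (_ : series _ = fun=> 0); first exact: cvg_cst.
by apply/funext => n; rewrite /series/= big1.
Qed.

Lemma has_csum_sum N (u : nat -> nat -> R[i]) (l : nat -> R[i]) :
  (forall i, (i < N)%N -> has_csum (u i) (l i)) ->
  has_csum (fun n => \sum_(0 <= i < N) u i n) (\sum_(0 <= i < N) l i).
Proof.
elim: N => [_|N ih h].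
  rewrite big_geq//; under [X in has_csum X]eq_fun do rewrite big_geq//.
  exact: has_csum0.
rewrite big_nat_recr//=; under [X in has_csum X]eq_fun do rewrite big_nat_recr//=.
by apply: has_csumD; [apply: ih => i iN; apply: h; exact: ltnW|exact: h].
Qed.

Lemma cabs_csum_le u l (v : nat -> R) s : (forall n, cabs (u n) <= v n) ->
  has_csum u l -> series v @ \oo --> s -> cabs l <= s.
Proof.
move=> uv /cvgrPdist_lt h vs; apply/ler_addgt0Pr => e e0.
have e0' : 0 < e%:C by rewrite ltcR.
have [N _ hN] := h _ e0'.
have hlim : series v N <= s.
  rewrite -(cvg_lim _ vs)//; apply: nondecreasing_cvgn_le.
    apply/nondecreasing_seqP => n; rewrite seriesSr lerDl.
    by rewrite (le_trans _ (uv n))// cabs_ge0.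
  by apply/cvg_ex; exists s.
have := hN N (leqnn N); rewrite /= cabsE ltcR => h1.
rewrite -[l](subrK (series u N)) (le_trans (cabsD _ _))//.
rewrite addrC lerD//; last exact: ltW.
apply: le_trans hlim.
by rewrite /series/= (le_trans (cabs_sum _ _ _))// ler_sum.
Qed.

Lemma acsum_le u (v : nat -> R) : (forall n, cabs (u n) <= v n) ->
  cvgn (series v) -> acsum u.
Proof.
move=> uv; apply: series_le_cvg => // n; rewrite ?cabs_ge0//.
by rewrite (le_trans _ (uv n))// cabs_ge0.
Qed.

Lemma has_csum_real (f : nat -> R) (l : R) : series f @ \oo --> l ->
  has_csum (fun n => (f n)%:C) l%:C.
Proof.
move=> h; apply/has_csumP; split => //=.
rewrite (_ : series _ = fun=> 0); first exact: cvg_cst.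
by apply/funext => n; rewrite /series/= big1.
Qed.

Lemma eq_has_csum u v l : u =1 v -> has_csum u l -> has_csum v l.
Proof. by move=> /funext ->. Qed.

End ComplexSeries.

(** * Tannery's theorem and the Cauchy product *)

Section Tannery.
Variable R : realType.

Lemma nneg_series_le (v : nat -> R) N : (forall i, 0 <= v i) -> cvgn (series v) ->
  series v N <= limn (series v).
Proof.
move=> v0 cv; apply: nondecreasing_cvgn_le => //.
by apply/nondecreasing_seqP => n; rewrite seriesSr lerDl.
Qed.

Lemma cvg_series_sum_le (u : nat -> R) (B : R) : (forall i, 0 <= u i) ->
  (forall n, series u n <= B) -> cvgn (series u).
Proof.
move=> u0 uB; apply: nondecreasing_is_cvgn.
  by apply/nondecreasing_seqP => n; rewrite seriesSr lerDl.
by exists B => _ [n _ <-].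
Qed.

(** Split at K with the tail of [v] below e / 4: the K leading terms converge one by one, and the
    tails of both series are bounded by the tail of [v], uniformly in N. *)
Lemma tannery (f : nat -> nat -> R) (l v : nat -> R) :
  (forall N i, `|f N i| <= v i) -> cvgn (series v) ->
  (forall i, f ^~ i @ \oo --> l i) ->
  (fun N => limn (series (f N))) @ \oo --> limn (series l).
Proof.
move=> fv cv fl.
have v0 i : 0 <= v i by apply: le_trans (fv 0%N i).
have lv i : `|l i| <= v i.
  have h : (fun N => `|f N i|) @ \oo --> `|l i| by exact: cvg_norm.
  rewrite -(cvg_lim _ h)//; apply: limr_le; first by apply/cvg_ex; exists `|l i|.
  by apply: nearW => N; exact: fv.
have cf N : cvgn (series (f N)).
  by apply: normed_cvg; apply: series_le_cvg cv => n /=.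
have cl : cvgn (series l).
  by apply: normed_cvg; apply: series_le_cvg cv => n /=.
apply/cvgrPdist_lt => e e0.
have e4 : 0 < e / 4 by rewrite divr_gt0.
have /cvgrPdist_lt/(_ _ e4)[K _ hK] := cv.
have {}hK := hK K (leqnn K).
have hd : (fun N => \sum_(0 <= i < K) `|f N i - l i|) @ \oo --> \sum_(0 <= i < K) (0 : R).
  apply: cvg_big => [|i _]; first exact: add_continuous.
  rewrite -(@normr0 _ R) -(subrr (l i)); apply: cvg_norm; apply: cvgB (fl i) _.
  exact: cvg_cst.
have /cvgrPdist_lt/(_ _ e4) := hd; rewrite big1//.
apply: filterS => N; rewrite sub0r normrN => hN.
have tail (g : nat -> R) : (forall i, `|g i| <= v i) -> cvgn (series g) ->
    `|limn (series g) - series g K| <= limn (series v) - series v K.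
  move=> gv cg.
  have h : (fun n => `|series g n - series g K|) @ \oo --> `|limn (series g) - series g K|.
    by apply: cvg_norm; apply: cvgB => //; exact: cvg_cst.
  rewrite -(cvg_lim _ h)//; apply: limr_le; first by apply/cvg_ex; eexists; exact: h.
  exists K => // n /= Kn; rewrite sub_series_geq//.
  apply: le_trans (_ : series v n - series v K <= _); last first.
    by rewrite lerD2r nneg_series_le.
  rewrite sub_series_geq// (le_trans (ler_norm_sum _ _ _))//.
  by apply: ler_sum => i _; exact: gv.
have h1 := tail _ (fv N) (cf N).
have h2 := tail _ lv cl.
have h3 : `|series (f N) K - series l K| <= e / 4.
  rewrite /series/= -sumrB (le_trans (ler_norm_sum _ _ _))//.
  by rewrite ltW// (le_lt_trans (ler_norm _)).
have hv : limn (series v) - series v K < e / 4 by rewrite (le_lt_trans (ler_norm _)).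
set A := limn _ in h2 *; set B := limn _ in h1 *.
rewrite (_ : A - B = (A - series l K) - (B - series (f N) K) -
  (series (f N) K - series l K)); last by ring.
rewrite (le_lt_trans (ler_normB _ _))//.
have := ler_normB (A - series l K) (B - series (f N) K).
lra.
Qed.

Lemma lim_series_finite (f : nat -> R) N : (forall i, (N <= i)%N -> f i = 0) ->
  limn (series f) = \sum_(0 <= i < N) f i.
Proof.
move=> h; apply: cvg_lim => //; apply: (cvg_near_cst (\sum_(0 <= i < N) f i)).
exists N => // n /= Nn; rewrite /series/= (big_cat_nat (n := N))//= [X in _ + X]big_nat_cond.
by rewrite [X in _ + X]big1 ?addr0// => i /andP[/andP[Ni _] _]; rewrite h.
Qed.

Lemma sum_conv (A : pzRingType) (u v : nat -> A) N :
  \sum_(0 <= n < N) \sum_(0 <= i < n.+1) u i * v (n - i)%N =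
  \sum_(0 <= i < N) u i * series v (N - i)%N.
Proof.
elim: N => [|N ih]; first by rewrite !big_geq.
rewrite big_nat_recr//= {}ih.
have -> : \sum_(0 <= i < N) u i * series v (N - i)%N =
    \sum_(0 <= i < N.+1) u i * series v (N - i)%N.
  by rewrite [RHS]big_nat_recr//= subnn [series v 0%N]big_geq// mulr0 addr0.
rewrite -big_split/=; apply: eq_big_nat => i /andP[_ iN].
by rewrite -mulrDr subSn// seriesSr.
Qed.

(** Mertens' argument: by [sum_conv] the N-th partial sum differs from [series u N * V] by the sum
    of [u i] times the error of [series v (N - i)]. Each such term tends to 0 and is dominated by
    [cabs (u i) * M], so [tannery] applies. *)
Lemma cauchy_product (u v : nat -> R[i]) : acsum u -> acsum v ->
  has_csum (fun n => \sum_(0 <= i < n.+1) u i * v (n - i)%N) (csum u * csum v).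
Proof.
move=> cu cv.
have hu := acsum_has cu; have hv := acsum_has cv.
set V := csum v in hv *.
pose M := limn (series (fun n => cabs (v n))) + cabs V.
have Vb n : cabs (series v n - V) <= M.
  rewrite (le_trans (cabsB _ _))// lerD2r.
  apply: le_trans (_ : series (fun n => cabs (v n)) n <= _).
    by rewrite /series/= cabs_sum.
  by apply: nneg_series_le => // i; exact: cabs_ge0.
have M0 : 0 <= M by apply: le_trans (Vb 0%N); exact: cabs_ge0.
(* Padding by 0 beyond N turns the finite sums of varying length into series on a fixed index
   set. *)
pose f N i := if (i < N)%N then cabs (u i) * cabs (series v (N - i)%N - V) else 0.
have fcv : (fun N => limn (series (f N))) @ \oo --> limn (series (fun=> 0 : R)).
  apply: (tannery (v := fun i => cabs (u i) * M)).
  - move=> N i; rewrite /f; case: ifP => _; last by rewrite normr0 mulr_ge0 ?cabs_ge0.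
    by rewrite ger0_norm ?mulr_ge0 ?cabs_ge0// ler_wpM2l ?cabs_ge0.
  - have := @is_cvg_seriesZ _ _ M cu; rewrite (_ : _ *: _ = fun i => cabs (u i) * M)//.
    by apply/funext => i /=; rewrite mulrC.
  - move=> i.
    have h : (fun N => cabs (u i) * cabs (series v (N - i)%N - V)) @ \oo --> (0:R).
      rewrite -(mulr0 (cabs (u i))); apply: cvgM; first exact: cvg_cst.
      apply/cvgrPdist_lt => e e0.
      have e0' : 0 < e%:C by rewrite ltcR.
      have /cvgrPdist_lt/(_ _ e0')[K _ hK] := hv.
      exists (K + i)%N => // n /= Kn.
      have Kn' : (K <= n - i)%N by rewrite leq_subRL ?(leq_trans _ Kn) ?leq_addl// addnC.
      have := hK _ Kn'; rewrite /= cabsE ltcR sub0r normrN ger0_norm ?cabs_ge0//.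
      by rewrite -cabsN opprB.
    apply: cvg_trans h; apply: near_eq_cvg; exists i.+1 => // n /= ni.
    by rewrite /f ni.
have l0 : limn (series (fun=> 0 : R)) = 0.
  by rewrite (lim_series_finite (f := fun=> 0) (N := 0%N))// big_geq.
rewrite l0 in fcv.
rewrite /has_csum; apply/cvgrPdist_lt => e; rewrite ltcE => /andP[/eqP ie re].
have -> : e = (complex.Re e)%:C by apply: complexP.
have e2 : 0 < complex.Re e / 2 by rewrite divr_gt0.
have /cvgrPdist_lt/(_ _ e2) hf := fcv.
have e3 : 0 < complex.Re e / 2 / (cabs V + 1) by rewrite divr_gt0// ltr_wpDl ?cabs_ge0.
have e3' : 0 < (complex.Re e / 2 / (cabs V + 1))%:C by rewrite ltcR.
have /cvgrPdist_lt/(_ _ e3') hu' := hu.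
apply: filterS2 hf hu' => N.
rewrite sub0r normrN (lim_series_finite (N := N)); last first.
  by move=> i Ni; rewrite /f ltnNge Ni.
move=> h1; rewrite !cabsE !ltcR => h2.
rewrite {1}/series/= sum_conv.
have -> : csum u * V - \sum_(0 <= i < N) u i * series v (N - i)%N =
  (csum u - series u N) * V - \sum_(0 <= i < N) u i * (series v (N - i)%N - V).
  under [in RHS]eq_bigr do rewrite mulrBr.
  rewrite sumrB -mulr_suml -/(series u N).
  by rewrite mulrBl opprB addrA subrK.
rewrite (le_lt_trans (cabsB _ _))// [ltRHS]splitr ltr_leD//.
  rewrite cabsM (le_lt_trans (_ : _ <= cabs (csum u - series u N) * (cabs V + 1)))//.
    by rewrite ler_wpM2l ?cabs_ge0// lerDl.
  by rewrite -ltr_pdivlMr// ltr_wpDl ?cabs_ge0.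
apply: le_trans (ltW h1); apply: le_trans (ler_norm _).
rewrite (le_trans (cabs_sum _ _ _))// big_nat_cond [leRHS]big_nat_cond.
apply: ler_sum => i /andP[/andP[_ iN] _].
by rewrite cabsM /f iN.
Qed.

End Tannery.

(** * The binomial series *)

Section BinomialSeries.
Variable R : realType.
Implicit Types (s x z w : R[i]) (r : R).

Lemma ratio_test (u : nat -> R) (q : R) N : (forall n, 0 <= u n) -> 0 < q < 1 ->
  (forall n, (N <= n)%N -> u n.+1 <= q * u n) -> cvgn (series u).
Proof.
move=> u0 /andP[q0 q1] h.
(* Summing instead of taking a maximum: the i-th summand alone gives [u i <= C * q ^+ i] for i <=
   N. *)
pose C := \sum_(i < N.+1) u i / q ^+ i.
have Ci i : (i <= N)%N -> u i <= C * q ^+ i.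
  rewrite -ltnS => iN; rewrite -ler_pdivrMr ?exprn_gt0// /C (bigD1 (Ordinal iN))//=.
    by rewrite lerDl sumr_ge0// => j _; rewrite divr_ge0 ?exprn_ge0// ltW.
have uC n : u n <= C * q ^+ n.
  have [nN|/ltnW Nn] := leqP n N; first exact: Ci.
  rewrite -(subnK Nn); elim: (n - N)%N => [|k ih]; first exact: Ci.
  rewrite addSn (le_trans (h _ (leq_addl _ _)))// exprS mulrCA ler_wpM2l//.
  exact: ltW.
apply: (series_le_cvg u0 _ uC) => [n|]; first exact: le_trans (u0 n) (uC n).
by apply: (@is_cvg_geometric_series R C q); rewrite ger0_norm// ltW.
Qed.

(** The coefficient of x^n in (1 - x)^(-s). *)
Definition bcoef s n : R[i] := pochhammer s n / n`!%:R.

Lemma pochhammerSr s n : pochhammer s n.+1 = pochhammer s n * (s + n%:R).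
Proof. by rewrite /pochhammer big_ord_recr. Qed.

Lemma pochhammerSl s n : pochhammer s n.+1 = s * pochhammer (s + 1) n.
Proof.
rewrite /pochhammer big_ord_recl/= addr0; congr (_ * _).
by apply: eq_bigr => i _; rewrite -addrA -natr1 [i%:R + 1]addrC.
Qed.

Lemma bcoef0 s : bcoef s 0 = 1.
Proof. by rewrite /bcoef /pochhammer big_ord0 fact0 divr1. Qed.

Lemma bcoefSr s n : bcoef s n.+1 = bcoef s n * (s + n%:R) / n.+1%:R.
Proof.
rewrite /bcoef pochhammerSr factS natrM invfM; set a := (n.+1%:R)^-1; set b := (n`!%:R)^-1; ring.
Qed.

Lemma bcoefSl s n : n.+1%:R * bcoef s n.+1 = s * bcoef (s + 1) n.
Proof.
rewrite /bcoef pochhammerSl factS natrM invfM.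
by rewrite -!mulrA mulrCA; congr (_ * _); rewrite mulrCA; congr (_ * _); rewrite mulVKf// pnatr_eq0.
Qed.

(** Pascal's rule, the coefficient form of (1 - x) (1 - x)^(-(s + 1)) = (1 - x)^(-s). *)
Lemma bcoef_sub s n : bcoef (s + 1) n.+1 - bcoef (s + 1) n = bcoef s n.+1.
Proof.
have h : (n.+1%:R : R[i]) != 0 by rewrite pnatr_eq0.
apply: (mulfI h); rewrite bcoefSl bcoefSr -natr1; field.
by rewrite natr1.
Qed.

Lemma acsum_binom s x : cabs x < 1 -> acsum (fun n => bcoef s n * x ^+ n).
Proof.
move=> x1; pose q := (cabs x + 1) / 2.
have q0 : 0 < q by rewrite divr_gt0// ltr_wpDl ?cabs_ge0.
have q1 : q < 1 by rewrite ltr_pdivrMr// mul1r (_ : 2 = 1 + 1)// ltrD2r.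
have xq : 0 < q - cabs x by rewrite /q; lra.
(* For n >= N this gives |s| <= (n + 1) (q - |x|), which makes the ratio (|s| + n) |x| / (n + 1) at
   most q. *)
pose N := Num.bound (cabs s / (q - cabs x)).
apply: (@ratio_test _ q N) => [n||n Nn]; [exact: cabs_ge0|by rewrite q0|].
rewrite bcoefSr exprS; move: (bcoef s n) => b'.
rewrite !cabsM cabsV cabs_nat cabsX.
set b := cabs b'; set X := cabs x.
have b0 : 0 <= b by exact: cabs_ge0.
have X0 : 0 <= X by exact: cabs_ge0.
rewrite (_ : b * _ / _ * _ = (cabs (s + n%:R) / n.+1%:R * X) * (b * X ^+ n)); last by ring.
rewrite ler_wpM2r ?mulr_ge0 ?exprn_ge0// mulrAC ler_pdivrMr ?ltr0n//.
have h1 : cabs (s + n%:R) <= cabs s + n%:R by rewrite (le_trans (cabsD _ _))// cabs_nat.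
have h2 : cabs s <= n.+1%:R * (q - X).
  rewrite -ler_pdivrMr// (le_trans (ltW (archi_boundP _)))//.
    by rewrite divr_ge0 ?cabs_ge0// ltW.
  by rewrite ler_nat -/N (leq_trans Nn).
apply: le_trans (ler_wpM2r X0 h1) _.
have s0 := cabs_ge0 s.
rewrite -natr1 mulrDl in h2 *.
have Xx : X < 1 by [].
nra.
Qed.

(** Differentiation along a real parameter is all that the binomial series needs, so the two
    components are treated as real functions. *)
Definition cderiv (f : R -> R[i]) r (l : R[i]) :=
  is_derive r 1 (fun t => complex.Re (f t)) (complex.Re l) /\
  is_derive r 1 (fun t => complex.Im (f t)) (complex.Im l).

Lemma eq_cderiv (f g : R -> R[i]) r l m : f =1 g -> l = m -> cderiv f r l -> cderiv g r m.
Proof. by move=> /funext -> ->. Qed.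

Lemma cderivM f g r l m : cderiv f r l -> cderiv g r m ->
  cderiv (fun t => f t * g t) r (l * g r + f r * m).
Proof.
move=> [fr fi] [gr gi]; split.
  under [X in is_derive _ _ X]eq_fun do rewrite cReM.
  apply: is_derive_eq; rewrite /= !(cReD, cReM) /GRing.scale/=; ring.
under [X in is_derive _ _ X]eq_fun do rewrite cImM.
by apply: is_derive_eq; rewrite /= !(cImD, cImM) /GRing.scale/=; ring.
Qed.

Lemma cderiv_cexp f r l : cderiv f r l ->
  cderiv (fun t => cexp (f t)) r (l * cexp (f r)).
Proof.
move=> [fr fi].
have he := @is_derive1_comp _ _ _ _ _ _ (is_derive_expR (complex.Re (f r))) fr.
have hc := @is_derive1_comp _ _ _ _ _ _ (is_derive_cos (complex.Im (f r))) fi.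
have hs := @is_derive1_comp _ _ _ _ _ _ (is_derive_sin (complex.Im (f r))) fi.
split.
  rewrite (_ : (fun t => _) = (fun t => (expR \o (fun t => complex.Re (f t))) t *
      (cos \o (fun t => complex.Im (f t))) t)); last first.
    by apply/funext => t; rewrite /cexp cReM/= mul0r subr0.
  by apply: is_derive_eq; rewrite /cexp !(cReM, cImM) /GRing.scale/=; ring.
rewrite (_ : (fun t => _) = (fun t => (expR \o (fun t => complex.Re (f t))) t *
      (sin \o (fun t => complex.Im (f t))) t)); last first.
  by apply/funext => t; rewrite /cexp cImM/= mul0r addr0.
by apply: is_derive_eq; rewrite /cexp !(cReM, cImM) /GRing.scale/=; ring.
Qed.

Lemma cderiv0_eq (f : R -> R[i]) : (forall r, 0 <= r <= 1 -> cderiv f r 0) -> f 1 = f 0.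
Proof.
move=> h.
have aux (g : R -> R) : (forall r, 0 <= r <= 1 -> is_derive r 1 g (0 : R)) -> g 1 = g 0.
  move=> hg.
  have [||c _] := @MVT _ g (fun=> 0) 0 1 ltr01.
  - by move=> x; rewrite in_itv/= => /andP[x0 x1]; apply: hg; rewrite !ltW.
  - apply: derivable_within_continuous => x; rewrite in_itv/= => /hg hx.
    exact: ex_derive.
  by rewrite mul0r => /eqP; rewrite subr_eq0 => /eqP.
apply: complexP; [apply: (aux (fun t => complex.Re (f t)))|apply: (aux (fun t => complex.Im (f t)))] => r /h[]//.
Qed.

Lemma cexpD z w : cexp (z + w) = cexp z * cexp w.
Proof.
rewrite /cexp cReD cImD expRD cosD sinD; apply: complexP;
  by rewrite !(cReM, cImM)/=; ring.
Qed.

Lemma cexp0 : cexp 0 = 1 :> R[i].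
Proof. by rewrite /cexp/= expR0 cos0 sin0 mul1r. Qed.

Lemma cexp_neq0 z : cexp z != 0.
Proof.
apply/eqP => h; have := cexp0; rewrite -(subrr z) cexpD h mul0r => /eqP.
by rewrite eq_sym oner_eq0.
Qed.

Lemma cexpN z : cexp (- z) = (cexp z)^-1.
Proof. by apply: (mulIf (cexp_neq0 z)); rewrite -cexpD addNr cexp0 mulVf// cexp_neq0. Qed.

Lemma cabs_cexp z : cabs (cexp z) = expR (complex.Re z).
Proof.
apply/eqP; rewrite -(@eqrXn2 _ 2) ?cabs_ge0 ?expR_ge0// sqr_cabs /cexp cReM cImM/=.
by rewrite !mul0r subr0 addr0 !exprMn -mulrDr cos2Dsin2 mulr1.
Qed.

Lemma cabs_gt0 z : (0 < cabs z) = (z != 0).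
Proof. by rewrite lt_def cabs_ge0 andbT cabs_eq0. Qed.

(** On the right half-plane the logarithm takes a form that can be differentiated, whereas [carg] is
    an acos with a case split along the real axis. *)
Lemma clog_right z : 0 < complex.Re z ->
  clog z = (ln (complex.Re z ^+ 2 + complex.Im z ^+ 2) / 2) +i* atan (complex.Im z / complex.Re z).
Proof.
move=> z0; set x := complex.Re z in z0 *; set y := complex.Im z.
have z1 : z != 0 by apply/eqP => h; move: z0; rewrite /x h ltxx.
have c0 : 0 < cabs z by rewrite cabs_gt0.
have hc : ln (cabs z) = ln (x ^+ 2 + y ^+ 2) / 2.
  by rewrite -sqr_cabs lnXn//; field.
rewrite /clog -/(cabs z) hc; congr (_ +i* _).
rewrite /carg -/(cabs z) -/x -/y.
have cT : cos (atan (y / x)) = x / cabs z.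
  rewrite cos_atan; apply/eqP; rewrite -(@eqrXn2 _ 2)//; last by rewrite divr_ge0// ltW.
    rewrite exprVn sqr_sqrtr; last by rewrite addr_ge0// sqr_ge0.
    rewrite [X in _ == X]expr_div_n sqr_cabs -/x -/y; apply/eqP; field.
    by rewrite !gt_eqF// ?exprn_gt0// ltr_pwDl ?exprn_gt0 ?sqr_ge0.
have := atan_gtNpi2 (y / x); have := atan_ltpi2 (y / x) => h1 h2.
have pi0 := @pi_gt0 R.
rewrite -cT; case: ifPn => y0.
  apply: cosK; rewrite in_itv/= -{1}(@atan0 R).
  apply/andP; split; first by apply: le_atan; rewrite divr_ge0// ltW.
  lra.
rewrite cosKN ?opprK//; apply/andP; split; first lra.
rewrite -(@atan0 R); apply: le_atan.
by rewrite -ltNge in y0; rewrite ltW// pmulr_llt0// invr_gt0.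
Qed.

(** The function differentiated is log (1 - t (a + i b)), in the form given by [clog_right]. *)
Lemma cderiv_clog (a b r : R) : 0 < 1 - r * a ->
  let z t : R[i] := (1 - t * a) +i* (- (t * b)) in
  cderiv (fun t => (ln ((1 - t * a) ^+ 2 + (t * b) ^+ 2) / 2)
                +i* atan (- (t * b) / (1 - t * a))) r (- (a +i* b) / z r).
Proof.
move=> x0 z.
have dx : is_derive r 1 (fun t => 1 - t * a) (- a).
  by apply: is_derive_eq; rewrite /GRing.scale/=; ring.
have dy : is_derive r 1 (fun t => t * b) b.
  by apply: is_derive_eq; rewrite /GRing.scale/=; ring.
have x1 : 1 - r * a != 0 by rewrite gt_eqF.
have n0 : 0 < (1 - r * a) ^+ 2 + (r * b) ^+ 2.
  by rewrite ltr_pwDl ?exprn_gt0 ?sqr_ge0.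
have zinv : (z r)^-1 = ((1 - r * a) / ((1 - r * a) ^+ 2 + (r * b) ^+ 2))
    +i* ((r * b) / ((1 - r * a) ^+ 2 + (r * b) ^+ 2)).
  have -> : (z r)^-1 = ((1 - r * a) / ((1 - r * a) ^+ 2 + (- (r * b)) ^+ 2))
    +i* (- - (r * b) / ((1 - r * a) ^+ 2 + (- (r * b)) ^+ 2)).
    by apply: complexP => /=; rewrite ?mulNr.
  by rewrite sqrrN opprK.
rewrite zinv; split => /=.
  have dn : is_derive r 1 (fun t => (1 - t * a) ^+ 2 + (t * b) ^+ 2)
      (- (2 * a * (1 - r * a)) + 2 * b * (r * b)).
    by apply: is_derive_eq; rewrite /GRing.scale/=; ring.
  have dl := @is_derive1_comp _ (@ln R) (fun t => (1 - t * a) ^+ 2 + (t * b) ^+ 2) r _ _ (is_derive1_ln n0) dn.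
  rewrite (_ : (fun t => _) = (2^-1 : R) \*: ((@ln R) \o (fun t => (1 - t * a) ^+ 2 + (t * b) ^+ 2))).
    by apply: is_derive_eq; rewrite /GRing.scale/=; field; rewrite gt_eqF.
  by apply/funext => t /=; rewrite mulrC.
have dv := @is_deriveV R (fun t => 1 - t * a) r (- a) 1 x1 dx.
have dq : is_derive r 1 (fun t => - (t * b) / (1 - t * a))
   ((- b * (1 - r * a) - (- (r * b)) * (- a)) / (1 - r * a) ^+ 2).
  by apply: is_derive_eq; rewrite /GRing.scale/=; field.
have da := @is_derive1_comp _ (@atan R) (fun t => - (t * b) / (1 - t * a)) r _ _ (is_derive1_atan _) dq.
rewrite (_ : (fun t => _) = (@atan R) \o (fun t => - (t * b) / (1 - t * a)))//.
apply: is_derive_eq.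
rewrite /GRing.scale/=; field; rewrite x1 gt_eqF//= andbT; apply/eqP.
Qed.

Lemma cderiv_cst c r : cderiv (fun=> c) r 0.
Proof. by split; exact: is_derive_cst. Qed.

Definition cpser (a : nat -> R[i]) (t : R) : R[i] :=
  limn (pseries (fun n => complex.Re (a n)) t)
  +i* limn (pseries (fun n => complex.Im (a n)) t).

Lemma acsum_pseries (a : nat -> R[i]) t : acsum (fun n => a n * t%:C ^+ n) ->
  cvgn (pseries (fun n => complex.Re (a n)) t) /\
  cvgn (pseries (fun n => complex.Im (a n)) t).
Proof.
move=> /acsum_has/has_csumP[hr hi].
split; [move: hr => /cvgP; congr (cvgn (series _))|move: hi => /cvgP; congr (cvgn (series _))];
  by apply/funext => n; rewrite /= -rmorphXn/= (cReMr, cImMr).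
Qed.

Lemma cpserE (a : nat -> R[i]) t : acsum (fun n => a n * t%:C ^+ n) ->
  has_csum (fun n => a n * t%:C ^+ n) (cpser a t).
Proof.
move=> h; have [hr hi] := acsum_pseries h.
apply/has_csumP; split => /=.
  rewrite (_ : (fun n => _) = (fun n => complex.Re (a n) * t ^+ n))//.
  by apply/funext => n; rewrite -rmorphXn/= cReMr.
rewrite (_ : (fun n => _) = (fun n => complex.Im (a n) * t ^+ n))//.
by apply/funext => n; rewrite -rmorphXn/= cImMr.
Qed.

Definition cdiffs (a : nat -> R[i]) n := n.+1%:R * a n.+1.

Lemma cRe_nat n z : complex.Re (n%:R * z) = n%:R * complex.Re z.
Proof. by rewrite mulrC -(rmorph_nat (real_complex R)) cReMr mulrC. Qed.
Lemma cIm_nat n z : complex.Im (n%:R * z) = n%:R * complex.Im z.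
Proof. by rewrite mulrC -(rmorph_nat (real_complex R)) cImMr mulrC. Qed.

Lemma cderiv_cpser (a : nat -> R[i]) K r :
  acsum (fun n => a n * K%:C ^+ n) ->
  acsum (fun n => cdiffs a n * K%:C ^+ n) ->
  acsum (fun n => cdiffs (cdiffs a) n * K%:C ^+ n) ->
  `|r| < `|K| -> cderiv (cpser a) r (cpser (cdiffs a) r).
Proof.
move=> /acsum_pseries[h0 h0'] /acsum_pseries[h1 h1'] /acsum_pseries[h2 h2'] rK.
have dr b : (fun n => complex.Re (cdiffs b n)) = pseries_diffs (fun n => complex.Re (b n)).
  by apply/funext => n; rewrite /cdiffs cRe_nat.
have di b : (fun n => complex.Im (cdiffs b n)) = pseries_diffs (fun n => complex.Im (b n)).
  by apply/funext => n; rewrite /cdiffs cIm_nat.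
rewrite !dr in h1 h2; rewrite !di in h1' h2'.
split => /=; first by rewrite dr; exact: pseries_snd_diffs h0 h1 h2 rK.
by rewrite di; exact: pseries_snd_diffs h0' h1' h2' rK.
Qed.

Lemma has_csum_shift (u : nat -> R[i]) l : has_csum u l ->
  has_csum (fun n => if n is k.+1 then u k else 0) l.
Proof.
rewrite /has_csum => h; rewrite -(cvg_shiftS (series _)).
rewrite (_ : (fun n => _) = series u)//; apply/funext => n.
by rewrite /series/= big_nat_recl//= add0r.
Qed.

Lemma binom_rec s x : cabs x < 1 ->
  csum (fun n => bcoef s n * x ^+ n) = (1 - x) * csum (fun n => bcoef (s + 1) n * x ^+ n).
Proof.
move=> x1; apply: csum_unique.
have h := acsum_has (@acsum_binom (s + 1) x x1).
have h2 := has_csumD h (@has_csumZ R _ _ (- x) (has_csum_shift h)).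
rewrite mulrDl mul1r; apply: eq_has_csum h2 => -[|n].
  by rewrite mulr0 addr0 !bcoef0.
rewrite -[bcoef s n.+1]bcoef_sub exprS.
move: (bcoef (s + 1) n.+1) (bcoef (s + 1) n) (x ^+ n) => A B X.
by rewrite mulNr mulrBl; congr (_ - _); rewrite mulrCA.
Qed.

(** For 0 <= t <= 1 the sum F(t) of [a s n] t^n satisfies (1 - x t) F' = s x F, by [bcoefSl] and
    [binom_rec]. Hence F(t) exp(s log (1 - x t)) has derivative 0 and keeps its value 1 at t = 0. *)
Lemma binom_series s x : cabs x < 1 ->
  csum (fun n => bcoef s n * x ^+ n) = cpow (1 - x) (- s).
Proof.
move=> x1.
pose a s n := bcoef s n * x ^+ n.
have aE s' t : (fun n => a s' n * t%:C ^+ n) = (fun n => bcoef s' n * (x * t%:C) ^+ n).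
  by apply/funext => n; rewrite /a -mulrA -exprMn.
(* A radius K > 1 with |x| K < 1: termwise differentiation at t = 1 needs convergence beyond 1. *)
pose K := 2 / (1 + cabs x).
have d0 : 0 < 1 + cabs x by rewrite ltr_wpDr ?cabs_ge0.
have K0 : 0 < K by rewrite divr_gt0.
have K1 : 1 < K by rewrite ltr_pdivlMr// mul1r (_ : 2 = 1 + 1)// ltrD2l.
have xK : cabs x * K < 1.
  by rewrite /K mulrA ltr_pdivrMr// mul1r mulr_natr mulr2n ltrD2r.
have hK s' : acsum (fun n => a s' n * K%:C ^+ n).
  by rewrite aE; apply: acsum_binom; rewrite cabsM cabsR gtr0_norm.
have xt t : 0 <= t <= 1 -> cabs (x * t%:C) < 1.
  move=> /andP[t0 t1]; rewrite cabsM cabsR ger0_norm//.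
  by rewrite (le_lt_trans _ x1)// ler_piMr ?cabs_ge0.
have ht s' t : 0 <= t <= 1 -> acsum (fun n => a s' n * t%:C ^+ n).
  by move=> t01; rewrite aE; apply: acsum_binom; exact: xt.
have acsumZ c (u : nat -> R[i]) : acsum u -> acsum (fun n => c * u n).
  rewrite /acsum => /(@is_cvg_seriesZ _ _ (cabs c)).
  by congr (cvgn (series _)); apply/funext => n; rewrite cabsM.
have da s' n : cdiffs (a s') n = s' * x * a (s' + 1) n.
  rewrite /cdiffs /a exprS mulrA bcoefSl; move: (bcoef _ _) (x ^+ n) => A X.
  by rewrite -!mulrA; congr (_ * _); rewrite mulrCA.
have dda s' n : cdiffs (cdiffs (a s')) n = (s' * x * ((s' + 1) * x)) * a (s' + 1 + 1) n.
  transitivity (s' * x * cdiffs (a (s' + 1)) n); first by rewrite {1}/cdiffs da mulrCA.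
  by rewrite da mulrA.
have hd t : 0 <= t <= 1 -> cderiv (cpser (a s)) t (cpser (cdiffs (a s)) t).
  move=> /andP[t0 t1]; apply: (@cderiv_cpser _ K) => //.
  - have := acsumZ (s * x) _ (hK (s + 1)); congr (acsum _); apply/funext => n.
    by rewrite da mulrA.
  - have := acsumZ (s * x * ((s + 1) * x)) _ (hK (s + 1 + 1)).
    by congr (acsum _); apply/funext => n; rewrite dda mulrA.
  - by rewrite ger0_norm// gtr0_norm// (le_lt_trans t1).
pose L (t : R) : R[i] := (ln ((1 - t * complex.Re x) ^+ 2 + (t * complex.Im x) ^+ 2) / 2)
   +i* atan (- (t * complex.Im x) / (1 - t * complex.Re x)).
have hx t : 0 <= t <= 1 -> 0 < 1 - t * complex.Re x.
  move=> /xt h; rewrite subr_gt0 (le_lt_trans _ h)// (le_trans _ (Re_le_cabs _))//.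
  by rewrite cReMr mulrC ler_norm.
have := @cderiv0_eq (fun t => cpser (a s) t * cexp (s * L t)).
have -> : cpser (a s) 0 = 1.
  have /cpserE/csum_unique <- := ht s 0 (introT andP (conj (lexx _) ler01)).
  apply: csum_unique; rewrite /has_csum.
  apply: (@cvg_near_cst _ R[i]^o); exists 1%N => // -[//|n] _ /=.
  rewrite /series/= big_nat_recl//= expr0 mulr1 /a bcoef0 expr0 mulr1.
  by rewrite big1 ?addr0// => i _; rewrite expr0n mulr0.
have -> : cexp (s * L 0) = 1.
  by rewrite /L !mul0r subr0 oppr0 expr1n expr0n addr0 ln1 !mul0r atan0 mulr0 cexp0.
have -> : cpser (a s) 1 = csum (fun n => bcoef s n * x ^+ n).
  have /cpserE/csum_unique <- := ht s 1 (introT andP (conj ler01 (lexx _))).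
  by rewrite aE rmorph1 mulr1.
have -> : L 1 = clog (1 - x).
  rewrite clog_right !(cReD, cImD, cReN, cImN)/=; last by have := hx 1; rewrite mul1r; apply; rewrite ler01 lexx.
  by rewrite /L !mul1r sub0r sqrrN.
move=> h; rewrite /cpow mulNr cexpN; apply: (mulIf (cexp_neq0 (s * clog (1 - x)))).
rewrite mulVf ?cexp_neq0// h ?mulr1// => t t01.
have dL := @cderiv_clog (complex.Re x) (complex.Im x) t (hx t t01).
have d1 := cderiv_cexp (cderivM (cderiv_cst s t) dL).
have := cderivM (hd t t01) d1; apply: eq_cderiv => //.
have <- : 1 - x * t%:C = (1 - t * complex.Re x) +i* (- (t * complex.Im x)).
  by apply: complexP; rewrite !(cReD, cImD, cReN, cImN, cReMr, cImMr)/= ?sub0r mulrC.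
have -> : - (complex.Re x +i* complex.Im x) = - x by congr (- _); apply: complexP.
have xt0 : 1 - x * t%:C != 0.
  rewrite subr_eq0; apply/eqP => h1; have := xt _ t01; rewrite -h1 cabs1 ltxx//.
have -> : cpser (a s) t = (1 - x * t%:C) * cpser (a (s + 1)) t.
  have /cpserE/csum_unique <- := ht s t t01.
  have /cpserE/csum_unique <- := ht (s + 1) t t01.
  by rewrite !aE binom_rec// xt.
have -> : cpser (cdiffs (a s)) t = s * x * cpser (a (s + 1)) t.
  have ha := cpserE (ht (s + 1) t t01).
  have /cpserE/csum_unique <- : acsum (fun n => cdiffs (a s) n * t%:C ^+ n).
    have := acsumZ (s * x) _ (ht (s + 1) t t01); congr (acsum _); apply/funext => n.
    by rewrite da mulrA.
  apply: csum_unique; apply: eq_has_csum (@has_csumZ R _ _ (s * x) ha) => n.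
  by rewrite da mulrA.
move: (cpser _ _) (cexp _) (1 - x * t%:C) xt0 => P G Z Z0.
by rewrite mul0r add0r mulNr mulrN !mulNr mulrN mulrCA [Z * _]mulrC; field.
Qed.

End BinomialSeries.

(** * The Gamma function *)

Section GammaIntegral.
Variable R : realType.
Implicit Types (q y s v c k : R).
Notation mu := (@lebesgue_measure R).

(** The exponent is y and not y - 1. The rate q makes [gint q y] a Laplace transform, equal to Gamma
    (y + 1) / q^(y + 1) for q > 0 and y >= 0. *)
Definition gker q y v : R := v `^ y * expR (- (q * v)).

Definition gint q y : \bar R := (\int[mu]_(v in `]0%R, +oo[) (gker q y v)%:E)%E.

Lemma gker_ge0 q y v : 0 <= gker q y v.
Proof. by rewrite mulr_ge0 ?powR_ge0 ?expR_ge0. Qed.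

Lemma measurable_gker q y (D : set R) : measurable_fun D (gker q y).
Proof.
apply: (measurable_funS measurableT) => //.
apply: measurable_funM; first exact: measurable_powR.
by apply: measurableT_comp => //; apply: measurableT_comp.
Qed.

Lemma measurable_gkerE q y (D : set R) : measurable_fun D (fun v => (gker q y v)%:E).
Proof. by apply/measurable_EFinP; exact: measurable_gker. Qed.

Lemma gint_ge0 q y : (0 <= gint q y)%E.
Proof. by apply: integral_ge0 => v _; rewrite lee_fin gker_ge0. Qed.

Lemma gint0 q : 0 < q -> gint q 0 = (q^-1)%:E.
Proof.
move=> q0.
have := integral_exponential_pdf q0.
have -> : (fun x => (exponential_pdf q x)%:E) =
    (EFin \o (fun x => q * expR (- q * x))) \_ `[0, +oo[ by rewrite restrict_EFin.
rewrite -integral_mkcond => h.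
rewrite /gint integral_itv_obnd_cbnd; last exact: measurable_gkerE.
rewrite -[RHS]mule1 -h -ge0_integralZl//=.
- by apply: eq_integral => v _ /=; rewrite -EFinM mulKf ?gt_eqF// /gker powRr0 mul1r mulNr.
- by apply/measurable_EFinP; apply: measurable_funM => //; apply: measurableT_comp.
- by move=> v _; rewrite lee_fin mulr_ge0 ?expR_ge0// ltW.
- by rewrite lee_fin invr_ge0 ltW.
Qed.

Lemma powR_le_expR y c : 0 <= y -> 0 < c ->
  exists2 C : R, 0 < C & forall v, 0 < v -> v `^ y <= C * expR (c * v).
Proof.
move=> y0 c0; pose N := Num.bound y.
have yN : y <= N.+1%:R.
  by rewrite (le_trans (ltW (archi_boundP y0)))// ler_nat leqnSn.
have cN : 0 < N.+1`!%:R / c ^+ N.+1 by rewrite divr_gt0 ?exprn_gt0// ltr0n fact_gt0.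
(* The summand 1 serves v <= 1; the other one serves v > 1, where v^y <= v^(N + 1) and (c v)^(N + 1)
   / (N + 1)! <= exp(c v). *)
exists (1 + N.+1`!%:R / c ^+ N.+1); first by rewrite addr_gt0.
move=> v v0.
have e1 : 1 <= expR (c * v) by rewrite -[leLHS](@expR0 R) ler_expR mulr_ge0// ltW.
have [v1|v1] := leP v 1.
  have h : v `^ y <= 1.
    by have := @ger_powR R v; rewrite v0 v1 => /(_ isT _ _ y0); rewrite powRr0.
  rewrite (le_trans h)// (le_trans e1)// ler_peMl ?expR_ge0// lerDl ltW//.
have h := ler_powR (ltW v1) yN; rewrite powR_mulrn ?(ltW v0)// in h.
apply: (le_trans h); have := @expR_ge1Dxn R (c * v) N (mulr_ge0 (ltW c0) (ltW v0)).
rewrite exprMn => h2.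
rewrite mulrDl mul1r ler_wpDl ?expR_ge0//.
rewrite -ler_pdivrMl// invf_div mulrAC (le_trans _ h2)// ler_wpDl//.
Qed.

Lemma gint_lty q y : 0 <= y -> 0 < q -> (gint q y < +oo)%E.
Proof.
move=> y0 q0; have q2 : 0 < q / 2 by rewrite divr_gt0.
have [C C0 hC] := powR_le_expR y0 q2.
apply: (@le_lt_trans _ _ (\int[mu]_(v in `]0%R, +oo[) (C%:E * (gker (q / 2) 0 v)%:E))%E).
  apply: ge0_le_integral => //.
  - by move=> v _; rewrite lee_fin gker_ge0.
  - exact: measurable_gkerE.
  - by apply: measurable_funeM; exact: measurable_gkerE.
  - move=> v /=; rewrite in_itv/= andbT => v0; rewrite -EFinM lee_fin /gker powRr0 mul1r.
    apply: (le_trans (ler_wpM2r (expR_ge0 _) (hC v v0))).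
    by rewrite -[leLHS]mulrA -expRD ler_pM2l// ler_expR; lra.
rewrite ge0_integralZl//; last 3 first.
- exact: measurable_gkerE.
- by move=> v _; rewrite lee_fin gker_ge0.
- by rewrite lee_fin ltW.
by rewrite -/(gint (q / 2) 0) gint0// -EFinM ltry.
Qed.

Lemma within_continuous_gker y : 0 <= y -> {within `[0, +oo[, continuous (gker 1 y)}.
Proof.
move=> y0; apply/continuous_within_itvcyP; split.
  move=> v; rewrite in_itv/= andbT => v0.
  apply: cvgM; last first.
    apply: (continuous_comp (f := fun v => - (1 * v))); last exact: continuous_expR.
    apply: cvgN; apply: cvgM; [exact: cvg_cst|exact: cvg_id].
  have : {for v, continuous (fun x : R => x `^ y)}.
    apply/differentiable_continuous/derivable1_diffP/derivable_powR.
    by rewrite in_itv/= v0.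
  by [].
apply: cvgM; last first.
  apply: cvg_at_right_filter.
  apply: (continuous_comp (f := fun v => - (1 * v))); last exact: continuous_expR.
  apply: cvgN; apply: cvgM; [exact: cvg_cst|exact: cvg_id].
move: y0; rewrite le_eqVlt => /predU1P[<-|y0].
  by under eq_fun do rewrite powRr0; rewrite powRr0; exact: cvg_cst.
by rewrite powR0 ?gt_eqF//; exact: powR_cvg0.
Qed.

Lemma gint_scale q y : 0 < q -> 0 <= y -> gint q y = ((q `^ (y + 1))^-1%:E * gint 1 y)%E.
Proof.
move=> q0 y0.
have dF v : (fun v => q * v)^`()%classic v = q.
  by rewrite derive1E; apply: derive_val; apply: is_derive_eq; rewrite /GRing.scale/= mulr1.
have h : (\int[mu]_(v in `[(q * 0)%R, +oo[) (gker 1 y v)%:E =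
   \int[mu]_(v in `[0%R, +oo[) (((gker 1 y \o (fun v => q * v)) * (fun v => q * v)^`()%classic) v)%:E)%E.
  apply: (@increasing_ge0_integration_by_substitutiony R (fun v => q * v) (gker 1 y) 0).
  - by move=> a b _ _ ab; rewrite ltr_pM2l.
  - by move=> v _; rewrite (_ : _^`()%classic = fun=> q); [exact: cvg_cst|apply/funext].
  - by rewrite (_ : _^`()%classic = fun=> q); [exact: is_cvg_cst|apply/funext].
  - by rewrite (_ : _^`()%classic = fun=> q); [exact: is_cvg_cst|apply/funext].
  - split => [v _|]; first exact: ex_derive.
    apply: cvg_at_right_filter; apply: cvgM; [exact: cvg_cst|exact: cvg_id].
  - exact: gt0_cvgMry.
  - by rewrite mulr0; exact: within_continuous_gker.
  - by move=> v _; rewrite gker_ge0.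
rewrite mulr0 in h.
rewrite /gint !integral_itv_obnd_cbnd; [|exact: measurable_gkerE|exact: measurable_gkerE].
rewrite h -ge0_integralZl//=.
- apply: eq_integral => v; rewrite inE/= in_itv/= andbT => v0.
  rewrite -EFinM; congr EFin; rewrite /GRing.mul/= -/(GRing.mul _ _) dF /gker.
  rewrite powRM ?(ltW q0)// powRD ?powRr1 ?(ltW q0)//; last first.
    by apply/implyP => _; rewrite gt_eqF.
  rewrite mul1r; field; rewrite gt_eqF//= gt_eqF// powR_gt0//.
- apply/measurable_EFinP; apply: measurable_funM; last first.
    by rewrite (_ : _^`()%classic = fun=> q); [exact: measurable_cst|apply/funext].
  apply: measurableT_comp; first exact: measurable_gker.
  by apply: measurable_funM.
- by move=> v _; rewrite lee_fin /GRing.mul/= mulr_ge0 ?gker_ge0// dF ltW.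
- by rewrite lee_fin invr_ge0 powR_ge0.
Qed.

(** Gamma shifted by one, as it occurs in [mittag_leffler]; for y >= 0 the integrand has no
    singularity at 0. *)
Definition Gam y : R := fine (gint 1 y).

Lemma GamE y : Gamma (y + 1) = Gam y.
Proof.
rewrite /Gamma /Gam /gint /Rintegral; congr fine; apply: eq_integral => v _.
by rewrite /gker addrK mul1r.
Qed.

Lemma gint1 y : 0 <= y -> gint 1 y = (Gam y)%:E.
Proof. by move=> y0; rewrite /Gam fineK// ge0_fin_numE ?gint_ge0// gint_lty. Qed.

Lemma gintE q y : 0 < q -> 0 <= y -> gint q y = ((q `^ (y + 1))^-1 * Gam y)%:E.
Proof. by move=> q0 y0; rewrite gint_scale// gint1. Qed.

(** The contribution of [M, M + 1] to the integral. As M is arbitrary, [Gam y] outgrows every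
    exponential in y, which makes the Mittag-Leffler series entire. *)
Lemma Gam_growth y M : 0 <= y -> 1 <= M -> M `^ y * expR (- (M + 1)) <= Gam y.
Proof.
move=> y0 M1; rewrite -lee_fin -gint1//.
have M0 : 0 < M by lra.
apply: (@le_trans _ _ (\int[mu]_(v in `[M, (M + 1)%R]) (gker 1 y v)%:E)%E); last first.
  apply: ge0_subset_integral => //; first exact: measurable_gkerE.
    by move=> v _; rewrite lee_fin gker_ge0.
  by move=> v /=; rewrite !in_itv/= => /andP[Mv _]; rewrite andbT (lt_le_trans M0).
apply: (@le_trans _ _ (\int[mu]_(v in `[M, (M + 1)%R]) (cst (M `^ y * expR (- (M + 1)))%:E v))%E).
  rewrite integral_cst//= lebesgue_measure_itv/= lte_fin ltrDl ltr01 -EFinB.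
  by rewrite addrAC subrr add0r mule1.
apply: ge0_le_integral => //.
- by move=> v _; rewrite lee_fin mulr_ge0 ?powR_ge0 ?expR_ge0.
- exact: measurable_gkerE.
move=> v /=; rewrite in_itv/= => /andP[Mv vM]; rewrite lee_fin /gker.
apply: ler_pM; rewrite ?powR_ge0 ?expR_ge0//.
  by apply: ge0_ler_powR => //; rewrite nnegrE; lra.
by rewrite ler_expR; lra.
Qed.

Lemma Gam_gt0 y : 0 <= y -> 0 < Gam y.
Proof.
move=> y0; apply: lt_le_trans (Gam_growth y0 (lexx 1)).
by rewrite mulr_gt0 ?powR_gt0 ?expR_gt0.
Qed.

Lemma le_small (A B c : R) : 0 <= A -> (forall k, 0 < k -> A * (1 - c * k) <= B) -> A <= B.
Proof.
move=> A0 h; apply/ler_addgt0Pr => e e0.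
pose k := e / (1 + A * `|c|).
have d0 : 0 < 1 + A * `|c| by rewrite ltr_wpDr// mulr_ge0.
have k0 : 0 < k by rewrite divr_gt0.
have := h k k0; rewrite mulrBr mulr1 lerBlDr => /le_trans; apply; rewrite lerD2l.
rewrite mulrA /k mulrA ler_pdivrMr// mulrC ler_pM2l//.
by have := ler_norm c; nra.
Qed.

Lemma integral_gker_lin q y (a b : R) q' y' : 0 < q -> 0 < q' -> 0 <= y -> 0 <= y' ->
  0 <= a -> 0 <= b ->
  (\int[mu]_(v in `]0%R, +oo[) ((a * gker q y v + b * gker q' y' v)%R)%:E
   = a%:E * gint q y + b%:E * gint q' y')%E.
Proof.
move=> q0 q0' y0 y0' a0 b0.
under eq_integral do rewrite EFinD !EFinM.
rewrite ge0_integralD//.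
- rewrite !ge0_integralZl//; try by move=> v _; rewrite lee_fin gker_ge0.
    exact: measurable_gkerE.
  exact: measurable_gkerE.
- by move=> v _; rewrite -EFinM lee_fin mulr_ge0// gker_ge0.
- by apply: measurable_funeM; exact: measurable_gkerE.
- by move=> v _; rewrite -EFinM lee_fin mulr_ge0// gker_ge0.
- by apply: measurable_funeM; exact: measurable_gkerE.
Qed.

Lemma measurable_gker_lin q y (a b : R) q' y' (D : set R) :
  measurable_fun D (fun v => (a * gker q y v + b * gker q' y' v)%:E).
Proof.
apply/measurable_EFinP; apply: measurable_funD; apply: measurable_funM => //;
  exact: measurable_gker.
Qed.

Lemma powRS v y : 0 < v -> v `^ (y + 1) = v * v `^ y.
Proof.
move=> v0; rewrite powRD ?powRr1 ?ltW// 1?mulrC//.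
by apply/implyP => _; rewrite gt_eqF.
Qed.

(* The inequalities  h v exp(-(1+h)v) <= exp(-v) - exp(-(1+h)v) <= h v exp(-v),
   integrated against v^y with 1 + h = exp k and then k -> 0, give the functional equation. *)
Lemma GamS y : 0 <= y -> Gam (y + 1) = (y + 1) * Gam y.
Proof.
move=> y0; have y1 : 0 <= y + 1 by rewrite addr_ge0.
have G0 := ltW (Gam_gt0 y0); have G1 := ltW (Gam_gt0 y1).
have key k : 0 < k -> let h := expR k - 1 in
    h * (expR (- (k * (y + 1 + 1))) * Gam (y + 1)) + expR (- (k * (y + 1))) * Gam y <= Gam y /\
    Gam y <= h * Gam (y + 1) + expR (- (k * (y + 1))) * Gam y.
  move=> k0 h.
  have h0 : 0 < h by rewrite subr_gt0 expR_gt1.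
  have hE : expR k = 1 + h by rewrite /h addrC subrK.
  have ek x : (expR k `^ x)^-1 = expR (- (k * x)) by rewrite -expRM expRN.
  have e0 := expR_gt0 k.
  split; rewrite -lee_fin.
  - have -> : ((h * (expR (- (k * (y + 1 + 1))) * Gam (y + 1)) +
       expR (- (k * (y + 1))) * Gam y)%:E = h%:E * gint (expR k) (y + 1) + 1%:E * gint (expR k) y)%E.
      by rewrite !gintE// !ek mul1e -EFinM -EFinD.
    rewrite -integral_gker_lin ?(ltW h0)// -gint1//; apply: ge0_le_integral => //.
    + by move=> v _; rewrite lee_fin addr_ge0// mulr_ge0 ?gker_ge0// ltW.
    + exact: measurable_gker_lin.
    + exact: measurable_gkerE.
    move=> v /=; rewrite in_itv/= andbT => v0; rewrite lee_fin /gker powRS// hE.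
    have -> : expR (- (1 * v)) = expR (- ((1 + h) * v)) * expR (h * v).
      by rewrite -expRD; congr expR; ring.
    have := expR_ge1Dx (h * v).
    have A := powR_ge0 v y; have B := expR_ge0 (- ((1 + h) * v)).
    have := mulr_ge0 A B; set P := v `^ y * _ => P0 C.
    have -> : v `^ y * (expR (- ((1 + h) * v)) * expR (h * v)) = P * expR (h * v) by rewrite mulrA.
    have -> : h * (v * v `^ y * expR (- ((1 + h) * v))) + 1 * P = P * (1 + h * v) by rewrite /P; ring.
    exact: ler_wpM2l.
  - have -> : ((h * Gam (y + 1) +
       expR (- (k * (y + 1))) * Gam y)%:E = h%:E * gint 1 (y + 1) + 1%:E * gint (expR k) y)%E.
      by rewrite !gintE// !ek mul1e powR1 invr1 mul1r -EFinM -EFinD.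
    rewrite -integral_gker_lin ?(ltW h0)// -gint1//; apply: ge0_le_integral => //.
    + by move=> v _; rewrite lee_fin gker_ge0.
    + exact: measurable_gkerE.
    + exact: measurable_gker_lin.
    move=> v /=; rewrite in_itv/= andbT => v0; rewrite lee_fin /gker powRS// hE.
    have -> : expR (- ((1 + h) * v)) = expR (- (1 * v)) * expR (- (h * v)).
      by rewrite -expRD; congr expR; ring.
    have := expR_ge1Dx (- (h * v)).
    have A := powR_ge0 v y; have B := expR_ge0 (- (1 * v)).
    have := mulr_ge0 A B; set P := v `^ y * _ => P0 C.
    have -> : h * (v * v `^ y * expR (- (1 * v))) + 1 * (v `^ y * (expR (- (1 * v)) * expR (- (h * v))))
      = P * (h * v + expR (- (h * v))) by rewrite /P; ring.
    by rewrite -[leLHS]mulr1 ler_wpM2l//; lra.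
apply/eqP; rewrite eq_le; apply/andP; split.
- apply: (@le_small _ _ (y + 1 + 1)) => // k k0; have [h1 _] := key k k0.
  have a1 := expR_ge1Dx (- (k * (y + 1 + 1))).
  have a2 := expR_ge1Dx (- (k * (y + 1))).
  have a3 := expR_ge1Dx k.
  set h := expR k - 1 in h1.
  have kh : k <= h by rewrite /h; lra.
  set E := expR (- (k * (y + 1 + 1))) in h1 a1; have E0 : 0 <= E by exact: expR_ge0.
  have b1 : k * (E * Gam (y + 1)) <= h * (E * Gam (y + 1)) by rewrite ler_wpM2r// mulr_ge0.
  have b2 : k * (E * Gam (y + 1)) <= k * ((y + 1) * Gam y).
    apply: (le_trans b1); have := ler_wpM2r G0 a2; lra.
  rewrite ler_pM2l// in b2; apply: le_trans b2; rewrite mulrC ler_wpM2r//; lra.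
- apply: (@le_small _ _ (y + 1 + 1)); first by rewrite mulr_ge0.
  move=> k k0; have [_ h1] := key k k0.
  have a1 := expR_ge1Dx (- k).
  set T := expR (- (k * (y + 1))) in h1.
  have T0 : 0 < T by exact: expR_gt0.
  have a2 : 1 - k * (y + 1) <= T by have := expR_ge1Dx (- (k * (y + 1))); rewrite -/T; lra.
  have a3 : (1 + k * (y + 1)) * T <= 1.
    by rewrite /T expRN ler_pdivrMr ?expR_gt0// mul1r expR_ge1Dx.
  set E := expR k in h1; have E0 : 0 < E by exact: expR_gt0.
  have a1' : (1 - k) * E <= 1.
    rewrite -ler_pdivlMr// mul1r /E -expRN; lra.
  set g0 := Gam y in h1 G0 *; set g1 := Gam (y + 1) in h1 G1 *; set s := y + 1 in a2 a3 *.
  (* For k >= 1 the left side is not positive. For k < 1, the bounds 1 - T >= k s T and E - 1 <= k E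
     give s T g0 <= E g1, and multiplying by 1 - k removes E because (1 - k) E <= 1. *)
  have [k1|k1] := leP 1 k.
    have : s * g0 * (1 - (s + 1) * k) <= 0.
      rewrite mulr_ge0_le0 ?mulr_ge0//.
      by have := mulr_ge0 y1 (ltW k0); rewrite -/s; lra.
    by move=> /le_trans; apply.
  have c1 : k * s * T * g0 <= (E - 1) * g1.
    have : (k * s * T) * g0 <= (1 - T) * g0 by rewrite ler_wpM2r//; lra.
    lra.
  have c2 : (E - 1) * g1 <= (k * E) * g1 by rewrite ler_wpM2r//; lra.
  have c3 : k * (s * T * g0) <= k * (E * g1) by lra.
  rewrite ler_pM2l// in c3.
  have k1' : 0 <= 1 - k by lra.
  have c4 : (1 - k) * (s * T * g0) <= (1 - k) * (E * g1) by rewrite ler_wpM2l.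
  have c5 : (1 - k) * (E * g1) <= g1.
    by rewrite mulrA -[leRHS]mul1r ler_wpM2r.
  apply: le_trans (le_trans c4 c5).
  have sg : 0 <= s * g0 by rewrite mulr_ge0.
  rewrite (_ : (1 - k) * (s * T * g0) = s * g0 * ((1 - k) * T)); last by ring.
  rewrite ler_wpM2l//.
  have : (1 - k) * (1 - k * s) <= (1 - k) * T by rewrite ler_wpM2l.
  have : 0 <= k * k * s by rewrite !mulr_ge0// ltW.
  lra.
Qed.

Lemma Gam0 : Gam 0 = 1.
Proof. by rewrite /Gam gint0// invr1. Qed.

Lemma Gam_nat n : Gam n%:R = n`!%:R.
Proof.
elim: n => [|n ih]; first by rewrite Gam0.
by rewrite -natr1 GamS// ih natr1 factS natrM.
Qed.

(** Jensen's inequality for the concave function v^s under the density v^y exp(-v) / [Gam y], whose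
    mean is y + 1: v^s lies below its tangent at c = y + 1. *)
Lemma Gam_interp y s : 0 <= y -> 0 <= s <= 1 -> Gam (y + s) <= (y + 1) `^ s * Gam y.
Proof.
move=> y0 /andP[s0 s1]; have c0 : 0 < y + 1 by rewrite ltr_wpDl.
have ys : 0 <= y + s by rewrite addr_ge0.
set c := y + 1 in c0 *.
have tangent v : 0 < v -> v `^ s <= c `^ s * (1 - s) + c `^ s * s / c * v.
  move=> v0.
  have -> : v `^ s = c `^ s * (v / c) `^ s.
    by rewrite -powRM ?divr_ge0 ?ltW// mulrC divfK// gt_eqF.
  have -> : c `^ s * (1 - s) + c `^ s * s / c * v = c `^ s * (1 - s + s * (v / c)) by ring.
  rewrite ler_wpM2l ?powR_ge0//; have w0 : 0 < v / c by rewrite divr_gt0.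
  set w := v / c in w0 *; set m := s * ln w.
  have -> : w `^ s = expR m by rewrite /powR gt_eqF.
  (* Weighted AM-GM: 1 + x <= exp x is taken at x = - m and x = ln w - m with weights 1 - s and s;
     the linear terms cancel since m = s ln w. *)
  have e1 := expR_ge1Dx (- m).
  have e2 := expR_ge1Dx (ln w - m).
  have e3 := expR_gt0 m.
  rewrite expRD lnK ?posrE// in e2.
  have e4 : expR m * expR (- m) = 1 by rewrite -expRD subrr expR0.
  have e5 : s * (1 + (ln w - m)) <= s * (w * expR (- m)) by rewrite ler_wpM2l.
  have e6 : (1 - s) * (1 - m) <= (1 - s) * expR (- m) by rewrite ler_wpM2l// subr_ge0.
  have e7 : 1 <= (1 - s + s * w) * expR (- m) by rewrite /m in e5 e6 *; lra.
  have := ler_wpM2l (ltW e3) e7; rewrite mulr1 mulrCA e4 mulr1//.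
have yp : 0 <= y + 1 by exact: ltW.
have -> : c `^ s * Gam y = c `^ s * (1 - s) * Gam y + c `^ s * s / c * Gam (y + 1).
  by rewrite GamS// -/c; field; rewrite gt_eqF.
have s1' : 0 <= 1 - s by rewrite subr_ge0.
have a0 : 0 <= c `^ s * (1 - s) by rewrite mulr_ge0 ?powR_ge0.
have b0 : 0 <= c `^ s * s / c by rewrite divr_ge0 ?mulr_ge0 ?powR_ge0// ltW.
rewrite -lee_fin EFinD !EFinM -!gint1// -!EFinM -integral_gker_lin//.
apply: ge0_le_integral => //.
- by move=> v _; rewrite lee_fin gker_ge0.
- exact: measurable_gkerE.
- exact: measurable_gker_lin.
move=> v /=; rewrite in_itv/= andbT => v0; rewrite lee_fin /gker powRS//.
rewrite powRD; last by apply/implyP => _; rewrite gt_eqF.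
rewrite (_ : _ + _ = v `^ y * expR (- (1 * v)) * (c `^ s * (1 - s) + c `^ s * s / c * v)); last by ring.
rewrite (_ : v `^ y * v `^ s * _ = v `^ y * expR (- (1 * v)) * v `^ s); last by ring.
by rewrite ler_wpM2l ?tangent// mulr_ge0 ?powR_ge0 ?expR_ge0.
Qed.

Lemma Gam_interp_ge y s : 0 <= y -> 0 <= s <= 1 ->
  (y + 1) * Gam y <= (y + s + 1) `^ (1 - s) * Gam (y + s).
Proof.
move=> y0 /andP[s0 s1].
have := @Gam_interp (y + s) (1 - s).
have -> : y + s + (1 - s) = y + 1 by ring.
rewrite GamS//.
by apply; [rewrite addr_ge0|apply/andP; split; lra].
Qed.

Lemma eq_cvgn (f g : nat -> R) (l : R) : f =1 g -> f @ \oo --> l -> g @ \oo --> l.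
Proof. by move=> /funext ->. Qed.

(** The constant is crude but uniform in m; it dominates the ratios [rr] in [ml_le1]. The integer
    part of s is handled by the functional equation, each factor of which is at least m. *)
Lemma Gam_ge_half (m : R) y s : 1 <= m <= y -> 0 <= s -> m `^ s / 2 * Gam y <= Gam (y + s).
Proof.
move=> /andP[m1 my] s0.
have [n f01 ->] : exists2 n : nat, 0 <= s - n%:R <= 1 & s = (s - n%:R) + n%:R.
  exists (Num.truncn s); last by rewrite subrK.
  by have /andP[a b] := truncn_itv s0; rewrite -natr1 in b; apply/andP; split; lra.
move: (s - n%:R) f01 => f f01; have /andP[f0 f1] := f01.
have m0 : 0 < m by lra.
have y0 : 0 <= y by lra.
elim: n => [|n ih].
  rewrite !addr0.
  have h := Gam_interp_ge y0 f01; have G0 := Gam_gt0 y0.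
  set c := y + f + 1 in h; have c0 : 0 < c by rewrite /c; lra.
  have cf : 0 < c `^ f by exact: powR_gt0.
  have e1 : c `^ (1 - f) = c / c `^ f.
    by rewrite powRB ?powRr1 ?(ltW c0)//; apply/implyP => _; rewrite gt_eqF.
  rewrite e1 in h.
  have h2 : (y + 1) * Gam y * c `^ f <= c * Gam (y + f).
    have := ler_wpM2r (ltW cf) h; rewrite (_ : c / _ * _ * _ = c * Gam (y + f))//.
    by field; rewrite gt_eqF.
  have mc : m `^ f <= c `^ f by apply: ge0_ler_powR => //; rewrite ?nnegrE /c; lra.
  (* The source of the factor 2: c = y + f + 1 <= 2 (y + 1), because f <= 1. *)
  have h3 : c * Gam y <= 2 * ((y + 1) * Gam y).
    by rewrite mulrA ler_wpM2r ?(ltW G0)//; rewrite /c; lra.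
  have h4 : c * Gam y * c `^ f <= c * (2 * Gam (y + f)).
    by have := ler_wpM2r (ltW cf) h3; lra.
  rewrite -mulrA ler_pM2l// in h4.
  have := ler_wpM2r (ltW G0) mc; lra.
rewrite -natr1 !addrA GamS; last by rewrite -!addrA addr_ge0// addr_ge0.
rewrite powRS// -addrA in ih *.
set A := m `^ _ in ih *; set G := Gam y in ih *; set G' := Gam _ in ih *.
have A0 : 0 <= A by exact: powR_ge0.
have G0 : 0 <= G by exact/ltW/Gam_gt0.
have n0 : 0 <= n%:R :> R by [].
have b1 : m * (A / 2 * G) <= m * G' by rewrite ler_wpM2l// ltW.
have b2 : m * G' <= (y + (f + n%:R) + 1) * G'.
  rewrite ler_wpM2r; [by []|exact/ltW/Gam_gt0/addr_ge0/addr_ge0|lra].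
lra.
Qed.

(** For the fractional part f the two interpolation inequalities squeeze the quotient between 1 -
    1/M and 1 + 1/M, with M = m + 1; each unit of the integer part contributes a factor 1 + (f + n +
    1) / M. *)
Lemma Gam_ratio s : 0 <= s ->
  (fun m => Gam (m.+1%:R + s) / (Gam m.+1%:R * m.+1%:R `^ s)) @ \oo --> (1 : R).
Proof.
move=> s0.
have [n f01 ->] : exists2 n : nat, 0 <= s - n%:R <= 1 & s = (s - n%:R) + n%:R.
  exists (Num.truncn s); last by rewrite subrK.
  by have /andP[a b] := truncn_itv s0; rewrite -natr1 in b; apply/andP; split; lra.
move: (s - n%:R) f01 => f f01; have /andP[f0 f1] := f01.
have hinv : (fun m => m.+1%:R^-1 : R) @ \oo --> (0 : R) by exact: cvg_harmonic.
elim: n => [|n ih].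
  rewrite !addr0.
  have up : (fun m => 1 + m.+1%:R^-1 : R) @ \oo --> (1 : R).
    by rewrite -[X in _ --> X]addr0; apply: cvgD => //; exact: cvg_cst.
  have lo : (fun m => 1 - m.+1%:R^-1 : R) @ \oo --> (1 : R).
    by rewrite -[X in _ --> X]subr0; apply: cvgB => //; exact: cvg_cst.
  apply: (squeeze_cvgr _ lo up); apply: nearW => m /=.
  have M0 : 0 < m.+1%:R :> R by rewrite ltr0n.
  move: (m.+1%:R : R) M0 => M M0.
  have G0 := Gam_gt0 (ltW M0).
  have Mf : 0 < M `^ f by exact: powR_gt0.
  apply/andP; split.
    have h := Gam_interp_ge (ltW M0) f01.
    set c := M + f + 1 in h; have c0 : 0 < c by rewrite /c; lra.
    have cf : 0 < c `^ f by exact: powR_gt0.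
    have e1 : c `^ (1 - f) = c / c `^ f.
      by rewrite powRB ?powRr1 ?(ltW c0)//; apply/implyP => _; rewrite gt_eqF.
    rewrite e1 in h.
    have h2 : (M + 1) * Gam M * c `^ f <= c * Gam (M + f).
      have := ler_wpM2r (ltW cf) h; rewrite (_ : c / _ * _ * _ = c * Gam (M + f))//.
      by field; rewrite gt_eqF.
    have mc : M `^ f <= c `^ f by apply: ge0_ler_powR => //; rewrite ?nnegrE /c; lra.
    rewrite ler_pdivlMr ?mulr_gt0//.
    set P := Gam M * M `^ f.
    have P0 : 0 <= P by rewrite mulr_ge0// ltW.
    have h3 : (M + 1) * P <= c * Gam (M + f).
      apply: le_trans h2; rewrite -mulrA ler_wpM2l//; first by lra.
      by rewrite ler_wpM2l// ltW.
    have h4 : c * ((1 - M^-1) * P) <= c * Gam (M + f).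
      apply: le_trans h3; rewrite mulrA ler_wpM2r//.
      have Mi : M * M^-1 = 1 by rewrite divff// gt_eqF.
      have Mi0 : 0 < M^-1 by rewrite invr_gt0.
      have fM : 0 <= f * M^-1 by rewrite mulr_ge0// ltW.
      have -> : c * (1 - M^-1) = M + f - M^-1 - f * M^-1 by rewrite /c; field; rewrite gt_eqF.
      lra.
    by rewrite ler_pM2l// in h4.
  have h := Gam_interp (ltW M0) f01.
  rewrite ler_pdivrMr ?mulr_gt0//; apply: (le_trans h).
  rewrite [Gam M * _]mulrC mulrA ler_wpM2r ?(ltW G0)//.
  have -> : M + 1 = (1 + M^-1) * M by field; rewrite gt_eqF.
  have Mi0 : 0 < M^-1 by rewrite invr_gt0.
  rewrite powRM ?(ltW M0)//; last lra.
  rewrite ler_wpM2r ?(ltW Mf)//.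
  rewrite -[leRHS]powRr1; last lra.
  by apply: ler_powR => //; lra.
have lim2 : (fun m => 1 + (f + n%:R + 1) * m.+1%:R^-1 : R) @ \oo --> (1 : R).
  rewrite -[X in _ --> X]addr0; apply: cvgD; first exact: cvg_cst.
  by rewrite -(mulr0 (f + n%:R + 1)); apply: cvgM => //; exact: cvg_cst.
have := cvgM ih lim2 => /(_ _); rewrite mulr1; apply: eq_cvgn => m /=.
have M0 : 0 < m.+1%:R :> R by rewrite ltr0n.
move: (m.+1%:R : R) M0 => M M0.
have G0 := Gam_gt0 (ltW M0).
have n0 : 0 <= n%:R :> R by [].
rewrite -natr1 !addrA GamS; last by rewrite -addrA addr_ge0 ?addr_ge0// ltW.
rewrite powRS//; set A := M `^ _; have A0 : 0 < A by exact: powR_gt0.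
field.
by rewrite !gt_eqF.
Qed.

End GammaIntegral.

(** * The Mittag-Leffler function for lambda <= 2 *)

Section MittagLeffler.
Variable R : realType.
Implicit Types (a : nat -> R) (x y b lambda : R).

Lemma eq_cvg_series (u v : nat -> R) : u =1 v -> cvgn (series u) -> cvgn (series v).
Proof. by move=> /funext ->. Qed.

Definition entire a := forall y, 0 <= y -> cvgn (series (fun n => `|a n| * y ^+ n)).

Lemma entire_cvg a y : entire a -> cvgn (pseries a y).
Proof.
move=> ea; apply: normed_cvg; apply: eq_cvg_series (ea `|y| (normr_ge0 y)) => n.
by rewrite /= normrM normrX.
Qed.

Lemma entire_le a (c : nat -> R) (B : R) : (forall n, `|c n| <= B * `|a n|) ->
  entire a -> entire c.
Proof.
move=> ca ea y y0; have h := @is_cvg_seriesZ _ _ B (ea y y0).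
apply: (series_le_cvg _ _ _ h) => n.
- by rewrite mulr_ge0// exprn_ge0.
- apply: le_trans (_ : 0 <= B * `|a n| * y ^+ n) _; last by rewrite -mulrA.
  by rewrite mulr_ge0 ?exprn_ge0// (le_trans _ (ca n)).
- by rewrite [X in _ <= X]mulrA ler_wpM2r ?exprn_ge0.
Qed.

Lemma entire_diffs a : entire a -> entire (pseries_diffs a).
Proof.
(* The factor 2 absorbs n + 1 <= 2^(n + 1), and y + 1 >= 1 allows y^n <= (y + 1)^(n + 1). *)
move=> ea y y0; pose Y := 2 * (y + 1).
have Y0 : 0 <= Y by rewrite mulr_ge0// addr_ge0.
have h := ea Y Y0.
have h1 : cvgn (series (fun n => `|a n.+1| * Y ^+ n.+1)).
  have : cvgn (fun n => series (fun n => `|a n| * Y ^+ n) n.+1 - `|a 0%N|).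
    apply: is_cvgB; last exact: is_cvg_cst.
    apply/cvg_ex; exists (limn (series (fun n => `|a n| * Y ^+ n))).
    by have := h; rewrite -(cvg_shiftS (series (fun n => `|a n| * Y ^+ n))).
  rewrite (_ : (fun n => _) = series (fun n => `|a n.+1| * Y ^+ n.+1))//.
  apply/funext => n; rewrite /series/= big_nat_recl//= expr0 mulr1.
  by rewrite addrC addKr.
apply: series_le_cvg h1 => n.
- by rewrite mulr_ge0// exprn_ge0.
- by rewrite mulr_ge0// exprn_ge0.
rewrite /pseries_diffs normrM normr_nat mulrAC -mulrA mulrC [leLHS]mulrAC [leLHS]mulrC.
rewrite ler_wpM2l// /Y exprMn [(y + 1) ^+ n.+1]exprS.
have e1 : n.+1%:R <= 2 ^+ n.+1 :> R by rewrite -natrX ler_nat ltnW// ltn_expl.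
rewrite mulrC ler_pM ?exprn_ge0//.
rewrite (le_trans (_ : _ <= (y + 1) ^+ n))//.
  by apply: lerXn2r; rewrite ?nnegrE; lra.
by rewrite ler_peMl ?exprn_ge0//; lra.
Qed.

Lemma entire_is_derive a y : entire a ->
  is_derive y 1 (fun y => limn (pseries a y)) (limn (pseries (pseries_diffs a) y)).
Proof.
move=> ea; apply: (@pseries_snd_diffs _ _ (`|y| + 1)); try exact: entire_cvg.
- exact/entire_cvg/entire_diffs.
- exact/entire_cvg/entire_diffs/entire_diffs.
- by rewrite [ltRHS]ger0_norm ?addr_ge0// ltrDl.
Qed.

Lemma pseries_at0 a : limn (pseries a 0) = a 0%N.
Proof.
rewrite /pseries (lim_series_finite (N := 1)); first by rewrite big_nat1 /= expr0 mulr1.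
by move=> -[//|i] _; rewrite /= expr0n mulr0.
Qed.

(* [c] has generating function chi y = \int_0^1 j r^(j-1) phi (r y) dr, an average of
   phi; it is used through the equation (y^j chi)' = j y^(j-1) phi. *)
Lemma pseries_average_le1 a (j : nat) : entire a -> (0 < j)%N ->
  (forall y, 0 <= y -> limn (pseries a y) <= 1) ->
  let c n := a n * (j%:R / (j%:R + n%:R)) in
  entire c /\ forall y, 0 <= y -> limn (pseries c y) <= 1.
Proof.
case: j => // j ea _ phi1 c.
have jR : 0 < j.+1%:R :> R by [].
have dn n : 0 < j.+1%:R + n%:R :> R by rewrite ltr_pwDl.
have ec : entire c.
  apply: (@entire_le a c 1 _ ea) => n; rewrite mul1r normrM ler_piMr//.
  by rewrite ger0_norm ?divr_ge0// ?ler_pdivrMr// ?mul1r ?lerDl// ltW.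
split => // y; rewrite le_eqVlt => /predU1P[<-|y0].
  rewrite pseries_at0 /c addr0 divff ?gt_eqF// mulr1.
  by have := phi1 0 (lexx _); rewrite pseries_at0.
pose chi (y : R) : R := limn (pseries c y).
have dchi (t : R) : is_derive t 1 chi (limn (pseries (pseries_diffs c) t)).
  exact: entire_is_derive.
have ode t : j.+1%:R * chi t + t * limn (pseries (pseries_diffs c) t) = j.+1%:R * limn (pseries a t).
  have h1 := @entire_cvg c t ec.
  have h2 := pseries_diffs_equiv (@entire_cvg _ t (entire_diffs ec)).
  have h3 : (fun n => j.+1%:R * pseries c t n +
      t * series (fun i => i%:R * c i * t ^+ i.-1) n) @ \oo -->
      j.+1%:R * chi t + t * limn (pseries (pseries_diffs c) t).
    by apply: cvgD; apply: cvgM => //; exact: cvg_cst.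
  rewrite -(cvg_lim _ h3)//; apply: cvg_lim => //.
  have h4 : (fun n => j.+1%:R * pseries a t n) @ \oo --> j.+1%:R * limn (pseries a t).
    by apply: cvgM; [exact: cvg_cst|exact: entire_cvg].
  apply: cvg_trans h4; apply: near_eq_cvg; apply: nearW => n /=.
  rewrite /pseries /series/= !mulr_sumr -big_split/=; apply: eq_bigr => i _.
  have ti : t * (i%:R * c i * t ^+ i.-1) = i%:R * c i * t ^+ i.
    by case: i => [|i]; rewrite ?mul0r ?mulr0// exprS mulrCA.
  rewrite ti /c; field; exact: lt0r_neq0.
rewrite -[leLHS]/(chi y); move: chi dchi ode => chi dchi ode.
(* By [ode] the derivative of D is (j + 1) t^j (1 - phi(t)) >= 0, phi being the sum of [pseries a];
   together with D(0) = 0 this gives chi <= 1. *)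
pose D (t : R) : R := t ^+ j.+1 * (1 - chi t).
have dD (t : R) : is_derive t 1 D (j.+1%:R * t ^+ j * (1 - limn (pseries a t))).
  have d1 : is_derive t 1 ((@id R) ^+ j.+1) (j.+1%:R * t ^+ j).
    by apply: is_derive_eq; rewrite /GRing.scale/= mulr1.
  have d2 : is_derive t 1 (fun s : R => 1 - chi s) (- limn (pseries (pseries_diffs c) t)).
    have := is_deriveB (is_derive_cst (1 : R) (t : R^o) (1 : R^o)) (dchi t); by rewrite sub0r.
  have dt := dchi t; have -> : D = ((@id R) ^+ j.+1) * (fun s : R => 1 - chi s).
    by rewrite exprfctE.
  apply: is_derive_eq; rewrite /GRing.scale/=.
  have := ode t; rewrite (_ : (id ^+ j.+1) t = t * t ^+ j); last by rewrite exprfctE exprS.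
  set X := limn _; set Z := limn _ => o.
  rewrite (_ : j.+1%:R * t ^+ j * (1 - Z) = t ^+ j * (j.+1%:R - j.+1%:R * Z)); last by ring.
  by rewrite -o; ring.
have : D 0 <= D y.
  have derD (t : R) : derivable D t 1 by case: (dD t).
  apply: (@ger0_derive1_ndecr _ D 0 y) => //.
  - move=> t; rewrite in_itv/= => /andP[t0 _]; rewrite derive1E.
    have [_ ->] := dD t.
    by rewrite !mulr_ge0 ?exprn_ge0 ?(ltW t0)// subr_ge0 phi1// ltW.
  - by apply: derivable_within_continuous => t _.
  - exact: ltW.
rewrite /D expr0n mul0r pmulr_rge0 ?exprn_gt0// subr_ge0; exact.
Qed.

Lemma pseries_mix_le1 a (j : nat) b : entire a -> (0 < j)%N -> 0 <= b <= 1 ->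
  (forall y, 0 <= y -> limn (pseries a y) <= 1) ->
  let c n := a n * ((j%:R + b * n%:R) / (j%:R + n%:R)) in
  entire c /\ forall y, 0 <= y -> limn (pseries c y) <= 1.
Proof.
move=> ea j0 /andP[b0 b1] phi1 c.
have jR : 0 < j%:R :> R by rewrite ltr0n.
have [ed d1] := pseries_average_le1 ea j0 phi1; set d := (fun n => _) in ed d1.
have cE n : c n = b * a n + (1 - b) * d n.
  rewrite /c /d; field; rewrite gt_eqF// ltr_pwDl//.
split.
  apply: (@entire_le a c 1 _ ea) => n; rewrite mul1r normrM ler_piMr//.
  have dn : 0 < j%:R + n%:R :> R by rewrite ltr_pwDl.
  rewrite ger0_norm; last by rewrite divr_ge0 ?addr_ge0 ?mulr_ge0// ltW.
  by rewrite ler_pdivrMr// mul1r lerD2l ler_piMl.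
move=> y y0.
have h : pseries c y @ \oo --> b * limn (pseries a y) + (1 - b) * limn (pseries d y).
  have : (fun n => b * pseries a y n + (1 - b) * pseries d y n) @ \oo -->
     b * limn (pseries a y) + (1 - b) * limn (pseries d y).
    by apply: cvgD; apply: cvgM; [exact: cvg_cst|exact: entire_cvg|exact: cvg_cst|exact: entire_cvg].
  apply: cvg_trans; apply: near_eq_cvg; apply: nearW => n /=.
  rewrite /pseries /series/= !mulr_sumr -big_split/=; apply: eq_bigr => i _.
  by rewrite cE; ring.
rewrite (cvg_lim _ h)//.
have b1' : 0 <= 1 - b by rewrite subr_ge0.
have := ler_wpM2l b0 (phi1 y y0); have := ler_wpM2l b1' (d1 y y0).
lra.
Qed.

Definition gratio b (m n : nat) : R := \prod_(0 <= j < m) ((j.+1%:R + b * n%:R) / (j.+1%:R + n%:R)).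

Lemma pseries_prod_le1 a b (m : nat) : entire a -> 0 <= b <= 1 ->
  (forall y, 0 <= y -> limn (pseries a y) <= 1) ->
  let c n := a n * gratio b m n in
  entire c /\ forall y, 0 <= y -> limn (pseries c y) <= 1.
Proof.
move=> ea b01 phi1; elim: m => [|m [em m1]].
  rewrite /gratio (_ : (fun n => _) = a)//; apply/funext => n.
  by rewrite big_geq// mulr1.
have [] := pseries_mix_le1 em (ltn0Sn m) b01 m1.
rewrite /=; set c1 := (fun n => _) => e1 h1.
by rewrite (_ : (fun n => _) = c1)//; apply/funext => n; rewrite /c1 /gratio big_nat_recr//= mulrA.
Qed.

(** Against a cosine coefficient the factor n! cancels and [Gam (b * n)] puts a Mittag-Leffler
    coefficient in its place. The other two Gamma values behave like m^(-(1 - b) n), which the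
    scaling of y in [ml_le1] compensates. *)
Lemma gratioE b m n : 0 <= b ->
  gratio b m n = Gam (b * n%:R + m%:R) / Gam (b * n%:R) * (n`!%:R / Gam (n%:R + m%:R)).
Proof.
move=> b0; have bn : 0 <= b * n%:R by rewrite mulr_ge0.
elim: m => [|m ih].
  rewrite /gratio big_geq// !addr0 Gam_nat !divff ?mulr1 ?gt_eqF ?Gam_gt0// ltr0n fact_gt0//.
rewrite /gratio big_nat_recr//= -/(gratio b m n) ih -natr1 !addrA.
rewrite !GamS ?addr_ge0//.
have h1 := Gam_gt0 bn; have h2 : 0 < Gam (n%:R + m%:R :> R) by rewrite Gam_gt0// addr_ge0.
have m0 : 0 <= m%:R :> R by []. have n0 : 0 <= n%:R :> R by [].
by field; rewrite !gt_eqF//; lra.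
Qed.

Definition mlcoef lambda n : R := (Gam (lambda * n%:R))^-1.

Lemma mlcoef_gt0 lambda n : 0 < lambda -> 0 < mlcoef lambda n.
Proof. by move=> l0; rewrite invr_gt0 Gam_gt0// mulr_ge0// ltW. Qed.

Lemma entire_mlcoef lambda : 0 < lambda -> entire (mlcoef lambda).
Proof.
move=> l0 X X0.
(* With this M the bound M^(lambda n) of [Gam_growth] becomes (2 X + 1)^n, which beats X^n
   geometrically. *)
pose M := (2 * X + 1) `^ lambda^-1.
have X1 : 1 <= 2 * X + 1 by lra.
have M1 : 1 <= M.
  by rewrite -(powRr0 (2 * X + 1)); apply: ler_powR => //; rewrite invr_ge0 ltW.
pose q := X / (2 * X + 1).
have q0 : 0 <= q by rewrite divr_ge0//; lra.
have q1 : q < 1 by rewrite ltr_pdivrMr; lra.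
apply: (@series_le_cvg _ _ (fun n => expR (M + 1) * q ^+ n)) => [n|n|n|].
- by rewrite mulr_ge0// exprn_ge0.
- by rewrite mulr_ge0 ?expR_ge0// exprn_ge0.
- have ln : 0 <= lambda * n%:R by rewrite mulr_ge0// ltW.
  have := Gam_growth ln M1.
  rewrite /M -powRrM mulKf ?gt_eqF// powR_mulrn; last lra.
  rewrite -/M => h; rewrite gtr0_norm ?mlcoef_gt0// /mlcoef.
  have p0 : 0 < (2 * X + 1) ^+ n by rewrite exprn_gt0//; lra.
  rewrite ler_pdivrMl ?Gam_gt0//.
  have e0 := expR_gt0 (M + 1).
  apply: le_trans (_ : _ <= (2 * X + 1) ^+ n * expR (- (M + 1)) * (expR (M + 1) * q ^+ n)) _; last first.
    by rewrite ler_wpM2r// mulr_ge0 ?exprn_ge0// ltW.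
  rewrite expRN /q expr_div_n.
  by rewrite (_ : _ * _ = X ^+ n)//; field; rewrite !gt_eqF.
- by apply: (@is_cvg_geometric_series R (expR (M + 1)) q); rewrite ger0_norm.
Qed.

Definition ml lambda x : R := limn (pseries (mlcoef lambda) x).

Lemma mittag_lefflerE lambda x : 0 < lambda -> mittag_leffler lambda x%:C = (ml lambda x)%:C.
Proof.
move=> l0; apply: csum_unique.
have h : series (fun n => mlcoef lambda n * x ^+ n) @ \oo --> ml lambda x.
  exact/entire_cvg/entire_mlcoef.
apply: eq_has_csum (has_csum_real h) => n /=.
by rewrite GamE rmorphM rmorphXn/= mulrC /mlcoef fmorphV.
Qed.

Lemma lim_series_even (f : nat -> R) (l : R) : (forall n, f n.*2.+1 = 0) ->
  cvgn (series f) -> series (fun n => f n.*2) @ \oo --> limn (series f).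
Proof.
move=> f0 cf.
have -> : series (fun n => f n.*2) = (fun n => series f n.*2).
  apply/funext; elim => [|n ih]; first by rewrite /series/= !big_geq.
  by rewrite seriesSr ih doubleS !seriesSr f0 addr0.
apply: (cvg_comp _ _ _ cf); apply/cvgnyPge => A; exists A => // n /= An.
by rewrite (leq_trans An)// -addnn leq_addr.
Qed.

(* With b = lambda / 2 and y = sqrt x * m^(1-b), E_lambda(-x) is the limit as m -> oo of the power
   series of cos at y with the coefficient of y^n multiplied by prod_(1 <= j <= m) (j + b n) / (j + n).
   Each factor is the convex combination b + (1 - b) j / (j + n), and j / (j + n) is an averaging
   operator, so the bound by 1 survives. *)
Lemma ml_le1 lambda x (e : R) : 0 < lambda <= 2 -> 0 <= x -> e = 1 \/ e = -1 ->
  e * ml lambda (- x) <= 1.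
Proof.
move=> /andP[l0 l2] x0 he.
have e1 : `|e| = 1 by case: he => ->; rewrite ?normrN normr1.
pose b := lambda / 2.
have b0 : 0 < b by rewrite divr_gt0.
have b1 : b <= 1 by rewrite ler_pdivrMr// mul1r.
pose Y := Num.sqrt x; have Y0 : 0 <= Y by exact: sqrtr_ge0.
(* [sg n] divided by n! is the n-th coefficient of cos; the sign e lets the bounds on both sides be
   proved as upper bounds. *)
pose sg n : R := (~~ odd n)%:R * (-1) ^+ n./2.
have sg1 n : `|sg n| <= 1.
  by rewrite /sg normrM normrX normrN1 expr1n mulr1; case: (odd n); rewrite ?normr0 ?normr1.
pose a n : R := e * (sg n / n`!%:R).
have ea : entire a.
  move=> y y0.
  have := @is_cvg_series_exp_coeff R y; apply: series_le_cvg => n.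
  - by rewrite mulr_ge0// exprn_ge0.
  - by rewrite divr_ge0 ?exprn_ge0.
  - rewrite /a normrM e1 mul1r normrM [`|_^-1|]ger0_norm ?invr_ge0// [leRHS]mulrC.
    rewrite ler_wpM2r ?exprn_ge0// ler_piMl ?invr_ge0//.
have phi1 y : 0 <= y -> limn (pseries a y) <= 1.
  move=> y0.
  have -> : limn (pseries a y) = e * cos y.
    have hc : series (cos_coeff y) @ \oo --> cos y.
      by first [exact: is_cvg_series_cos_coeff|rewrite unlock; exact: is_cvg_series_cos_coeff].
    apply: cvg_lim => //.
    have : (fun n => e * series (cos_coeff y) n) @ \oo --> e * cos y.
      by apply: cvgM => //; exact: cvg_cst.
    apply: cvg_trans; apply: near_eq_cvg; apply: nearW => n.
    rewrite /pseries /series/= mulr_sumr; apply: eq_bigr => i _.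
    rewrite /cos_coeff /= -?exprnP /a /sg; move: (~~ odd i)%:R ((-1) ^+ i./2) (i`!%:R^-1) (y ^+ i) => A B C D.
    by ring.
  have := @cos_max R y; rewrite ler_norml => /andP[c1 c2].
  by case: he => ->; lra.
have bd : 0 <= b <= 1 by rewrite (ltW b0).
have main m := pseries_prod_le1 m ea bd phi1.
have bn n : 0 <= b * n%:R by rewrite mulr_ge0// ltW.
pose l n := e * sg n * (mlcoef b n * Y ^+ n).
(* What the n-th term at y = Y (m + 1)^(1 - b) contains besides its limit [l n]. This ratio is at
   most 2 and tends to 1, so [tannery] gives the limit of the whole series. *)
pose rr m n : R := Gam (b * n%:R + m.+1%:R) * m.+1%:R `^ ((1 - b) * n%:R) / Gam (n%:R + m.+1%:R).
pose f m n := l n * rr m n.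
have fE m n : a n * gratio b m.+1 n * (Y * m.+1%:R `^ (1 - b)) ^+ n = f m n.
  rewrite gratioE ?(ltW b0)// exprMn -[(m.+1%:R `^ _) ^+ n]powR_mulrn ?powR_ge0// -powRrM.
  rewrite /f /l /rr /a /mlcoef.
  have h1 := Gam_gt0 (bn n); have h2 : 0 < Gam (n%:R + m.+1%:R :> R) by rewrite Gam_gt0// addr_ge0.
  field; rewrite !gt_eqF// ltr0n fact_gt0//.
have rr0 m n : 0 <= rr m n.
  by rewrite divr_ge0 ?mulr_ge0 ?powR_ge0// ltW// Gam_gt0// addr_ge0.
have rr2 m n : rr m n <= 2.
  rewrite ler_pdivrMr; last by rewrite Gam_gt0// addr_ge0.
  have := @Gam_ge_half R m.+1%:R (b * n%:R + m.+1%:R) ((1 - b) * n%:R).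
  rewrite (_ : b * n%:R + m.+1%:R + (1 - b) * n%:R = n%:R + m.+1%:R); last by ring.
  rewrite ler1n lerDr bn mulr_ge0 ?subr_ge0// => /(_ isT isT); lra.
have rrl n : rr ^~ n @ \oo --> (1 : R).
  have h1 := Gam_ratio (bn n).
  have h2 := @Gam_ratio R n%:R (ler0n _ _).
  have h3 : (fun m => (Gam (m.+1%:R + n%:R) / (Gam m.+1%:R * m.+1%:R `^ n%:R))^-1) @ \oo --> (1 : R).
    by rewrite -[X in _ --> X](@invr1 R); apply: cvgV h2; exact: oner_neq0.
  have := cvgM h1 h3 => /(_ _); rewrite mulr1; apply: eq_cvgn => m /=; rewrite /rr.
  have M0 : 0 < m.+1%:R :> R by rewrite ltr0n.
  move: (m.+1%:R : R) M0 => M M0.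
  have g1 := Gam_gt0 (ltW M0).
  rewrite [n%:R + M]addrC [b * n%:R + M]addrC mulrBl mul1r.
  rewrite powRB; last by apply/implyP => _; rewrite gt_eqF.
  have p1 : 0 < M `^ n%:R by exact: powR_gt0.
  have p2 : 0 < M `^ (b * n%:R) by exact: powR_gt0.
  have g2 : 0 < Gam (M + n%:R) by rewrite Gam_gt0// addr_ge0// ltW.
  by field; rewrite !gt_eqF.
have ent := entire_mlcoef b0.
have lY n : `|l n| <= `|mlcoef b n| * Y ^+ n.
  rewrite /l normrM [`|e * _|]normrM e1 mul1r [`|mlcoef b n * _|]normrM.
  rewrite [`|Y ^+ n|]ger0_norm ?exprn_ge0// ler_piMl//.
  by rewrite mulr_ge0// exprn_ge0.
have sl : cvgn (series l).
  apply: normed_cvg; apply: series_le_cvg (ent Y Y0) => n //=.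
    by rewrite mulr_ge0// exprn_ge0.
have lim : (fun m => limn (series (f m))) @ \oo --> limn (series l).
  apply: (@tannery _ f l (fun n => `|mlcoef b n| * Y ^+ n * 2)).
  - move=> m n; rewrite /f normrM (ger0_norm (rr0 _ _)) ler_pM//.
  - apply: eq_cvg_series (@is_cvg_seriesZ _ _ 2 (ent Y Y0)) => n.
    by rewrite mulrC.
  - move=> n; rewrite -[X in _ --> X]mulr1; apply: cvgM; first exact: cvg_cst.
    exact: rrl.
(* The odd terms of [l] vanish; for n = 2 i one has b n = lambda i and Y^n = x^i. *)
have -> : e * ml lambda (- x) = limn (series l).
  have l0' n : l n.*2.+1 = 0 by rewrite /l /sg /= odd_double/= mul0r mulr0 mul0r.
  have h := lim_series_even 0 l0' sl.
  rewrite -(cvg_lim _ h)//; apply/esym/cvg_lim => //.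
  have h2 : (fun n => e * pseries (mlcoef lambda) (- x) n) @ \oo --> e * ml lambda (- x).
    by apply: cvgM; [exact: cvg_cst|exact/entire_cvg/entire_mlcoef].
  apply: cvg_trans h2; apply: near_eq_cvg; apply: nearW => n.
  rewrite /pseries /series/= mulr_sumr; apply: eq_bigr => i _.
  rewrite /l /sg odd_double/= doubleK mul1r /mlcoef.
  have -> : b * i.*2%:R = lambda * i%:R by rewrite /b -muln2 natrM; field.
  have -> : Y ^+ i.*2 = x ^+ i by rewrite -mul2n exprM sqr_sqrtr.
  have -> : (- x) ^+ i = (-1) ^+ i * x ^+ i by rewrite -exprMn mulN1r.
  by ring.
rewrite -(cvg_lim _ lim)//; apply: limr_le; first by apply/cvg_ex; eexists; exact: lim.
apply: nearW => m; have [_ h] := main m.+1.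
have := h (Y * m.+1%:R `^ (1 - b)); rewrite mulr_ge0 ?powR_ge0// => /(_ isT).
by rewrite /pseries; under eq_fun do rewrite fE.
Qed.

Lemma ml_bound lambda x : 0 < lambda <= 2 -> 0 <= x -> `|ml lambda (- x)| <= 1.
Proof.
move=> l02 x0; rewrite ler_norml; apply/andP; split.
  by have := @ml_le1 _ _ (-1) l02 x0 (or_intror erefl); lra.
by have := @ml_le1 _ _ 1 l02 x0 (or_introl erefl); lra.
Qed.

End MittagLeffler.

(** * The Mittag-Leffler function for lambda > 2 *)

Section ExponentialGrowth.
Variable R : realType.
Notation mu := (@lebesgue_measure R).
Notation D := (`]0%R, +oo[%classic : set R).

(** Chu-Vandermonde, the coefficient form of (1 - x)^(-s) (1 - x)^(-t) = (1 - x)^(-(s + t)). The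
    induction step is the derivative of this identity: n + 1 is split as i + (n + 1 - i), and
    [bcoefSl] absorbs each part. *)
Lemma bcoef_conv (s t : R[i]) n :
  \sum_(0 <= i < n.+1) bcoef s i * bcoef t (n - i)%N = bcoef (s + t) n.
Proof.
elim: n s t => [|n ih] s t; first by rewrite big_nat1 !bcoef0 mulr1.
have n0 : (n.+1%:R : R[i]) != 0 by rewrite pnatr_eq0.
apply: (mulfI n0); rewrite bcoefSl mulrDl.
have e1 : s * bcoef (s + t + 1) n = \sum_(0 <= i < n.+1) (i.+1%:R * bcoef s i.+1) * bcoef t (n - i)%N.
  rewrite addrAC -ih mulr_sumr; apply: eq_bigr => i _.
  by rewrite bcoefSl mulrA.
have e2 : t * bcoef (s + t + 1) n = \sum_(0 <= i < n.+1) bcoef s i * ((n - i).+1%:R * bcoef t (n - i).+1).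
  rewrite -addrA -ih mulr_sumr; apply: eq_bigr => i _.
  by rewrite bcoefSl mulrCA.
rewrite e1 e2 mulr_sumr.
have -> : \sum_(0 <= i < n.+1) (i.+1%:R * bcoef s i.+1) * bcoef t (n - i)%N =
   \sum_(0 <= i < n.+2) i%:R * (bcoef s i * bcoef t (n.+1 - i)%N).
  by rewrite [RHS]big_nat_recl//= mul0r add0r; apply: eq_bigr => i _; rewrite mulrA subSS.
have -> : \sum_(0 <= i < n.+1) bcoef s i * ((n - i).+1%:R * bcoef t (n - i).+1) =
   \sum_(0 <= i < n.+2) (n.+1 - i)%:R * (bcoef s i * bcoef t (n.+1 - i)%N).
  rewrite [RHS]big_nat_recr//= subnn mul0r addr0.
  apply: eq_big_nat => i /andP[_ iN]; rewrite subSn//.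
  by rewrite mulrCA.
rewrite -big_split/=; apply: eq_big_nat => i /andP[_ iN].
by rewrite -mulrDl -natrD subnKC.
Qed.

Lemma bcoef_real (y : R) n : 0 <= y ->
  bcoef (y + 1)%:C n = (Gam (y + n%:R) / (Gam y * n`!%:R))%:C.
Proof.
move=> y0; have G0 := Gam_gt0 y0; elim: n => [|n ih].
  by rewrite bcoef0 addr0 mulr1 divff ?gt_eqF// rmorph1.
have -> : y + n.+1%:R = y + n%:R + 1 by rewrite -natr1 addrA.
rewrite bcoefSr ih GamS ?addr_ge0// factS natrM.
have -> : (y + 1)%:C + n%:R = (y + n%:R + 1)%:C.
  by rewrite -(rmorph_nat (real_complex R)) -rmorphD/= addrAC.
have -> : (n.+1%:R : R[i])^-1 = ((n.+1%:R : R)^-1)%:C by rewrite fmorphV/= rmorph_nat.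
rewrite -!rmorphM/=; congr (_%:C); field.
by rewrite !gt_eqF// ltr0n fact_gt0.
Qed.

Lemma eseries_fin (u : nat -> R) : cvgn (series u) ->
  (\sum_(i <oo) (u i)%:E)%E = (limn (series u))%:E.
Proof.
move=> cu; apply: cvg_lim => //; apply/fine_cvgP; split.
  by apply: nearW => n; rewrite sumEFin.
by apply: eq_cvgn cu => n; rewrite /= sumEFin.
Qed.

Lemma integrable_gker q y : 0 < q -> 0 <= y -> mu.-integrable D (fun s => (gker q y s)%:E).
Proof.
move=> q0 y0; apply/integrableP; split; first exact: measurable_gkerE.
under eq_integral do rewrite gee0_abs ?lee_fin ?gker_ge0//.
exact: gint_lty.
Qed.

Variable lambda : R.
Hypothesis l0 : 0 < lambda.

Definition mlpow (s : R) : R := ml lambda (- (s `^ lambda)).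

Lemma powR_exprn (s : R) n : (s `^ lambda) ^+ n = s `^ (lambda * n%:R).
Proof. by rewrite -powR_mulrn ?powR_ge0// -powRrM. Qed.

Lemma mlpow_cvg s : (fun M => \sum_(0 <= m < M) (-1) ^+ m * mlcoef lambda m * s `^ (lambda * m%:R))
  @ \oo --> mlpow s.
Proof.
have := @entire_cvg R (mlcoef lambda) (- (s `^ lambda)) (entire_mlcoef l0).
rewrite -/(mlpow s); apply: eq_cvgn => M; apply: eq_bigr => m _ /=.
by rewrite -powR_exprn -[- (s `^ lambda)]mulN1r exprMn; ring.
Qed.

Lemma measurable_mlpow (A : set R) : measurable_fun A mlpow.
Proof.
apply: (measurable_funS measurableT) => //.
apply: (measurable_fun_cvg (h := fun M s => \sum_(0 <= m < M) (-1) ^+ m * mlcoef lambda m * s `^ (lambda * m%:R))).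
  move=> M; apply: measurable_sum => m.
  by apply: measurable_funM => //; exact: measurable_powR.
by move=> s _; exact: mlpow_cvg.
Qed.

Section Subexponential.
(** The assumption that [ml_not_subexp] refutes for lambda > 2. *)
Hypothesis subexp : forall e : R, 0 < e -> (\int[mu]_(s in D) (`|mlpow s| * expR (- (e * s)))%:E < +oo)%E.
Variable q : R.
Hypothesis q1 : 1 < q.

Definition pker n (s : R) : R := expR (- (q * s)) * (q * s) ^+ n / n`!%:R.

(* Taylor coefficients at q of the Laplace transform of [mlpow], up to sign and a power of q:
   the transform at q (1 - x) is the sum of the [lcoef n * x^n]. *)
Definition lcoef n : R := fine (\int[mu]_(s in D) (pker n s * mlpow s)%:E)%E.

Let q0 : 0 < q. Proof. by rewrite (lt_trans _ q1). Qed.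

Lemma pker_gker n s : 0 < s -> pker n s = q ^+ n / n`!%:R * gker q n%:R s.
Proof. by move=> s0; rewrite /pker /gker powR_mulrn ?(ltW s0)// exprMn; ring. Qed.

Lemma measurable_pker n (A : set R) : measurable_fun A (pker n).
Proof.
apply: (measurable_funS measurableT) => //.
apply: measurable_funM => //; apply: measurable_funM.
  by apply: measurableT_comp => //; apply: measurableT_comp.
by apply: measurable_funX; apply: measurable_funM.
Qed.

Lemma pker_ge0 n s : 0 < s -> 0 <= pker n s.
Proof.
by move=> s0; rewrite divr_ge0// mulr_ge0 ?expR_ge0// exprn_ge0// mulr_ge0// ltW.
Qed.

(** In each integral the Gamma factor cancels [mlcoef], which leaves a geometric series of ratio
    q'^(-lambda); hence the condition q' > 1. *)
Lemma dominator_fin (q' : R) : 1 < q' ->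
  (\int[mu]_(s in D) (\sum_(m <oo) (mlcoef lambda m * gker q' (lambda * m%:R) s)%:E) < +oo)%E.
Proof.
move=> q'1; have q'0 : 0 < q' by rewrite (lt_trans _ q'1).
have lm m : 0 <= lambda * m%:R by rewrite mulr_ge0// ltW.
rewrite integral_nneseries//; last 2 first.
- move=> m; apply/measurable_EFinP; apply: measurable_funM => //.
  exact: measurable_gker.
- by move=> m s _; rewrite lee_fin mulr_ge0 ?gker_ge0// ltW// mlcoef_gt0.
have e m : (\int[mu]_(s in D) (mlcoef lambda m * gker q' (lambda * m%:R) s)%:E)%E =
    (q'^-1 * ((q' `^ lambda)^-1) ^+ m)%:E.
  under eq_integral do rewrite EFinM.
  rewrite ge0_integralZl//; last 3 first.
  - exact: measurable_gkerE.
  - by move=> s _; rewrite lee_fin gker_ge0.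
  - by rewrite lee_fin ltW// mlcoef_gt0.
  rewrite -/(gint q' (lambda * m%:R)) gintE// -EFinM; congr EFin.
  rewrite powRD ?powRr1 ?(ltW q'0)//; last by apply/implyP => _; rewrite gt_eqF.
  rewrite exprVn powR_exprn /mlcoef.
  by field; rewrite !gt_eqF ?Gam_gt0 ?powR_gt0.
under eq_eseriesr do rewrite e.
rewrite eseries_fin ?ltry//.
apply: (@is_cvg_geometric_series R q'^-1 ((q' `^ lambda)^-1)).
rewrite ger0_norm ?invr_ge0 ?powR_ge0// invf_lt1 ?powR_gt0//.
by rewrite -(powRr0 q') /powR gt_eqF// mul0r expR0 expR_gt1 mulr_gt0// ln_gt0.
Qed.

Lemma lcoef_dct n :
  mu.-integrable D (fun s => (pker n s * mlpow s)%:E) /\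
  (fun M => \sum_(0 <= m < M) (-1) ^+ m * (q `^ (lambda * m%:R + 1))^-1 *
     (Gam (lambda * m%:R + n%:R) / (Gam (lambda * m%:R) * n`!%:R))) @ \oo --> lcoef n.
Proof.
(* Halfway between 1 and q: the spare rate q - q' > 0 absorbs the factor s^n of [pker], and q' > 1
   keeps the dominating series integrable. *)
pose q' := (q + 1) / 2.
have q'0 : 0 < q' by rewrite divr_gt0// addr_gt0.
have q'1 : 1 < q' by rewrite /q' ltr_pdivlMr// mul1r -[2]/(1 + 1) ltrD2r.
have lm m : 0 <= lambda * m%:R by rewrite mulr_ge0// ltW.
have qq' : 0 < q - q' by rewrite subr_gt0 /q' ltr_pdivrMr// mulr_natr mulr2n ltrD2l.
have [C C0 hC] := powR_le_expR (ler0n R n) qq'.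
pose C' := C * q ^+ n / n`!%:R.
have C'0 : 0 <= C' by rewrite divr_ge0// mulr_ge0 ?exprn_ge0// ltW.
have pC s : 0 < s -> pker n s <= C' * expR (- (q' * s)).
  move=> s0; have := hC s s0; rewrite powR_mulrn ?(ltW s0)// => h.
  rewrite /pker /C' exprMn.
  have -> : expR (- (q' * s)) = expR (- (q * s)) * expR ((q - q') * s).
    by rewrite -expRD; congr expR; ring.
  have A : 0 <= expR (- (q * s)) * q ^+ n / n`!%:R.
    by rewrite divr_ge0 ?mulr_ge0 ?expR_ge0 ?exprn_ge0// ltW.
  have := ler_wpM2l A h.
  by congr (_ <= _); ring.
pose t m (s : R) : R := (-1) ^+ m * mlcoef lambda m * s `^ (lambda * m%:R).
pose f_ M s : \bar R := (\sum_(0 <= m < M) (pker n s * t m s))%:E.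
pose g s : \bar R := (C'%:E * \sum_(m <oo) (mlcoef lambda m * gker q' (lambda * m%:R) s)%:E)%E.
have nn s m : (0 <= m)%N -> true -> (0 <= (mlcoef lambda m * gker q' (lambda * m%:R) s)%:E)%E.
  by move=> _ _; rewrite lee_fin mulr_ge0 ?gker_ge0// ltW// mlcoef_gt0.
have mg0 : measurable_fun D (fun s => \sum_(m <oo) (mlcoef lambda m * gker q' (lambda * m%:R) s)%:E)%E.
  apply: ge0_emeasurable_sum => [m s _ _|m _]; first exact: nn.
  by apply/measurable_EFinP; apply: measurable_funM => //; exact: measurable_gker.
have mg : measurable_fun D g by exact: measurable_funeM.
have mt m : measurable_fun D (t m).
  by apply: measurable_funM => //; apply: (measurable_funS measurableT) => //; exact: measurable_powR.
have [] := @dominated_convergence _ _ R mu D (measurable_itv _) f_ (fun s => (pker n s * mlpow s)%:E) g.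
- move=> M; apply/measurable_EFinP; apply: measurable_sum => m.
  by apply: measurable_funM; [exact: measurable_pker|exact: mt].
- by apply/measurable_EFinP; apply: measurable_funM; [exact: measurable_pker|exact: measurable_mlpow].
- apply: aeW => s _; apply/fine_cvgP; split; first by apply: nearW => M.
  have : (fun M => pker n s * \sum_(0 <= m < M) t m s) @ \oo --> pker n s * mlpow s.
    by apply: cvgM; [exact: cvg_cst|exact: mlpow_cvg].
  by apply: eq_cvgn => M; rewrite /= mulr_sumr.
- apply/integrableP; split => //.
  have g_ge0 s : (0 <= g s)%E.
    by rewrite mule_ge0 ?lee_fin//; apply: nneseries_ge0 => m; exact: nn.
  under eq_integral do rewrite gee0_abs ?g_ge0//.
  rewrite ge0_integralZl//; last by move=> s _; apply: nneseries_ge0 => m _ _; exact: nn.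
  by rewrite lte_mul_pinfty// ?lee_fin// dominator_fin.
- apply: aeW => s M; rewrite /= in_itv/= andbT => s0.
  rewrite /g; apply: (@le_trans _ _ (C'%:E * (\sum_(0 <= m < M) (mlcoef lambda m * gker q' (lambda * m%:R) s)%:E))%E); last first.
    by rewrite lee_wpmul2l ?lee_fin//; apply: nneseries_lim_ge => m; exact: nn.
  rewrite sumEFin -EFinM lee_fin (le_trans (ler_norm_sum _ _ _))// mulr_sumr.
  apply: ler_sum => m _; rewrite normrM (ger0_norm (pker_ge0 _ s0)).
  have -> : `|t m s| = mlcoef lambda m * s `^ (lambda * m%:R).
    rewrite /t normrM normrMsign ger0_norm ?(ltW (mlcoef_gt0 _ l0))//.
    by rewrite ger0_norm ?powR_ge0.
  have A : 0 <= mlcoef lambda m * s `^ (lambda * m%:R).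
    by rewrite mulr_ge0 ?powR_ge0// ltW// mlcoef_gt0.
  have := ler_wpM2r A (pC s s0); rewrite /gker; congr (_ <= _); ring.
move=> ig _ cvI; split => //.
have fin : (\int[mu]_(s in D) (pker n s * mlpow s)%:E)%E \is a fin_num by exact: integrable_fin_num.
have := cvI; rewrite -(fineK fin) -/(lcoef n) => /fine_cvgP[_].
apply: eq_cvgn => M /=; rewrite /f_.
under eq_integral do rewrite -sumEFin.
have it m : mu.-integrable D (fun s => (pker n s * t m s)%:E).
  apply: (@eq_integrable _ _ _ mu D _ (fun s => ((-1) ^+ m * mlcoef lambda m * (q ^+ n / n`!%:R))%:E *
      (gker q (lambda * m%:R + n%:R) s)%:E)%E) => //.
    move=> s; rewrite inE/= in_itv/= andbT => s0; rewrite -EFinM; congr EFin.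
    rewrite pker_gker// /t /gker powRD; last by apply/implyP => _; rewrite gt_eqF.
    by ring.
  by apply: integrableZl => //; apply: integrable_gker => //; rewrite addr_ge0.
pose v m : R := (-1) ^+ m * (q `^ (lambda * m%:R + 1))^-1 *
   (Gam (lambda * m%:R + n%:R) / (Gam (lambda * m%:R) * n`!%:R)).
have iv m : (\int[mu]_(s in D) (pker n s * t m s)%:E)%E = (v m)%:E.
  have -> : (\int[mu]_(s in D) (pker n s * t m s)%:E)%E =
      (((-1) ^+ m * mlcoef lambda m * (q ^+ n / n`!%:R))%:E * gint q (lambda * m%:R + n%:R))%E.
    rewrite -integralZl//; last by apply: integrable_gker => //; rewrite addr_ge0.
    apply: eq_integral => s; rewrite inE/= in_itv/= andbT => s0; rewrite -EFinM; congr EFin.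
    rewrite pker_gker// /t /gker powRD; last by apply/implyP => _; rewrite gt_eqF.
    by ring.
  rewrite gintE ?addr_ge0// -EFinM; congr EFin.
  have -> : lambda * m%:R + n%:R + 1 = lambda * m%:R + 1 + n%:R by ring.
  rewrite [q `^ (_ + n%:R)]powRD; last by apply/implyP => _; rewrite gt_eqF.
  rewrite powR_mulrn ?(ltW q0)// /mlcoef /v.
  have := Gam_gt0 (lm m); have := powR_gt0 (lambda * m%:R + 1) q0 => P0 G0.
  by field; rewrite !gt_eqF// ?exprn_gt0// ltr0n fact_gt0.
rewrite integral_sum// (eq_bigr (fun m => (v m)%:E)) ?sumEFin// => m _; exact: iv.
Qed.

(** The terms [pker n s * x ^+ n] sum to exp(- q (1 - x) s), so every partial sum is at most the
    Laplace integral of |mlpow| at the rate q (1 - x) > 0. This is where the growth assumption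
    enters. *)
Lemma lcoef_summable (x : R) : 0 <= x < 1 -> cvgn (series (fun n => `|lcoef n| * x ^+ n)).
Proof.
move=> /andP[x0 x1].
pose B := (\int[mu]_(s in D) (`|mlpow s| * expR (- ((q * (1 - x)) * s)))%:E)%E.
have e0 : 0 < q * (1 - x) by rewrite mulr_gt0// subr_gt0.
have Bfin : (B < +oo)%E by exact: subexp.
have B0 : (0 <= B)%E by apply: integral_ge0 => s _; rewrite lee_fin mulr_ge0 ?expR_ge0.
have BE : B = (fine B)%:E by rewrite fineK// ge0_fin_numE.
apply: (@cvg_series_sum_le _ _ (fine B)) => [n|N].
  by rewrite mulr_ge0// exprn_ge0.
rewrite -lee_fin -BE /series/= -sumEFin.
have mm n : measurable_fun D (fun s => (pker n s * `|mlpow s| * x ^+ n)%:E).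
  apply/measurable_EFinP; apply: measurable_funM => //; apply: measurable_funM.
    exact: measurable_pker.
  by apply: measurableT_comp => //; exact: measurable_mlpow.
apply: (@le_trans _ _ (\sum_(0 <= n < N) \int[mu]_(s in D) (pker n s * `|mlpow s| * x ^+ n)%:E)%E).
  apply: lee_sum => n _; have [ig _] := lcoef_dct n.
  have fin : (\int[mu]_(s in D) (pker n s * mlpow s)%:E)%E \is a fin_num by exact: integrable_fin_num.
  under eq_integral do rewrite EFinM.
  rewrite ge0_integralZr//; last 3 first.
  - apply/measurable_EFinP; apply: measurable_funM; first exact: measurable_pker.
    by apply: measurableT_comp => //; exact: measurable_mlpow.
  - by move=> s; rewrite /= in_itv/= andbT => s0; rewrite lee_fin mulr_ge0// pker_ge0.
  - by rewrite lee_fin exprn_ge0.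
  rewrite EFinM lee_wpmul2r ?lee_fin ?exprn_ge0//.
  rewrite /lcoef EFin_normr_Rintegral//.
  apply: (le_trans (le_abse_integral _ _ (measurable_int _ ig))) => //.
  rewrite le_eqVlt; apply/orP; left; apply/eqP; apply: eq_integral => s.
  rewrite inE/= in_itv/= andbT => s0; congr EFin.
  by rewrite normrM ger0_norm// pker_ge0.
rewrite -ge0_integral_sum//; last first.
  by move=> n s; rewrite /= in_itv/= andbT => s0; rewrite lee_fin mulr_ge0 ?exprn_ge0// mulr_ge0// pker_ge0.
apply: ge0_le_integral => //.
- move=> s; rewrite /= in_itv/= andbT => s0; apply: sume_ge0 => n _.
  by rewrite lee_fin mulr_ge0 ?exprn_ge0// mulr_ge0// pker_ge0.
- by apply: emeasurable_sum.
- apply/measurable_EFinP; apply: measurable_funM.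
    by apply: measurableT_comp => //; exact: measurable_mlpow.
  by apply: measurableT_comp => //; apply: measurableT_comp.
move=> s; rewrite /= in_itv/= andbT => s0; rewrite sumEFin lee_fin.
have -> : \sum_(0 <= n < N) pker n s * `|mlpow s| * x ^+ n =
   `|mlpow s| * expR (- (q * s)) * series (exp_coeff (q * s * x)) N.
  rewrite /series/= mulr_sumr; apply: eq_bigr => n _.
  by rewrite /pker exp_coeffE/= [(q * s * x) ^+ n]exprMn; ring.
have -> : expR (- (q * (1 - x) * s)) = expR (- (q * s)) * expR (q * s * x).
  by rewrite -expRD; congr expR; ring.
rewrite mulrA ler_wpM2l ?mulr_ge0 ?expR_ge0//.
apply: nneg_series_le; last exact: is_cvg_series_exp_coeff.
by move=> n; apply: exp_coeff_ge0; rewrite !mulr_ge0// ltW.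
Qed.

Lemma lcoef_csum n : has_csum (fun m => ((-1) ^+ m * (q `^ (lambda * m%:R + 1))^-1)%:C *
   bcoef (lambda * m%:R + 1)%:C n) (lcoef n)%:C.
Proof.
have [_ h] := lcoef_dct n; apply: eq_has_csum (has_csum_real h) => m.
by rewrite bcoef_real ?mulr_ge0 ?(ltW l0)// -rmorphM.
Qed.

(* Chu-Vandermonde turns lambda m + 1 into lambda (m - 1) + 1, a shift in the series [lcoef_csum]. *)
Lemma lcoef_rec n :
  \sum_(0 <= i < n.+1) bcoef (- lambda%:C) i * (lcoef (n - i))%:C =
  (q^-1)%:C * bcoef (1 - lambda%:C) n - ((q `^ lambda)^-1)%:C * (lcoef n)%:C.
Proof.
pose w m : R[i] := ((-1) ^+ m * (q `^ (lambda * m%:R + 1))^-1)%:C.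
have h1 : has_csum (fun m => w m * bcoef (lambda * m%:R + 1 - lambda)%:C n)
    (\sum_(0 <= i < n.+1) bcoef (- lambda%:C) i * (lcoef (n - i))%:C).
  have := @has_csum_sum R n.+1 (fun i m => bcoef (- lambda%:C) i * (w m * bcoef (lambda * m%:R + 1)%:C (n - i)))
     (fun i => bcoef (- lambda%:C) i * (lcoef (n - i))%:C).
  move=> /(_ (fun i _ => @has_csumZ R _ _ _ (@lcoef_csum (n - i)%N))).
  apply: eq_has_csum => m; rewrite rmorphB/= [_ - lambda%:C]addrC -bcoef_conv mulr_sumr.
  by apply: eq_bigr => i _; rewrite mulrCA.
have h2 := has_csum_shift (@has_csumZ R _ _ (- ((q `^ lambda)^-1)%:C) (@lcoef_csum n)).
have h3 : has_csum (fun m => if m is 0%N then (q^-1)%:C * bcoef (1 - lambda%:C) n else 0)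
    ((q^-1)%:C * bcoef (1 - lambda%:C) n).
  apply: (@cvg_near_cst _ R[i]^o); exists 1%N => // -[//|k] _ /=.
  by rewrite /series/= big_nat_recl//= big1 ?addr0.
have h4 := has_csumD h3 h2; rewrite mulNr in h4.
rewrite -(csum_unique h1) -(csum_unique h4); congr csum; apply/funext => -[|m].
  rewrite addr0 /w mulr0 add0r expr0 mul1r powRr1 ?(ltW q0)//.
  by rewrite rmorphB.
rewrite add0r; have -> : lambda * m.+1%:R + 1 - lambda = lambda * m%:R + 1.
  by rewrite -natr1; ring.
rewrite mulrA; congr (_ * _); rewrite /w -rmorphN -rmorphM; congr (_%:C).
have -> : lambda * m.+1%:R + 1 = lambda + (lambda * m%:R + 1) by rewrite -natr1; ring.
rewrite powRD; last by apply/implyP => _; rewrite gt_eqF.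
by rewrite exprS invfM; ring.
Qed.

(** The left side of [lcoef_rec] is a Cauchy product with the binomial series of (1 - x)^lambda.
    With w = q (1 - x) the result is the equation w^lambda L = w^(lambda - 1) - L of the Laplace
    transform, divided by q^lambda. *)
Lemma lcoef_generating (x : R[i]) : cabs x < 1 ->
  cpow (1 - x) lambda%:C * csum (fun n => (lcoef n)%:C * x ^+ n) =
  (q^-1)%:C * cpow (1 - x) (lambda%:C - 1) -
    ((q `^ lambda)^-1)%:C * csum (fun n => (lcoef n)%:C * x ^+ n).
Proof.
move=> x1; set Cx := csum _.
have sL : acsum (fun n => (lcoef n)%:C * x ^+ n).
  have := @lcoef_summable (cabs x); rewrite cabs_ge0 x1 => /(_ isT).
  by apply: eq_cvg_series => n; rewrite cabsM cabsR cabsX.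
have b1 := @acsum_binom R (- lambda%:C) x x1.
have b2 := @acsum_binom R (1 - lambda%:C) x x1.
have h1 := cauchy_product b1 sL; rewrite binom_series// opprK -/Cx in h1.
have h2 := @has_csumZ R _ _ (q^-1)%:C (acsum_has b2); rewrite binom_series// opprB in h2.
have h3 := @has_csumZ R _ _ (- ((q `^ lambda)^-1)%:C) (acsum_has sL).
have h4 := has_csumD h2 h3; rewrite mulNr -/Cx in h4.
rewrite -(csum_unique h1) -(csum_unique h4); congr csum; apply/funext => n.
transitivity ((\sum_(0 <= i < n.+1) bcoef (- lambda%:C) i * (lcoef (n - i))%:C) * x ^+ n).
  rewrite mulr_suml; apply: eq_big_nat => i /andP[_ iN].
  by rewrite mulrACA -exprD subnKC.
by rewrite lcoef_rec mulrBl -!mulrA mulNr.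
Qed.

End Subexponential.

(* At w = exp(i pi / lambda) / q one has w^lambda = - q^(-lambda), so that the unknown series cancels
   from [lcoef_generating] and w^(lambda - 1) = 0 is left; |1 - w| < 1 for q large because
   pi / lambda < pi / 2. *)
Lemma ml_not_subexp : 2 < lambda ->
  ~ (forall e : R, 0 < e -> (\int[mu]_(s in D) (`|mlpow s| * expR (- (e * s)))%:E < +oo)%E).
Proof.
move=> l2 subexp.
have pi0 := @pi_gt0 R.
pose f : R := pi / lambda.
have f0 : 0 < f by rewrite divr_gt0.
have f2 : f < pi / 2 by rewrite /f ltr_pdivrMr// mulrAC ltr_pdivlMr// ltr_pM2l.
have cf : 0 < cos f by apply: cos_gt0_pihalf; rewrite f2 andbT; lra.
(* Since |w| = 1 / q, the condition |1 - w| < 1 amounts to 1 < 2 q cos f; this choice gives q cos f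
   = cos f + 1. *)
pose q : R := 1 + (cos f)^-1.
have ci : 0 < (cos f)^-1 by rewrite invr_gt0.
have q1 : 1 < q by rewrite /q; lra.
have q0 : 0 < q by lra.
have qc : 1 < 2 * (q * cos f).
  have -> : q * cos f = cos f + 1 by rewrite /q mulrDl mul1r mulVf// gt_eqF.
  lra.
pose w : R[i] := (q^-1 * cos f) +i* (q^-1 * sin f).
have qi : 0 < q^-1 by rewrite invr_gt0.
have w0 : 0 < complex.Re w by rewrite /= mulr_gt0.
have cs := cos2Dsin2 f.
have wn : complex.Re w ^+ 2 + complex.Im w ^+ 2 = q^-1 ^+ 2.
  by rewrite /= !exprMn -mulrDr cs mulr1.
have lw : clog w = (- ln q) +i* f.
  rewrite clog_right// wn lnXn// lnV ?posrE//; congr (_ +i* _); first by field.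
  rewrite /= -[_ / _]mulf_div divff ?gt_eqF// mul1r -/(tan f) tanK//.
  by rewrite in_itv/= f2 andbT; lra.
have x1 : cabs (1 - w) < 1.
  rewrite -(@ltr_pXn2r _ 2)// ?nnegrE ?cabs_ge0// expr1n sqr_cabs.
  rewrite !(cReD, cImD, cReN, cImN) [complex.Re 1]/= [complex.Im 1]/= sub0r sqrrN.
  rewrite (_ : (1 - complex.Re w) ^+ 2 + _ = (complex.Re w ^+ 2 + complex.Im w ^+ 2) - complex.Re w *+ 2 + 1); last by ring.
  rewrite wn -[ltRHS]add0r ltrD2r subr_lt0 /= expr2 -mulr_natl mulrCA ltr_pM2l//.
  by rewrite -(ltr_pM2l q0) mulfV ?gt_eqF// mulrCA.
have := lcoef_generating subexp q1 x1.
rewrite subKr.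
have -> : cpow w lambda%:C = - ((q `^ lambda)^-1)%:C.
  rewrite /cpow lw.
  have -> : lambda%:C * (- ln q +i* f) = (- (lambda * ln q)) +i* pi.
    apply: complexP; rewrite !(cReM, cImM)/= !mul0r ?subr0 ?addr0 ?mulrN//.
    by rewrite /f; field; rewrite gt_eqF.
  rewrite /cexp/= cospi sinpi expRN /powR gt_eqF//.
    by apply: complexP; rewrite !(cReM, cImM)/=; ring.
rewrite mulNr => /eqP; rewrite -subr_eq0 opprB addrCA.
set S := (((q `^ lambda)^-1)%:C * _).
rewrite addrA addrN sub0r oppr_eq0 mulf_eq0 => /orP[|].
  by move=> /eqP[/eqP]; rewrite gt_eqF.
by rewrite /cpow (negbTE (cexp_neq0 _)).
Qed.

End ExponentialGrowth.

(** * Non-integrability of the extended beta integrand for p > 0 and lambda > 2 *)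

Section Nonintegrability.
Variable R : realType.
Notation mu := (@lebesgue_measure R).
Variables (p lambda d : R).
Hypotheses (p0 : 0 < p) (l2 : 2 < lambda) (d0 : 0 < d).

Let l0 : 0 < lambda. Proof. by rewrite (lt_trans _ l2). Qed.
Let li0 : 0 < lambda^-1. Proof. by rewrite invr_gt0. Qed.

(* The substitution s^lambda = p / (u (1 - u)). *)
Definition subst_base (u : R) : R := p * (u * (1 - u))^-1.
Definition subst_map (u : R) : R := subst_base u `^ lambda^-1.
Definition subst_der (u : R) : R :=
  lambda^-1 * subst_base u `^ (lambda^-1 - 1) * (p * (- (u * (1 - u)) ^- 2 * (1 - 2 * u))).

Lemma subst_prod_gt0 (u : R) : 0 < u < 1 -> 0 < u * (1 - u).
Proof. by move=> /andP[u0 u1]; rewrite mulr_gt0// subr_gt0. Qed.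

Lemma subst_base_gt0 (u : R) : 0 < u < 1 -> 0 < subst_base u.
Proof. by move=> u01; rewrite mulr_gt0// invr_gt0 subst_prod_gt0. Qed.

Lemma subst_map_gt0 (u : R) : 0 < u < 1 -> 0 < subst_map u.
Proof. by move=> u01; rewrite powR_gt0// subst_base_gt0. Qed.

Lemma subst_map_powR (u : R) : 0 < u < 1 -> subst_map u `^ lambda = p / (u * (1 - u)).
Proof.
move=> u01; rewrite /subst_map -powRrM mulVf ?gt_eqF// powRr1//.
by rewrite ltW// subst_base_gt0.
Qed.

Lemma is_derive_subst_prod_inv (u : R) : 0 < u < 1 ->
  is_derive u 1 (fun u : R => (u * (1 - u))^-1) (- (u * (1 - u)) ^- 2 * (1 - 2 * u)).
Proof.
move=> u01; have u0 := subst_prod_gt0 u01.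
have d1 : is_derive u 1 (fun u : R => u * (1 - u)) (1 - 2 * u).
  by apply: is_derive_eq; rewrite /GRing.scale/=; ring.
have h : u * (1 - u) != 0 by rewrite gt_eqF.
exact: (@is_deriveV R (fun u : R => u * (1 - u)) u (1 - 2 * u) 1 h d1).
Qed.

Lemma is_derive_subst_base (u : R) : 0 < u < 1 ->
  is_derive u 1 subst_base (p * (- (u * (1 - u)) ^- 2 * (1 - 2 * u))).
Proof.
move=> u01; have h := is_derive_subst_prod_inv u01.
by rewrite /subst_base; apply: is_derive_eq; rewrite /GRing.scale/=; ring.
Qed.

Lemma is_derive_subst_pow (a u : R) : 0 < u < 1 ->
  is_derive u 1 (fun u => subst_base u `^ a)
    (a * subst_base u `^ (a - 1) * (p * (- (u * (1 - u)) ^- 2 * (1 - 2 * u)))).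
Proof.
move=> u01.
exact: (@is_derive1_comp R (fun x => x `^ a) subst_base u _ _
  (is_derive1_powR a (subst_base_gt0 u01)) (is_derive_subst_base u01)).
Qed.

Lemma is_derive_subst_map (u : R) : 0 < u < 1 -> is_derive u 1 subst_map (subst_der u).
Proof. exact: is_derive_subst_pow. Qed.

Lemma derivable_continuous (f : R -> R) (u : R) : derivable f u 1 -> {for u, continuous f}.
Proof. by move=> ?; apply/differentiable_continuous/derivable1_diffP. Qed.

Lemma continuous_subst_der (u : R) : 0 < u < 1 -> {for u, continuous subst_der}.
Proof.
move=> u01.
have c1 : {for u, continuous (fun u => subst_base u `^ (lambda^-1 - 1))}.
  by apply: derivable_continuous; case: (is_derive_subst_pow (lambda^-1 - 1) u01).
have c2 : {for u, continuous (fun u : R => (u * (1 - u))^-1)}.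
  by apply: derivable_continuous; case: (is_derive_subst_prod_inv u01).
have c3 : {for u, continuous (fun u : R => 1 - 2 * u)}.
  by apply: derivable_continuous; exact: ex_derive.
apply: cvgM; first by apply: cvgM; [exact: cvg_cst|exact: c1].
apply: cvgM; first exact: cvg_cst.
apply: cvgM; last exact: c3.
apply: cvgN; rewrite -exprVn.
under eq_fun do rewrite -exprVn expr2.
by rewrite expr2; apply: cvgM; exact: c2.
Qed.

Lemma subst_derive1 (u : R) : 0 < u < 1 -> (subst_map^`()%classic) u = subst_der u.
Proof. by move=> u01; rewrite derive1E; case: (is_derive_subst_map u01) => _ ->. Qed.

Lemma near01 (u : R) : 0 < u < 1 -> \forall x \near u, 0 < x < 1.
Proof.
move=> u01; have := @near_in_itvoo R 0 1 u; rewrite in_itv/= => /(_ u01).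
by apply: filterS => x; rewrite in_itv.
Qed.

Lemma continuous_subst_derive1 (u : R) : 0 < u < 1 ->
  {for u, continuous (subst_map^`()%classic)}.
Proof.
move=> u01; rewrite /prop_for /continuous_at subst_derive1//.
apply: cvg_trans (continuous_subst_der u01); apply: near_eq_cvg.
by apply: filterS (near01 u01) => x x01; rewrite subst_derive1.
Qed.

Lemma subst_map_incr (u v : R) : 2^-1 <= u -> u < v -> v < 1 -> subst_map u < subst_map v.
Proof.
move=> u2 uv v1.
have h2 : 2^-1 = 1 / 2 :> R by rewrite mul1r.
have u01 : 0 < u < 1 by apply/andP; split; lra.
have v01 : 0 < v < 1 by apply/andP; split; lra.
apply: gt0_ltr_powR => //; rewrite ?nnegrE ?ltW ?subst_base_gt0//.
rewrite ltr_pM2l// ltf_pV2 ?posrE ?subst_prod_gt0//.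
have : 0 < (v - u) * (u + v - 1) by rewrite mulr_gt0//; lra.
lra.
Qed.

Lemma mlpow_continuous (s : R) : 0 < s -> {for s, continuous (mlpow lambda)}.
Proof.
move=> s0; apply: (@continuous_comp _ _ _ (fun s : R => - (s `^ lambda)) (ml lambda)).
  have c : {for s, continuous (fun s : R => s `^ lambda)}.
    by apply: derivable_continuous; apply: derivable_powR; rewrite in_itv/= s0.
  by apply: cvgN; exact: c.
apply: derivable_continuous.
by case: (@entire_is_derive R (mlcoef lambda) (- (s `^ lambda)) (entire_mlcoef l0)).
Qed.

(** A crude bound for the compact range of s below [subst_map] at 1/2, which the substitution on
    [1/2, 1[ does not reach. *)
Lemma ml_le_abs (x X : R) : 0 <= x <= X -> `|ml lambda (- x)| <= ml lambda X.
Proof.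
move=> /andP[x0 xX].
have h : (fun M => `|pseries (mlcoef lambda) (- x) M|) @ \oo --> `|ml lambda (- x)|.
  by apply: cvg_norm; exact/entire_cvg/entire_mlcoef.
rewrite -(cvg_lim _ h)//; apply: limr_le; first by apply/cvg_ex; eexists; exact: h.
apply: nearW => M.
have X0 : 0 <= X by lra.
have c0 n : 0 <= mlcoef lambda n by rewrite ltW// mlcoef_gt0.
apply: le_trans (_ : pseries (mlcoef lambda) X M <= _).
  rewrite (le_trans (ler_norm_sum _ _ _))//; apply: ler_sum => n _ /=.
  rewrite normrM normrX normrN (ger0_norm (c0 n)) (ger0_norm x0) ler_wpM2l//.
  by apply: lerXn2r; rewrite ?nnegrE.
apply: nneg_series_le; last exact/entire_cvg/entire_mlcoef.
by move=> n; rewrite /= mulr_ge0// exprn_ge0.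
Qed.

(** With S = [subst_map u], the derivative is at most S / (lambda (1 - u)), and p <= S^lambda (1 -
    u) trades the factor (1 - u)^(-d) for a power S^(lambda d). The exponential then absorbs S^(1 +
    lambda d). *)
Lemma subst_weight (e : R) : 0 < e -> exists2 K : R, 0 <= K & forall u : R, 2^-1 <= u < 1 ->
  expR (- (e * subst_map u)) * subst_der u <= K * (1 - u) `^ (d - 1).
Proof.
move=> e0.
have y0 : 0 <= 1 + lambda * d by rewrite addr_ge0// mulr_ge0// ltW.
have [C C0 hC] := powR_le_expR y0 e0.
exists (lambda^-1 * (p `^ d)^-1 * C).
  by rewrite !mulr_ge0 ?invr_ge0 ?powR_ge0// ltW.
move=> u /andP[u2 u1].
have h2 : 2^-1 = 1 / 2 :> R by rewrite mul1r.
have u0 : 0 < u by lra.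
have u01 : 0 < u < 1 by rewrite u0.
have r0 : 0 < 1 - u by lra.
set S := subst_map u; have S0 : 0 < S by exact: subst_map_gt0.
have b0 := subst_base_gt0 u01.
have dE : subst_der u = lambda^-1 * S * ((2 * u - 1) / (u * (1 - u))).
  rewrite /subst_der powRB ?powRr1 ?(ltW b0)//; last by apply/implyP => _; rewrite gt_eqF.
  rewrite -/(subst_map u) -/S /subst_base; field.
  by rewrite !gt_eqF//; lra.
have k1 : subst_der u <= lambda^-1 * S * (1 - u)^-1.
  rewrite dE ler_wpM2l ?mulr_ge0 ?(ltW S0) ?(ltW li0)//.
  rewrite ler_pdivrMr ?subst_prod_gt0// mulrCA mulVf ?gt_eqF// mulr1; lra.
have k2 : (1 - u)^-1 <= (p `^ d)^-1 * S `^ (lambda * d) * (1 - u) `^ (d - 1).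
  rewrite powRB ?powRr1 ?(ltW r0)//; last by apply/implyP => _; rewrite gt_eqF.
  rewrite mulrA ler_pdivlMr// mulVf ?gt_eqF//.
  rewrite powRrM subst_map_powR// -mulrA -powRM; first 1 last.
  - by rewrite divr_ge0 ?(ltW p0)// ltW// subst_prod_gt0.
  - exact: ltW.
  rewrite mulrC ler_pdivlMr ?powR_gt0// mul1r.
  apply: ge0_ler_powR; rewrite ?nnegrE ?ltW//.
    by rewrite mulr_gt0// divr_gt0// subst_prod_gt0.
  rewrite (_ : p / _ * _ = p / u); last by field; rewrite !gt_eqF//.
  by rewrite ltr_pdivlMr// gtr_pMr.
have k3 := hC S S0.
have S1 : S `^ (1 + lambda * d) = S * S `^ (lambda * d).
  rewrite powRD ?powRr1 ?(ltW S0)//; by apply/implyP => _; rewrite gt_eqF.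
rewrite S1 in k3.
rewrite expRN; have E0 := expR_gt0 (e * S).
rewrite ler_pdivrMl//.
apply: (le_trans k1).
have A0 : 0 <= lambda^-1 * S by rewrite mulr_ge0 ?(ltW S0) ?(ltW li0).
apply: (le_trans (ler_wpM2l A0 k2)).
have B0 : 0 <= lambda^-1 * (p `^ d)^-1 * (1 - u) `^ (d - 1).
  by rewrite !mulr_ge0 ?invr_ge0 ?powR_ge0// ltW.
have := ler_wpM2l B0 k3; congr (_ <= _); ring.
Qed.

(* Modulus of the extended beta integrand, without the power of u, which is harmless on [1/2, 1[. *)
Definition weight (u : R) : R := (1 - u) `^ (d - 1) * `|ml lambda (- (p / (u * (1 - u))))|.

Lemma weight_ge0 u : 0 <= weight u.
Proof. by rewrite mulr_ge0 ?powR_ge0. Qed.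

(** The change of variables is made on [1/2, b] because [subst_map] is unbounded at 1; K does not
    depend on b, so b may tend to 1. *)
Lemma subst_bound (e : R) : 0 < e -> measurable_fun `[(2^-1 : R), 1[ weight ->
  exists2 K : R, 0 <= K & forall b : R, 2^-1 < b < 1 ->
  (\int[mu]_(s in `[subst_map (2^-1)%R, subst_map b]) (`|mlpow lambda s| * expR (- (e * s)))%:E
    <= K%:E * \int[mu]_(u in `[(2^-1)%R, 1%R[) (weight u)%:E)%E.
Proof.
move=> e0 mw; have [K K0 hK] := subst_weight e0.
exists K => // b /andP[b2 b1].
have h2 : 2^-1 = 1 / 2 :> R by rewrite mul1r.
pose G (s : R) : R := `|mlpow lambda s| * expR (- (e * s)).
have in01 (u : R) : 2^-1 <= u <= b -> 0 < u < 1 by move=> /andP[? ?]; apply/andP; split; lra.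
have half01 : 0 < (2^-1 : R) < 1 by apply: in01; rewrite lexx ltW.
have b01 : 0 < b < 1 by apply: in01; rewrite lexx ltW.
have subst : (\int[mu]_(s in `[subst_map (2^-1)%R, subst_map b]) (G s)%:E =
    \int[mu]_(u in `[(2^-1)%R, b]) (((G \o subst_map) * (subst_map^`()%classic)) u)%:E)%E.
  apply: integration_by_substitution_increasing.
  - exact: ltW.
  - move=> u v; rewrite !in_itv/= => /andP[u2 ub] /andP[v2 vb] uv.
    by apply: subst_map_incr => //; lra.
  - move=> u; rewrite in_itv/= => /andP[u2 ub].
    by apply: continuous_subst_derive1; apply: in01; rewrite !ltW.
  - apply/cvg_ex; eexists; apply: cvg_at_right_filter.
    exact: continuous_subst_derive1.
  - apply/cvg_ex; eexists; apply: cvg_at_left_filter.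
    exact: continuous_subst_derive1.
  - have c (u : R) : 0 < u < 1 -> {for u, continuous subst_map}.
      by move=> u01; apply: derivable_continuous; case: (is_derive_subst_map u01).
    split.
    + move=> u; rewrite in_itv/= => /andP[u2 ub].
      have u01 : 0 < u < 1 by apply: in01; rewrite !ltW.
      by case: (is_derive_subst_map u01).
    + by apply: cvg_at_right_filter; exact: c.
    + by apply: cvg_at_left_filter; exact: c.
  - apply: continuous_in_subspaceT => s; rewrite inE/= in_itv/= => /andP[s2 _].
    have s0 : 0 < s by rewrite (lt_le_trans _ s2)// subst_map_gt0.
    apply: cvgM; first by apply: cvg_norm; exact: mlpow_continuous.
    apply: (continuous_comp (f := fun s => - (e * s))); last exact: continuous_expR.
    by apply: cvgN; apply: cvgM; [exact: cvg_cst|exact: cvg_id].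
rewrite subst -ge0_integralZl//; try by move=> u _; rewrite lee_fin weight_ge0.
all: try exact/measurable_EFinP.
apply: (@le_trans _ _ (\int[mu]_(u in `[(2^-1)%R, b]) (K%:E * (weight u)%:E))%E).
  have mW : measurable_fun `[(2^-1 : R), b] weight.
    apply: measurable_funS mw => //; apply: subset_itvl; by rewrite bnd_simp.
  apply: ge0_le_integral => //.
  - move=> u; rewrite /= in_itv/= => /andP[u2 ub].
    have u01 : 0 < u < 1 by apply: in01; rewrite u2.
    rewrite lee_fin; apply: mulr_ge0; first by rewrite mulr_ge0// expR_ge0.
    rewrite subst_derive1// /subst_der; apply: mulr_ge0; first by rewrite mulr_ge0 ?powR_ge0// ltW.
    apply: mulr_ge0; first exact: ltW.
    rewrite mulNr -mulrN opprB mulr_ge0//; last lra.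
    by rewrite invr_ge0 exprn_ge0// ltW// subst_prod_gt0.
  - apply/measurable_EFinP.
    apply: (@eq_measurable_fun _ _ _ _ _ (fun u => G (subst_map u) * subst_der u)).
      move=> u; rewrite inE/= in_itv/= => /andP[u2 ub].
      by rewrite -subst_derive1//; apply: in01; rewrite u2.
    apply: subspace_continuous_measurable_fun => //.
    apply: continuous_in_subspaceT => u; rewrite inE/= in_itv/= => /andP[u2 ub].
    have u01 : 0 < u < 1 by apply: in01; rewrite u2.
    apply: cvgM; last exact: continuous_subst_der.
    have c : {for u, continuous subst_map}.
      by apply: derivable_continuous; case: (is_derive_subst_map u01).
    apply: (@continuous_comp _ _ _ subst_map G); first exact: c.
    apply: cvgM; first by apply: cvg_norm; apply: mlpow_continuous; exact: subst_map_gt0.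
    apply: (continuous_comp (f := fun s => - (e * s))); last exact: continuous_expR.
    by apply: cvgN; apply: cvgM; [exact: cvg_cst|exact: cvg_id].
  - by apply: measurable_funeM; exact/measurable_EFinP.
  move=> u; rewrite /= in_itv/= => /andP[u2 ub].
  have u01 : 0 < u < 1 by apply: in01; rewrite u2.
  rewrite -EFinM lee_fin.
  have -> : ((G \o subst_map) * (subst_map^`()%classic)) u = G (subst_map u) * subst_der u.
    by rewrite -subst_derive1.
  rewrite /G /mlpow subst_map_powR// /weight.
  have u21 : 2^-1 <= u < 1 by rewrite u2; lra.
  have := ler_wpM2l (normr_ge0 (ml lambda (- (p / (u * (1 - u)))))) (hK u u21).
  by congr (_ <= _); ring.
apply: ge0_subset_integral => //.
- by apply: measurable_funeM; exact/measurable_EFinP.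
- by move=> u _; rewrite -EFinM lee_fin mulr_ge0// weight_ge0.
- by apply: subset_itvl; rewrite bnd_simp.
Qed.

(** A finite integral of the weight would bound the Laplace integral of |mlpow| at every rate e:
    [ml_le_abs] takes care of [0, s0], and the substitution of everything beyond. *)
Lemma weight_nonintegrable : measurable_fun `[(2^-1 : R), 1[ weight ->
  ~ (\int[mu]_(u in `[(2^-1)%R, 1%R[) (weight u)%:E < +oo)%E.
Proof.
move=> mw Ifin; apply: (ml_not_subexp l0 l2) => e e0.
have [K K0 hK] := subst_bound e0 mw.
set I := (\int[mu]_(u in _) _)%E in Ifin hK.
pose G (s : R) : R := `|mlpow lambda s| * expR (- (e * s)).
have G0 s : 0 <= G s by rewrite mulr_ge0 ?expR_ge0.
have mG (A : set R) : measurable_fun A G.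
  apply: measurable_funM; first by apply: measurableT_comp => //; exact: measurable_mlpow.
  by apply: measurableT_comp => //; apply: measurableT_comp.
have mGE (A : set R) : measurable_fun A (EFin \o G) by exact/measurable_EFinP.
pose s0 := subst_map 2^-1.
have h2 : 2^-1 = 1 / 2 :> R by rewrite mul1r.
have half01 : 0 < (2^-1 : R) < 1 by apply/andP; split; lra.
have s00 : 0 < s0 by exact: subst_map_gt0.
pose A := (ml lambda (s0 `^ lambda) * s0)%:E.
have hA : (\int[mu]_(s in `[0%R, s0]) (G s)%:E <= A)%E.
  apply: (@le_trans _ _ (\int[mu]_(s in `[0%R, s0]) (cst (ml lambda (s0 `^ lambda))%:E s))%E); last first.
    by rewrite integral_cst//= lebesgue_measure_itv/= lte_fin s00 sube0 /A EFinM.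
  apply: ge0_le_integral => //; [by move=> s _; rewrite lee_fin|exact: mGE|].
  move=> s /=; rewrite in_itv/= => /andP[s1 s2]; rewrite lee_fin /G.
  have h : `|mlpow lambda s| <= ml lambda (s0 `^ lambda).
    apply: ml_le_abs; rewrite powR_ge0/=; apply: ge0_ler_powR; rewrite ?nnegrE//; exact/ltW.
  by apply: le_trans h; rewrite ler_piMr// -expR0 ler_expR oppr_le0 mulr_ge0// ltW.
have hn (n : nat) : (\int[mu]_(s in `[0%R, n%:R]) (G s)%:E <= A + K%:E * I)%E.
  pose N : R := n.+1%:R; have N0 : 0 < N by rewrite ltr0n.
  have q0 : 0 < N `^ lambda by exact: powR_gt0.
  have D0 : 0 < 2 * p + N `^ lambda by rewrite addr_gt0// mulr_gt0.
  (* Here p / r = 2 p + N^lambda, so [subst_base b] exceeds N^lambda; the summand 2 p keeps r below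
     1/2. *)
  pose r := p / (2 * p + N `^ lambda); pose b := 1 - r.
  have r0 : 0 < r by rewrite divr_gt0.
  have r2 : r < 2^-1.
    by rewrite /r ltr_pdivrMr// mulrC ltr_pdivlMr//; lra.
  have b12 : 2^-1 < b < 1 by rewrite /b; apply/andP; split; lra.
  have b01 : 0 < b < 1 by rewrite /b; apply/andP; split; lra.
  have Nb : N <= subst_map b.
    have -> : N = (N `^ lambda) `^ lambda^-1.
      by rewrite -powRrM mulfV ?gt_eqF// powRr1// ltW.
    apply: ge0_ler_powR; rewrite ?nnegrE ?(ltW li0) ?(ltW q0) ?ltW ?subst_base_gt0//.
    rewrite /subst_base /b subKr.
    have b0 : 0 < 1 - r by lra.
    apply: (@le_lt_trans _ _ (p / r)).
      by rewrite /r invf_div mulrCA mulfV ?gt_eqF// mulr1 lerDr mulr_ge0// ltW.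
    move: (r) r0 b0 => x x0 y0.
    by rewrite ltr_pM2l// ltf_pV2 ?posrE ?mulr_gt0// gtr_pMl//; lra.
  apply: (@le_trans _ _ (\int[mu]_(s in (`[0%R, s0] `|` `]s0, subst_map b])%classic) (G s)%:E)%E).
    apply: ge0_subset_integral => //; [exact: measurableU|exact: mGE|by move=> s _; rewrite lee_fin|].
    move=> s /=; rewrite !in_itv/= => /andP[s1 sn].
    have [ss0|ss0] := leP s s0; first by left; rewrite s1.
    right => /=; apply: le_trans Nb; apply: (le_trans sn).
    by rewrite ler_nat.
  rewrite ge0_integral_setU//=.
  - apply: leeD => //; apply: le_trans (hK b b12).
    apply: ge0_subset_integral => //; [exact: mGE|by move=> s _; rewrite lee_fin|].
    by move=> s /=; rewrite !in_itv/= => /andP[/ltW -> ->].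
  - exact: mGE.
  - by move=> s _; rewrite lee_fin.
  - apply/disj_setPS => s [/=]; rewrite !in_itv/= => /andP[_ ss] /andP[ss' _].
    by move: ss; rewrite leNgt ss'.
have B0 : (A + K%:E * I < +oo)%E.
  by rewrite lte_add_pinfty ?ltry// lte_mul_pinfty.
have mGT : measurable_fun setT G by exact: mG.
have lim := @ge0_cvgn_integral R mu G G0 mGT.
apply: (@le_lt_trans _ _ (\int[mu]_(s in `[0%R, +oo[) (G s)%:E)%E).
  apply: ge0_subset_integral => //; first exact: mGE.
  by move=> s /=; rewrite !in_itv/= !andbT => /ltW.
apply: le_lt_trans B0; rewrite -(cvg_lim _ lim)//; apply: lime_le.
  by apply/cvg_ex; eexists; exact: lim.
by apply: nearW => n; exact: hn.
Qed.

End Nonintegrability.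

(** * Exchange of summations *)

Section Growth.
Variable R : realType.
Implicit Types (s t z w gamma sigma : R[i]).

(** Each factor is 1 + (gamma - 1) / K with K = k + 1. Its modulus is at most ((K + 1) / K)^s up to
    an error of order 1 / K^2 in the exponent, and these powers telescope. *)
Lemma bcoef_growth gamma : exists2 C : R, 0 <= C &
  forall k, cabs (bcoef gamma k) <= C * k.+1%:R `^ (complex.Re gamma - 1).
Proof.
pose s := complex.Re gamma - 1; pose w := gamma - 1; rewrite -/s.
pose A := 2 * `|s| + cabs w ^+ 2.
have A0 : 0 <= A by apply: addr_ge0; rewrite ?sqr_ge0 ?mulr_ge0.
exists (expR (2 * A)); first exact: expR_ge0.
move=> k.
(* The growth of exp(A (2 - 1/K)) from K to K + 1 pays for the quadratic error of one step, since
   1/K^2 <= 2 (1/K - 1/(K + 1)). *)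
suff h : cabs (bcoef gamma k) <= expR (A * (2 - k.+1%:R^-1)) * k.+1%:R `^ s.
  apply: (le_trans h); rewrite ler_wpM2r ?powR_ge0// ler_expR mulrC ler_wpM2r//.
  by rewrite lerBlDr lerDl.
elim: k => [|k ih].
  rewrite bcoef0 cabs1 powR1 mulr1 invr1 -expR0 ler_expR mulr_ge0//; lra.
rewrite bcoefSr -mulrA cabsM.
set K : R := k.+1%:R in ih *; have K1 : 1 <= K by rewrite ler1n.
have K0 : 0 < K by rewrite (lt_le_trans _ K1).
have -> : k.+2%:R = K + 1 :> R by rewrite /K natr1.
have -> : (gamma + k%:R) / k.+1%:R = 1 + w * (K^-1)%:C.
  have k0 : (k.+1%:R : R[i]) != 0 by rewrite pnatr_eq0.
  have -> : (K^-1)%:C = (k.+1%:R : R[i])^-1 by rewrite fmorphV/= rmorph_nat.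
  by apply: (mulIf k0); rewrite divfK// mulrDl mul1r divfK// /w -natr1; ring.
move: K K1 K0 ih => K K1 K0 ih.
pose x := K^-1; have x0 : 0 < x by rewrite invr_gt0.
have step : cabs (1 + w * x%:C) <= expR (A * (K^-1 - (K + 1)^-1)) * ((K + 1) / K) `^ s.
  have n2 : cabs (1 + w * x%:C) <= expR (s * x + cabs w ^+ 2 * x ^+ 2 / 2).
    rewrite -(@ler_pXn2r _ 2)// ?nnegrE ?cabs_ge0 ?expR_ge0//.
    have reE : complex.Re (1 + w * x%:C) = 1 + complex.Re w * x by rewrite cReD cReMr.
    have imE : complex.Im (1 + w * x%:C) = complex.Im w * x by rewrite cImD cImMr add0r.
    have := sqr_cabs (1 + w * x%:C); rewrite reE imE => ->.
    rewrite [leRHS]expr2 -expRD.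
    have := expR_ge1Dx (s * x + cabs w ^+ 2 * x ^+ 2 / 2 + (s * x + cabs w ^+ 2 * x ^+ 2 / 2)).
    apply: le_trans.
    have -> : s = complex.Re w by rewrite /w cReD cReN.
    rewrite sqr_cabs; set a := complex.Re w; set b := complex.Im w.
    by rewrite le_eqVlt; apply/orP; left; apply/eqP; field.
  apply: (le_trans n2).
  have q0 : 0 < (K + 1) / K by rewrite divr_gt0//; lra.
  have -> : ((K + 1) / K) `^ s = expR (s * ln ((K + 1) / K)) by rewrite /powR gt_eqF.
  rewrite -expRD ler_expR.
  have qE : (K + 1) / K = 1 + x by rewrite /x; field; rewrite gt_eqF.
  have l1 : ln (1 + x) <= x by apply: le_ln1Dx; lra.
  have l2 : x - x ^+ 2 <= ln (1 + x).
    have i0 : 0 < (1 + x)^-1 by rewrite invr_gt0; lra.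
    have := @le_ln1Dx _ ((1 + x)^-1 - 1).
    rewrite addrCA subrr addr0 lnV ?posrE; last lra.
    have -> : -1 < (1 + x)^-1 - 1 by lra.
    move=> /(_ isT) h.
    have e : (1 + x)^-1 * (1 + x) = 1 by rewrite mulVf// gt_eqF//; lra.
    have : (1 + x)^-1 <= 1 - x + x ^+ 2.
      rewrite -div1r ler_pdivrMr; last lra.
      have : 0 <= x ^+ 3 by rewrite exprn_ge0// ltW.
      lra.
    lra.
  rewrite qE.
  have b1 : s * (x - ln (1 + x)) <= `|s| * x ^+ 2.
    have h : 0 <= x - ln (1 + x) by lra.
    apply: le_trans (_ : `|s| * (x - ln (1 + x)) <= _).
      by rewrite ler_wpM2r// ler_norm.
    rewrite ler_wpM2l//; lra.
  have xx : x ^+ 2 <= 2 * (K^-1 - (K + 1)^-1).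
    have -> : K^-1 - (K + 1)^-1 = x / (K + 1) by rewrite /x; field; rewrite !gt_eqF//; lra.
    rewrite expr2 mulrCA ler_wpM2l ?(ltW x0)// ler_pdivlMr; last lra.
    have e : x * K = 1 by rewrite /x mulVf// gt_eqF.
    have x1 : x <= 1 by rewrite /x invf_le1.
    lra.
  have c0 : 0 <= `|s| + cabs w ^+ 2 / 2 by rewrite addr_ge0// divr_ge0 ?sqr_ge0.
  have := ler_wpM2l c0 xx; rewrite /A; lra.
apply: (le_trans (ler_pM (cabs_ge0 _) (cabs_ge0 _) ih step)).
have -> : (K + 1) `^ s = K `^ s * ((K + 1) / K) `^ s.
  rewrite -powRM ?(ltW K0)//; last by rewrite divr_ge0//; lra.
  by rewrite mulrCA divff ?gt_eqF// mulr1.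
rewrite mulrACA -expRD ler_wpM2r ?mulr_ge0 ?powR_ge0//.
by rewrite ler_expR -mulrDr ler_wpM2l//; lra.
Qed.

(** By comparison with a telescoping series: e (K + 1)^(-1 - e) <= K^(-e) - (K + 1)^(-e). *)
Lemma powR_series_cvg (e : R) : 0 < e -> cvgn (series (fun k => k.+1%:R `^ (- 1 - e) : R)).
Proof.
move=> e0.
have tel (k : nat) : e * (k.+2%:R : R) `^ (- 1 - e) <= k.+1%:R `^ (- e) - k.+2%:R `^ (- e).
  set K : R := k.+1%:R; have K0 : 0 < K by rewrite ltr0n.
  have -> : k.+2%:R = K + 1 :> R by rewrite /K natr1.
  move: K K0 => K K0; have K1 : 0 < K + 1 by lra.
  have L0 : 0 < (K + 1) `^ (- e) by exact: powR_gt0.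
  have -> : (K + 1) `^ (- 1 - e) = (K + 1)^-1 * (K + 1) `^ (- e).
    rewrite powRD ?powR_inv1 ?(ltW K1)//; by apply/implyP => _; rewrite gt_eqF.
  have -> : K `^ (- e) = (K + 1) `^ (- e) * expR (e * ln ((K + 1) / K)).
    have h : K = (K + 1) * ((K + 1) / K)^-1 by field; rewrite !gt_eqF//; lra.
    have q0 : 0 < (K + 1) / K by rewrite divr_gt0.
    rewrite {1}h powRM ?(ltW K1) ?invr_ge0 ?(ltW q0)//; congr (_ * _).
    by rewrite /powR gt_eqF ?invr_gt0// lnV ?posrE// mulrNN.
  have h1 := expR_ge1Dx (e * ln ((K + 1) / K)).
  have h2 : (K + 1)^-1 <= ln ((K + 1) / K).
    have q0 : 0 < (K + 1) / K by rewrite divr_gt0.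
    have i1 : 0 < (K + 1)^-1 by rewrite invr_gt0.
    have := @le_ln1Dx _ (- (K + 1)^-1).
    have -> : 1 - (K + 1)^-1 = ((K + 1) / K)^-1 by field; rewrite !gt_eqF//; lra.
    rewrite lnV ?posrE// lerN2; apply.
    rewrite ltrN2 invf_lt1//; lra.
  have h3 : e * (K + 1)^-1 <= e * ln ((K + 1) / K) by rewrite ler_pM2l.
  have := ler_wpM2l (ltW L0) (le_trans h3 (_ : e * ln ((K + 1) / K) <= expR (e * ln ((K + 1) / K)) - 1)).
  move=> /(_ _); rewrite mulrBr mulr1 => h4.
  have -> : e * ((K + 1)^-1 * (K + 1) `^ (- e)) = (K + 1) `^ (- e) * (e * (K + 1)^-1) by ring.
  by apply: h4; lra.
apply: (@cvg_series_sum_le _ _ (1 + e^-1)) => [n|n]; first exact: powR_ge0.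
have S n' : e * series (fun k => k.+1%:R `^ (- 1 - e) : R) n'.+1 <= e + 1 - (n'.+1%:R : R) `^ (- e).
  elim: n' => [|m ih]; first by rewrite /series/= big_nat1 !powR1; lra.
  rewrite seriesSr mulrDr; have := tel m; lra.
case: n => [|n]; first by rewrite /series/= big_geq// addr_ge0// invr_ge0 ltW.
rewrite -(ler_pM2l e0) mulrDr mulr1 mulfV ?gt_eqF//.
by apply: (le_trans (S n)); rewrite lerBlDr lerDl powR_ge0.
Qed.

Lemma powR_geometric_cvg (b x : R) : 0 <= x < 1 ->
  cvgn (series (fun k => k.+1%:R `^ b * x ^+ k : R)).
Proof.
move=> /andP[x0 x1].
(* As x = 1 - 2 c < 1 - c <= exp(- c), the ratio exp(c) x stays below 1 after an exponential of rate
   c has absorbed the power. *)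
pose c := (1 - x) / 2; have c0 : 0 < c by rewrite /c; lra.
have b0 : 0 <= `|b| by [].
have [C C0 hC] := powR_le_expR b0 c0.
have q0 : 0 <= expR c * x by rewrite mulr_ge0 ?expR_ge0.
apply: (@series_le_cvg _ _ (fun k => (C * expR c) * (expR c * x) ^+ k)) => [k|k|k|].
- by rewrite mulr_ge0 ?powR_ge0// exprn_ge0.
- by rewrite !mulr_ge0 ?expR_ge0 ?exprn_ge0// ltW.
- have k1 : 1 <= (k.+1%:R : R) by rewrite ler1n.
  have h1 : (k.+1%:R : R) `^ b <= k.+1%:R `^ `|b| by apply: ler_powR => //; exact: ler_norm.
  have h2 := hC k.+1%:R (ltr0Sn _ _).
  rewrite exprMn mulrA ler_wpM2r ?exprn_ge0//.
  apply: (le_trans h1); apply: (le_trans h2).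
  by rewrite -mulrA -exprS -expRM_natl [k.+1%:R * c]mulrC.
- apply: (@is_cvg_geometric_series R (C * expR c) (expR c * x)).
  rewrite ger0_norm// -ltr_pdivlMl ?expR_gt0// mulr1 -expRN.
  by apply: lt_le_trans (expR_ge1Dx (- c)); rewrite /c; lra.
Qed.

Lemma cpow_natD (r : R) s n : 0 < r -> cpow r%:C (s + n%:R) = cpow r%:C s * r%:C ^+ n.
Proof.
move=> r0; elim: n => [|n ih]; first by rewrite addr0 expr0 mulr1.
rewrite -natr1 addrA exprSr mulrA -ih /cpow mulrDl mul1r cexpD; congr (_ * _).
rewrite clog_right// [complex.Im _]/= mul0r atan0 expr0n addr0 lnXn//.
rewrite /cexp/= cos0 sin0 (_ : ln r *+ 2 / 2 = ln r); last by field.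
by rewrite lnK ?posrE//; apply: complexP; rewrite !(cReM, cImM)/=; ring.
Qed.

Lemma cabs_cpow (r : R) s : 0 < r -> cabs (cpow r%:C s) = r `^ complex.Re s.
Proof.
move=> r0; rewrite cabs_cexp clog_right// [complex.Im _]/= mul0r atan0 expr0n addr0 lnXn//.
by rewrite cReM/= mulr0 subr0 /powR gt_eqF//; congr expR; field.
Qed.

(** A positive factor leaves the argument unchanged, so there is no branch correction; meant for k +
    a - t = (k + a) (1 - t / (k + a)). *)
Lemma cpowMr (r : R) w s : 0 < r -> w != 0 -> cpow (r%:C * w) s = cpow r%:C s * cpow w s.
Proof.
move=> r0 w0; rewrite /cpow -cexpD -mulrDr; congr (cexp (_ * _)).
have c0 : 0 < cabs w by rewrite cabs_gt0.
rewrite [X in _ = X + _]clog_right// [complex.Im r%:C]/= mul0r atan0 expr0n addr0 lnXn//.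
have clE v : clog v = ln (cabs v) +i* carg v by [].
have cE v : carg v = if 0 <= complex.Im v then acos (complex.Re v / cabs v)
    else - acos (complex.Re v / cabs v) by [].
rewrite !clE cabsM cabsR gtr0_norm// lnM ?posrE//.
have -> : ln r *+ 2 / 2 = ln r by field.
apply: complexP; [rewrite cReD|rewrite cImD]; first by [].
rewrite [complex.Im (_ +i* carg (r%:C * w))]/= [complex.Im (_ +i* 0)]/= [complex.Im (_ +i* carg w)]/= add0r.
rewrite !cE cabsM cabsR gtr0_norm//.
have -> : complex.Re (r%:C * w) = r * complex.Re w by rewrite mulrC cReMr mulrC.
have -> : complex.Im (r%:C * w) = r * complex.Im w by rewrite mulrC cImMr mulrC.
by rewrite pmulr_rge0// -mulf_div divff ?gt_eqF// mul1r.
Qed.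

Lemma cpowN w s : cpow w (- s) = (cpow w s)^-1.
Proof. by rewrite /cpow mulNr cexpN. Qed.

End Growth.

(** * The exchange for an absolutely summable weight *)

Section Exchange.
Variable R : realType.

Lemma has_csum_tail (u : nat -> R[i]) (l : R[i]) N : has_csum u l ->
  has_csum (fun n => if (n < N)%N then 0 else u n) (l - series u N).
Proof.
move=> h.
have hf : has_csum (fun n => if (n < N)%N then u n else 0) (series u N).
  apply: (@cvg_near_cst _ R[i]^o); exists N => // n /= Nn.
  rewrite /series/= (big_cat_nat (n := N))//= [X in _ + X]big_nat_cond [X in _ + X]big1 ?addr0.
    by apply: eq_big_nat => i /andP[_ ->].
  by move=> i /andP[/andP[Ni _] _]; rewrite ltnNge Ni.
have := has_csumD h (@has_csumZ R _ _ (- 1) hf); rewrite mulN1r.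
by apply: eq_has_csum => n; case: ifP => _; rewrite mulN1r ?oppr0 ?addr0 ?addrN.
Qed.

Lemma cvg_series_tail (b : nat -> R) N : cvgn (series b) ->
  series (fun n => if (n < N)%N then 0 else b n) @ \oo --> limn (series b) - series b N.
Proof.
move=> cb.
have h : (fun n => series b n - series b N) @ \oo --> limn (series b) - series b N.
  by apply: cvgB => //; exact: cvg_cst.
apply: cvg_trans h; apply: near_eq_cvg; exists N => // n /= Nn.
rewrite sub_series_geq// [RHS]/series/= [RHS](big_cat_nat (n := N))//= [X in _ = X + _]big_nat_cond.
rewrite [X in _ = X + _]big1 ?add0r; last by move=> i /andP[/andP[_ ->]].
by apply: eq_big_nat => i /andP[Ni _]; rewrite ltnNge Ni.
Qed.

(** Since |t / (k + a)| <= |t| / a < 1 for all k, the binomial partial sums converge uniformly in k,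
    with error at most the tail [tau N] of one majorant. The partial sums in n therefore miss the
    total by at most [Ct * tau N]. *)
Lemma lerch_exchange (c : nat -> R[i]) (sigma t : R[i]) (a : R) :
  cabs t < a -> acsum c ->
  has_csum (fun n => bcoef sigma n * csum (fun k => c k / (k%:R + a)%:C ^+ n) * t ^+ n)
    (csum (fun k => c k * cpow (1 - t / (k%:R + a)%:C) (- sigma))).
Proof.
move=> ta ac.
have a0 : 0 < a by rewrite (le_lt_trans _ ta)// cabs_ge0.
pose x k : R[i] := t / (k%:R + a)%:C.
pose X := cabs t / a.
have ka k : a <= k%:R + a by rewrite lerDr.
have ka0 k : 0 < k%:R + a by rewrite (lt_le_trans a0).
have X0 : 0 <= X by rewrite divr_ge0 ?cabs_ge0// ltW.
have X1 : X < 1 by rewrite ltr_pdivrMr// mul1r.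
have xX k : cabs (x k) <= X.
  by rewrite /x cabsM cabsV cabsR gtr0_norm// ler_wpM2l ?cabs_ge0// lef_pV2 ?posrE.
have x1 k : cabs (x k) < 1 by exact: le_lt_trans (xX k) X1.
pose b n := cabs (bcoef sigma n) * X ^+ n.
have cb : cvgn (series b).
  have h : cabs (X%:C : R[i]) < 1 by rewrite cabsR ger0_norm.
  have := @acsum_binom R sigma X%:C h; apply: eq_cvg_series => n.
  by rewrite cabsM cabsX cabsR ger0_norm.
pose S N (y : R[i]) := series (fun n => bcoef sigma n * y ^+ n) N.
pose tau N := limn (series b) - series b N.
have tailP N k : cabs (cpow (1 - x k) (- sigma) - S N (x k)) <= tau N.
  have h := @has_csum_tail _ _ N (acsum_has (@acsum_binom R sigma (x k) (x1 k))).
  rewrite binom_series// in h.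
  apply: (cabs_csum_le _ h (@cvg_series_tail _ N cb)) => n.
  case: ifP => _; first by rewrite cabs0.
  rewrite cabsM cabsX /b ler_wpM2l ?cabs_ge0//.
  by apply: lerXn2r; rewrite ?nnegrE ?cabs_ge0.
have tau0 N : 0 <= tau N by apply: le_trans (tailP N 0%N); exact: cabs_ge0.
pose Ct := limn (series (fun k => cabs (c k))).
have cM (M : R) (u : nat -> R[i]) : (forall k, cabs (u k) <= M) -> acsum (fun k => c k * u k).
  move=> uM; apply: (@acsum_le _ _ (fun k => cabs (c k) * M)).
    by move=> k; rewrite cabsM ler_wpM2l ?cabs_ge0.
  by apply: eq_cvg_series (@is_cvg_seriesZ _ _ M ac) => k; rewrite mulrC.
have hP : has_csum (fun k => c k * cpow (1 - x k) (- sigma))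
    (csum (fun k => c k * cpow (1 - x k) (- sigma))).
  apply/acsum_has/(cM (tau 0%N)) => k.
  by have := tailP 0%N k; rewrite /S /series/= big_geq// subr0.
set T := csum _ in hP; rewrite -/T.
have hterm n : has_csum (fun k => c k * (bcoef sigma n * x k ^+ n))
    (bcoef sigma n * csum (fun k => c k / (k%:R + a)%:C ^+ n) * t ^+ n).
  have h : acsum (fun k => c k * ((k%:R + a)%:C ^+ n)^-1).
    apply: (cM ((a ^+ n)^-1)) => k; rewrite cabsV cabsX cabsR gtr0_norm//.
    rewrite lef_pV2 ?posrE ?exprn_gt0//; apply: lerXn2r; rewrite ?nnegrE//; exact: ltW.
  have := @has_csumZ R _ _ (bcoef sigma n * t ^+ n) (acsum_has h).
  rewrite [X in has_csum _ X -> _]mulrAC; apply: eq_has_csum => k.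
  rewrite /x expr_div_n; move: (bcoef _ _) (c k) (t ^+ n) (_ ^-1) => B Ck T' I.
  by rewrite mulrCA -mulrA.
have hpart N : has_csum (fun k => c k * S N (x k))
    (series (fun n => bcoef sigma n * csum (fun k => c k / (k%:R + a)%:C ^+ n) * t ^+ n) N).
  have := @has_csum_sum R N (fun n k => c k * (bcoef sigma n * x k ^+ n)) _ (fun n _ => hterm n).
  by apply: eq_has_csum => k; rewrite -mulr_sumr.
have dist N : cabs (T - series (fun n => bcoef sigma n * csum (fun k => c k / (k%:R + a)%:C ^+ n) * t ^+ n) N)
    <= Ct * tau N.
  have h := has_csumD hP (@has_csumZ R _ _ (- 1) (hpart N)); rewrite mulN1r in h.
  apply: (cabs_csum_le (v := fun k => cabs (c k) * tau N) _ h).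
    by move=> k; rewrite mulN1r -mulrBr cabsM ler_wpM2l ?cabs_ge0.
  have : (fun M => series (fun k => cabs (c k)) M * tau N) @ \oo --> Ct * tau N.
    by apply: cvgM => //; exact: cvg_cst.
  by apply: eq_cvgn => M; rewrite /series/= mulr_suml.
have lim0 : (fun N => Ct * tau N) @ \oo --> (0 : R).
  rewrite -(mulr0 Ct); apply: cvgM; first exact: cvg_cst.
  by rewrite -(subrr (limn (series b))); apply: cvgB => //; exact: cvg_cst.
rewrite /has_csum; apply/cvgrPdist_lt => e; rewrite ltcE => /andP[/eqP ie re].
have -> : e = (complex.Re e)%:C by apply: complexP.
have /cvgrPdist_lt/(_ _ re) := lim0; apply: filterS => N.
rewrite sub0r normrN => h; rewrite cabsE ltcR (le_lt_trans (dist N))//.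
by rewrite (le_lt_trans _ h)// ler_norm.
Qed.

End Exchange.

(** * Decay of the extended beta function *)

Section Beta.
Variable R : realType.
Implicit Types (x y z s : R[i]) (p lambda u : R) (k m n : nat).
Local Notation mu := (@lebesgue_measure R).

(** If a component of f is not integrable, the left side is the default value 0. The factor 2 comes
    from bounding the two components separately. *)
Lemma cabs_cintegral_le (D : set R) (f : R -> R[i]) (g : R -> R) : measurable D ->
  mu.-integrable D (EFin \o g) -> (forall u, D u -> cabs (f u) <= g u) ->
  cabs (cintegral D f) <= 2 * (\int[mu]_(u in D) g u)%R.
Proof.
move=> mD ig fg; rewrite /cintegral.
case: asboolP => [[h1 h2]|_]; last first.
  rewrite cabs0 mulr_ge0// Rintegral_ge0// => u Du.
  exact: le_trans (cabs_ge0 _) (fg u Du).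
apply: (le_trans (cabs_le_ReIm _)); rewrite mulr_natl mulr2n /=; apply: lerD.
  apply: (le_trans (@le_normr_Rintegral _ _ _ mu _ _ mD h1)); apply: le_Rintegral => //.
    exact: integrable_norm.
  by move=> u Du; exact: le_trans (Re_le_cabs _) (fg u Du).
apply: (le_trans (@le_normr_Rintegral _ _ _ mu _ _ mD h2)); apply: le_Rintegral => //.
  exact: integrable_norm.
by move=> u Du; exact: le_trans (Im_le_cabs _) (fg u Du).
Qed.

Definition ebeta_kernel x y p lambda u : R[i] :=
  cpow u%:C (x - 1) * cpow (1 - u)%:C (y - 1) * mittag_leffler lambda (- (p / (u * (1 - u))))%:C.

Lemma cabs_ebeta_kernel x y p lambda u : 0 < lambda -> 0 < u < 1 ->
  cabs (ebeta_kernel x y p lambda u) =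
  u `^ (complex.Re x - 1) * (1 - u) `^ (complex.Re y - 1) * `|ml lambda (- (p / (u * (1 - u))))|.
Proof.
move=> l0 /andP[u0 u1]; rewrite /ebeta_kernel mittag_lefflerE//.
have v0 : 0 < 1 - u by rewrite subr_gt0.
by rewrite cabsM [cabs (_ * _)]cabsM !cabs_cpow// cabsR !cReD !cReN.
Qed.

Lemma ebeta_kernel_natD x y p lambda u n : 0 < u ->
  ebeta_kernel (x + n%:R) y p lambda u = ebeta_kernel x y p lambda u * (u ^+ n)%:C.
Proof.
move=> u0; rewrite /ebeta_kernel addrAC cpow_natD// rmorphXn/=.
have h (a b c e : R[i]) : a * e * b * c = a * b * c * e by ring.
exact: h.
Qed.

(* If the integrand is never integrable, then all the values are the default value 0. *)
Lemma ext_beta_bounded x y p lambda : exists B : R, exists K : nat,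
  forall k, (K <= k)%N -> cabs (ext_beta (x + k%:R) y p lambda) <= B.
Proof.
pose f k := ebeta_kernel (x + k%:R) y p lambda.
pose I k := mu.-integrable `]0, 1[ (EFin \o (fun u => complex.Re (f k u))) /\
  mu.-integrable `]0, 1[ (EFin \o (fun u => complex.Im (f k u))).
have [[K [h1 h2]]|nI] := pselect (exists K, I K); last first.
  exists 0, 0%N => k _; rewrite /ext_beta /cintegral.
  by case: asboolP => [h|_]; [case: nI; exists k|rewrite cabs0].
(* For k >= K the kernel is the one at K multiplied by u^(k - K) <= 1, so the integrable function g
   dominates all of them. *)
pose g (u : R) : R := `|complex.Re (f K u)| + `|complex.Im (f K u)|.
exists (2 * (\int[mu]_(u in `]0, 1[) g u)%R), K => k Kk.
apply: cabs_cintegral_le => //.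
  have -> : EFin \o g = ((fun u => `|complex.Re (f K u)|%:E) \+ (fun u => `|complex.Im (f K u)|%:E))%E by [].
  by apply: integrableD => //; exact: integrable_norm.
move=> u /=; rewrite in_itv/= => /andP[u0 u1].
rewrite -/(ebeta_kernel _ _ _ _ _) -(subnK Kk) addnC natrD addrA ebeta_kernel_natD//.
rewrite cabsM; apply: le_trans (cabs_le_ReIm _).
rewrite ler_piMr ?cabs_ge0// cabsR ger0_norm ?exprn_ge0 ?(ltW u0)//.
by rewrite exprn_ile1// ltW.
Qed.

(** Put v = (1 - u) (m + 1): then v^(d - 1) <= C exp(v), while u^m <= exp(- (1 - u) m), and the
    product of the exponentials is exp(1 - u) <= exp(1). *)
Lemma expn_powR_le (d : R) : 1 < d -> exists2 C : R, 0 < C &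
  forall m u, 0 < u < 1 -> u ^+ m * (1 - u) `^ (d - 1) <= C * m.+1%:R `^ (1 - d).
Proof.
move=> d1; have d0 : 0 <= d - 1 by rewrite subr_ge0 ltW.
have [C C0 hC] := powR_le_expR d0 (@ltr01 R).
exists (C * expR 1); first by rewrite mulr_gt0// expR_gt0.
move=> m u /andP[u0 u1].
have -> : 1 - d = - (d - 1) by rewrite opprB.
have M0 : 0 < (m.+1%:R : R) by rewrite ltr0n.
rewrite powRN ler_pdivlMr ?powR_gt0// -mulrA -powRM ?subr_ge0 ?(ltW u1) ?(ltW M0)//.
have r0 : 0 < 1 - u by rewrite subr_gt0.
have h := hC ((1 - u) * m.+1%:R) (mulr_gt0 r0 M0); rewrite mul1r in h.
apply: (le_trans (ler_wpM2l _ h)); first by rewrite exprn_ge0// ltW.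
rewrite mulrCA ler_wpM2l ?(ltW C0)//.
have um : u ^+ m <= expR (- ((1 - u) * m%:R)).
  rewrite -mulNr mulrC expRM_natl; apply: lerXn2r; rewrite ?nnegrE ?(ltW u0) ?expR_ge0//.
  by have := expR_ge1Dx (- (1 - u)); apply: le_trans; lra.
apply: (le_trans (ler_wpM2r (expR_ge0 _) um)).
by rewrite -expRD ler_expR -natr1; lra.
Qed.

(** The interval has length 1, so a pointwise bound of the kernel by [expn_powR_le] is enough. *)
Lemma ext_beta_decay_bounded x y p lambda (M : R) : 0 < lambda -> 1 < complex.Re y ->
  (forall u, 0 < u < 1 -> `|ml lambda (- (p / (u * (1 - u))))| <= M) ->
  exists C : R, exists K : nat, forall k, (K <= k)%N ->
    cabs (ext_beta (x + k%:R) y p lambda) <= C * k.+1%:R `^ (1 - complex.Re y).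
Proof.
move=> l0 d1 hM; set d := complex.Re y in d1 *.
have [C C0 hC] := expn_powR_le d1.
have M0 : 0 <= M by apply: le_trans (hM (1 / 2) _); rewrite ?normr_ge0//; apply/andP; split; lra.
(* After K powers of u are set aside, u^(Re x + K - 1) <= 1 removes the singularity at 0; the
   remaining m = k - K powers produce the decay. *)
pose K := Num.bound `|complex.Re x - 1|.
have hK : 0 <= complex.Re x - 1 + K%:R.
  have := archi_boundP (normr_ge0 (complex.Re x - 1)); rewrite -/K => hb.
  by have := ler_norm (- (complex.Re x - 1)); rewrite normrN => hn; lra.
exists (2 * (C * M * K.+1%:R `^ (d - 1))), K => k Kk; pose m := (k - K)%N.
have d0 : 0 <= d - 1 by rewrite subr_ge0 ltW.
(* From k + 1 <= (K + 1) (m + 1) and 1 - d < 0: the shift by K costs only a constant. *)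
have mk : (m.+1%:R : R) `^ (1 - d) <= K.+1%:R `^ (d - 1) * k.+1%:R `^ (1 - d).
  have -> : 1 - d = - (d - 1) by rewrite opprB.
  rewrite !powRN ler_pdivlMr ?powR_gt0// ler_pdivrMl ?powR_gt0// -powRM//.
  apply: ge0_ler_powR; rewrite ?nnegrE// -?natrM ?ler_nat//.
  by rewrite -(subnK Kk) -/m mulSn mulnS addSn ltnS addnA [(K + m)%N]addnC leq_addr.
pose B : R := C * M * m.+1%:R `^ (1 - d).
have hB : cabs (ext_beta (x + k%:R) y p lambda) <= 2 * B.
  have -> : B = (\int[mu]_(u in `]0%R, 1%R[) (cst B u))%R.
    by rewrite (@Rintegral_cst _ _ _ mu)//= lebesgue_measure_itv/= lte_fin ltr01 sube0 mulr1.
  apply: cabs_cintegral_le => //.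
    apply/integrableP; split; first exact/measurable_EFinP.
    rewrite [X in (X < _)%E](_ : _ = (\int[mu]_(u in `]0%R, 1%R[) (cst `|B|%:E u))%E)//.
    by rewrite integral_cst//= lebesgue_measure_itv/= lte_fin ltr01 sube0 mule1 ltry.
  move=> u /=; rewrite in_itv/= => u01; have /andP[u0 u1] := u01.
  rewrite -/(ebeta_kernel _ _ _ _ _) -(subnK Kk) -/m addnC natrD addrA ebeta_kernel_natD//.
  rewrite cabsM cabs_ebeta_kernel// cabsR [`|u ^+ m|]ger0_norm ?exprn_ge0 ?(ltW u0)// cReD -/d.
  have -> : complex.Re (K%:R : R[i]) = K%:R by rewrite -(rmorph_nat (real_complex R)).
  have e1 : u `^ (complex.Re x + K%:R - 1) <= 1.
    have h : 0 <= complex.Re x + K%:R - 1 by rewrite addrAC.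
    by have := @ger_powR _ u (etrans (congr1 (andb^~ _) u0) (ltW u1)) _ _ h; rewrite powRr0.
  have := hC m u u01; have := hM u u01; rewrite /B.
  have := powR_ge0 u (complex.Re x + K%:R - 1).
  have := powR_ge0 (1 - u) (d - 1).
  have := normr_ge0 (ml lambda (- (p / (u * (1 - u))))).
  have : 0 <= u ^+ m by rewrite exprn_ge0// ltW.
  move: (u `^ _) e1 ((1 - u) `^ _) (`|_|) (u ^+ m) (m.+1%:R `^ _) => a a1 b c e g e0 c0 b0 a0 cM beg.
  have -> : a * b * c * e = a * (c * (e * b)) by ring.
  apply: (@le_trans _ _ (c * (e * b))).
    by rewrite ler_piMl// !mulr_ge0.
  apply: le_trans (ler_pM c0 (mulr_ge0 e0 b0) cM beg) _.
  by rewrite mulrCA mulrA.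
apply: (le_trans hB); rewrite -!mulrA ler_wpM2l//.
by rewrite /B -mulrA; do 2![rewrite ler_wpM2l// ?(ltW C0)//].
Qed.

(* The integrand is not integrable near 1; 0 is the default value of [cintegral]. *)
Lemma ext_beta_eq0 x y p lambda : 0 < p -> 2 < lambda -> 0 < complex.Re y ->
  ext_beta x y p lambda = 0.
Proof.
move=> p0 l2 d0; rewrite /ext_beta /cintegral; case: asboolP => // -[h1 h2]; exfalso.
have l0 : 0 < lambda by lra.
pose f := ebeta_kernel x y p lambda.
have {}h1 : mu.-integrable `]0, 1[ (EFin \o (fun u => complex.Re (f u))) := h1.
have {}h2 : mu.-integrable `]0, 1[ (EFin \o (fun u => complex.Im (f u))) := h2.
have hh : 2^-1 = 1 / 2 :> R by rewrite mul1r.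
have cont u : 0 < u < 1 -> {for u, continuous (weight p lambda (complex.Re y))}.
  move=> /andP[u0 u1].
  have cl (t : R) : {for t, continuous (fun v : R => 1 - v)}.
    by apply: cvgB; [exact: cvg_cst|exact: cvg_id].
  apply: cvgM.
    apply: (@continuous_comp _ _ _ (fun v : R => 1 - v) (fun v => v `^ (complex.Re y - 1))).
      exact: cl.
    have v0 : 0 < 1 - u by lra.
    by apply: derivable_continuous; case: (is_derive1_powR (complex.Re y - 1) v0).
  apply: cvg_norm.
  apply: (@continuous_comp _ _ _ (fun v : R => - (p / (v * (1 - v)))) (ml lambda)).
    apply: cvgN; apply: cvgM; first exact: cvg_cst.
    apply: cvgV; first by rewrite mulf_neq0// gt_eqF//; lra.
    by apply: cvgM; [exact: cvg_id|exact: cl].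
  apply: derivable_continuous.
  by case: (@entire_is_derive R (mlcoef lambda) (- (p / (u * (1 - u)))) (entire_mlcoef l0)).
have mw : measurable_fun `[(2^-1 : R), 1[ (weight p lambda (complex.Re y)).
  apply: subspace_continuous_measurable_fun => //.
  apply: continuous_in_subspaceT => u; rewrite inE/= in_itv/= => /andP[u2 u1].
  by apply: cont; apply/andP; split; lra.
apply: (@weight_nonintegrable R p lambda (complex.Re y)) => //.
pose g (u : R) : R := `|complex.Re (f u)| + `|complex.Im (f u)|.
have ig : mu.-integrable `]0, 1[ (EFin \o g).
  have -> : EFin \o g = ((fun u => `|complex.Re (f u)|%:E) \+ (fun u => `|complex.Im (f u)|%:E))%E by [].
  by apply: integrableD => //; exact: integrable_norm.
(* On [1/2, 1[ the factor u^(Re x - 1) is at least u^e, and 2^e u^e = (2 u)^e >= 1; thus C times the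
   modulus of the kernel dominates the weight. *)
pose e := `|complex.Re x - 1|; pose C : R := 2 `^ e.
have C0 : 0 <= C by exact: powR_ge0.
have iC : mu.-integrable `[(2^-1)%R, 1%R[ (EFin \o (fun u => C * g u)).
  have -> : EFin \o (fun u => C * g u) = (fun u => C%:E * (EFin \o g) u)%E by [].
  apply: integrableZl => //; apply: (integrableS _ _ _ ig) => //.
  by move=> u /=; rewrite !in_itv/= => /andP[u2 ->]; rewrite andbT; lra.
apply: le_lt_trans (integrable_lty _ iC) => //.
apply: ge0_le_integral => //.
- by move=> u _; rewrite lee_fin weight_ge0.
- exact/measurable_EFinP.
- exact: measurable_int iC.
move=> u /=; rewrite in_itv/= => /andP[u2 u1]; rewrite lee_fin.
have u01 : 0 < u < 1 by apply/andP; split; lra.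
have u0 : 0 < u by lra.
apply: (@le_trans _ _ (C * cabs (f u))); last by rewrite ler_wpM2l// cabs_le_ReIm.
have -> : cabs (f u) = u `^ (complex.Re x - 1) * weight p lambda (complex.Re y) u.
  by rewrite [LHS]cabs_ebeta_kernel// -mulrA.
rewrite mulrA ler_peMl ?weight_ge0//.
have ue : 1 <= 2 * u by lra.
apply: (@le_trans _ _ ((2 * u) `^ e)).
  by have := @ler_powR _ _ ue 0 e (normr_ge0 _); rewrite powRr0.
rewrite powRM ?(ltW u0)// ler_wpM2l//.
by apply: ger_powR; [rewrite u0 ltW|exact: ler_norm].
Qed.

Lemma ext_beta_decay x y p lambda : 0 <= p -> 0 < lambda -> 1 < complex.Re y ->
  exists C : R, exists K : nat, forall k, (K <= k)%N ->
    cabs (ext_beta (x + k%:R) y p lambda) <= C * k.+1%:R `^ (1 - complex.Re y).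
Proof.
move=> p0 l0 d1.
have [l2|l2] := leP lambda 2.
  apply: (@ext_beta_decay_bounded _ _ _ _ 1) => // u /andP[u0 u1].
  apply: ml_bound; first by rewrite l0.
  by rewrite divr_ge0// mulr_ge0// ltW// subr_gt0.
have [->|pn0] := eqVneq p 0.
  by apply: (@ext_beta_decay_bounded _ _ _ _ `|ml lambda (- 0)|) => // u _; rewrite mul0r.
exists 0, 0%N => k _; rewrite ext_beta_eq0 ?cabs0 ?mul0r//; first by rewrite lt_neqAle eq_sym pn0.
by lra.
Qed.

End Beta.

(** * Absolute convergence of the extended Hurwitz-Lerch series *)

Section Summability.
Variable R : realType.
Implicit Types (x y z s gamma theta upsilon sigma t : R[i]) (p lambda : R).

Lemma acsum_le_near (u : nat -> R[i]) (v : nat -> R) K :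
  (forall n, (K <= n)%N -> cabs (u n) <= v n) -> cvgn (series v) -> acsum u.
Proof.
move=> uv cv; apply: (@acsum_le _ _ (fun n => if (n < K)%N then cabs (u n) else v n)).
  by move=> n; case: ltnP => // /uv.
rewrite -(is_cvg_series_restrict K); rewrite -(is_cvg_series_restrict K) in cv.
rewrite (_ : (fun n => \sum_(K <= k < n) _) = (fun n => \sum_(K <= k < n) v k))//.
apply/funext => n; apply: eq_big_nat => i /andP[Ki _].
by rewrite ltnNge Ki.
Qed.

Lemma powR_natD_le (a s : R) : 0 < a -> exists2 D : R, 0 <= D &
  forall k : nat, (k%:R + a) `^ s <= D * k.+1%:R `^ s.
Proof.
move=> a0; have a1 : 0 < 1 + a by rewrite addr_gt0.
have [s0|s0] := leP 0 s.
  exists ((1 + a) `^ s) => [|k]; first exact: powR_ge0.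
  have k0 : 0 <= (k%:R : R) by [].
  rewrite -powRM ?(ltW a1)//; apply: ge0_ler_powR; rewrite ?nnegrE ?mulr_ge0 ?addr_ge0 ?(ltW a0)//.
  by rewrite -natr1; have := mulr_ge0 k0 (ltW a0); lra.
(* A negative exponent calls for a lower bound of the base: k + a >= (k + 1) a / (1 + a). *)
exists ((a / (1 + a)) `^ s) => [|k]; first exact: powR_ge0.
have k0 : 0 <= (k%:R : R) by [].
have c0 : 0 < a / (1 + a) by rewrite divr_gt0.
have ka : 0 < k%:R + a by rewrite ltr_wpDl.
rewrite -powRM ?(ltW c0)// -[s]opprK !(powRN _ (- s)) lef_pV2 ?posrE ?powR_gt0// ?mulr_gt0// ?invr_gt0//.
apply: ge0_ler_powR; rewrite ?nnegrE ?oppr_ge0 ?(ltW s0) ?(ltW ka) ?mulr_ge0 ?invr_ge0 ?(ltW a1) ?(ltW a0)//.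
rewrite mulrAC ler_pdivrMr// -natr1.
by have := mulr_ge0 k0 (ltW a0); have := sqr_ge0 a; lra.
Qed.

(** For |z| < 1 the geometric factor makes e = 0 sufficient. For |z| = 1 the series converges as
    soon as Re gamma + e < Re sigma: with d = Re (upsilon - theta), e = 0 achieves this when d <= 1,
    and e = 1 - d when d > 1. *)
Lemma ext_beta_growth gamma theta upsilon sigma z p lambda : 0 <= p -> 0 < lambda ->
  cabs z < 1 \/ (cabs z = 1 /\ 1 < complex.Re (sigma + upsilon - gamma - theta)) ->
  exists e : R, exists C : R, exists K : nat,
    (forall k, (K <= k)%N ->
       cabs (ext_beta (theta + k%:R) (upsilon - theta) p lambda) <= C * k.+1%:R `^ e) /\
    cvgn (series (fun k => k.+1%:R `^ (complex.Re gamma - 1 + e - complex.Re sigma) * cabs z ^+ k : R)).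
Proof.
move=> p0 l0 [z1|[z1 hre]].
  have [B [K hB]] := ext_beta_bounded theta (upsilon - theta) p lambda.
  exists 0, B, K; split; last by apply: powR_geometric_cvg; rewrite cabs_ge0.
  by move=> k /hB; rewrite powRr0 mulr1.
rewrite !(cReD, cReN) in hre.
have cv (e : R) : complex.Re gamma + e < complex.Re sigma ->
    cvgn (series (fun k => k.+1%:R `^ (complex.Re gamma - 1 + e - complex.Re sigma) * cabs z ^+ k : R)).
  move=> h; have e0 : 0 < complex.Re sigma - complex.Re gamma - e by lra.
  apply: eq_cvg_series (powR_series_cvg e0) => k.
  by rewrite z1 expr1n mulr1; congr (_ `^ _); ring.
have [d1|d1] := leP (complex.Re (upsilon - theta)) 1.
  have [B [K hB]] := ext_beta_bounded theta (upsilon - theta) p lambda.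
  exists 0, B, K; split; last by apply: cv; rewrite cReD cReN in d1; lra.
  by move=> k /hB; rewrite powRr0 mulr1.
have [C [K hC]] := ext_beta_decay theta p0 l0 d1.
exists (1 - complex.Re (upsilon - theta)), C, K; split => //.
by apply: cv; rewrite cReD cReN; lra.
Qed.

Definition lerch_coef gamma theta upsilon z p lambda k : R[i] :=
  pochhammer gamma k * ext_beta (theta + k%:R) (upsilon - theta) p lambda
    / (beta theta (upsilon - theta) * k`!%:R) * z ^+ k.

Lemma acsum_lerch gamma theta upsilon z sigma (a : R) p lambda :
  0 <= p -> 0 < lambda -> 0 < a ->
  cabs z < 1 \/ (cabs z = 1 /\ 1 < complex.Re (sigma + upsilon - gamma - theta)) ->
  acsum (fun k => lerch_coef gamma theta upsilon z p lambda k / cpow (k%:R + a)%:C sigma).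
Proof.
move=> p0 l0 a0 hz.
have [e [C [K [hC cv]]]] := ext_beta_growth p0 l0 hz.
have [G G0 hG] := bcoef_growth gamma.
have [D D0 hD] := powR_natD_le (- complex.Re sigma) a0.
pose b := cabs (beta theta (upsilon - theta))^-1.
pose A := G * `|C| * b * D.
pose w (k : nat) : R := k.+1%:R `^ (complex.Re gamma - 1 + e - complex.Re sigma) * cabs z ^+ k.
apply: (@acsum_le_near _ (A *: w : nat -> R) K); last first.
  by exact: is_cvg_seriesZ.
move=> k Kk.
have -> : lerch_coef gamma theta upsilon z p lambda k / cpow (k%:R + a)%:C sigma =
    bcoef gamma k * (ext_beta (theta + k%:R) (upsilon - theta) p lambda *
      ((beta theta (upsilon - theta))^-1 * (z ^+ k * (cpow (k%:R + a)%:C sigma)^-1))).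
  rewrite /lerch_coef /bcoef invfM.
  have h (a1 a2 a3 a4 a5 a6 : R[i]) :
    a1 * a2 * (a3 * a4) * a5 * a6 = a1 * a4 * (a2 * (a3 * (a5 * a6))) by ring.
  exact: h.
have h1 := hG k.
have h2 := le_trans (hC k Kk) (ler_wpM2r (powR_ge0 _ _) (ler_norm C)).
have h3 : cabs (cpow (k%:R + a)%:C sigma)^-1 <= D * k.+1%:R `^ (- complex.Re sigma).
  rewrite cabsV cabs_cpow -?powRN; last by rewrite ltr_wpDl.
  exact: hD.
have n0 : (k.+1%:R : R) != 0 by rewrite pnatr_eq0.
rewrite [X in _ <= X](_ : _ = G * k.+1%:R `^ (complex.Re gamma - 1) *
    (`|C| * k.+1%:R `^ e * (b * (cabs z ^+ k * (D * k.+1%:R `^ (- complex.Re sigma)))))); last first.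
  have -> : (A *: w) k = A * w k by [].
  rewrite /A /w [_ `^ (_ + e - _)]powRD ?n0 ?implybT// [_ `^ (_ + e)]powRD ?n0 ?implybT//.
  ring.
rewrite /b; move: (bcoef gamma k) (ext_beta _ _ _ _) (beta _ _)^-1 (_^-1) h1 h2 h3 => x1 x2 x3 x4 h1 h2 h3.
rewrite !cabsM cabsX.
have := (cabs_ge0 x1, cabs_ge0 x2, cabs_ge0 x3, cabs_ge0 x4) => -[[[p1 p2] p3] p4].
have pz : 0 <= cabs z ^+ k by rewrite exprn_ge0 ?cabs_ge0.
apply: ler_pM; rewrite ?mulr_ge0//; apply: ler_pM; rewrite ?mulr_ge0//.
by do 2![apply: ler_wpM2l => //].
Qed.

End Summability.

(* On R[i], x < y means that y - x is a positive real, so `|t| < a forces a to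
   be real and positive. *)
Theorem theorem4p3 (R : realType) (p lambda : R)
    (gamma theta upsilon z sigma a t : R[i])
    (hp : 0 <= p) (hlambda : 0 < lambda)
    (hta : `|t| < a) (hsigma : sigma != 1)
    (hz : `|z| < 1 \/
          (`|z| = 1 /\ 1 < complex.Re (sigma + upsilon - gamma - theta))) :
  has_csum
    (fun n => pochhammer sigma n / n`!%:R
              * ext_Phi gamma theta upsilon z (sigma + n%:R) a p lambda
              * t ^+ n)
    (ext_Phi gamma theta upsilon z sigma (a - t) p lambda).
Proof.
have [r aE tr] : exists2 r : R, a = r%:C & cabs t < r.
  move: hta; rewrite cabsE; case: a => r s; rewrite ltcE/= => /andP[/eqP -> tr].
  by exists r.
have r0 : 0 < r := le_lt_trans (cabs_ge0 t) tr.
have hz' : cabs z < 1 \/ cabs z = 1 /\ 1 < complex.Re (sigma + upsilon - gamma - theta).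
  move: hz; rewrite cabsE => -[|[z1 h]]; first by rewrite ltcR; left.
  by right; split => //; move: z1 => [].
(* The factor (k + a)^(-sigma) is part of the summable weight, so that dividing by (k + a)^n yields
   the series of Phi at sigma + n. *)
have := @lerch_exchange _ _ sigma _ _ tr (acsum_lerch hp hlambda r0 hz').
set f := fun n : nat => _; set l := csum _.
have kE (k : nat) : (k%:R + r)%:C = k%:R + r%:C :> R[i] by rewrite rmorphD/= rmorph_nat.
have kr (k : nat) : 0 < k%:R + r by rewrite ltr_wpDl.
have -> : l = ext_Phi gamma theta upsilon z sigma (a - t) p lambda.
  congr csum; apply/funext => k.
  have k0 : (k%:R + r)%:C != 0 :> R[i].
    by rewrite -cabs_eq0 cabsR normr_eq0 gt_eqF.
  have -> : k%:R + (a - t) = (k%:R + r)%:C * (1 - t / (k%:R + r)%:C).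
    by rewrite mulrBr mulr1 mulrCA divff// mulr1 kE aE addrA.
  rewrite cpowMr//; last first.
    rewrite subr_eq0; apply/eqP => h; have := cabs1 R; rewrite h cabsM cabsV cabsR gtr0_norm//.
    by apply/eqP; rewrite lt_eqF// ltr_pdivrMr// mul1r (lt_le_trans tr)// lerDr.
  by rewrite cpowN -mulrA -invfM mulrA.
apply: eq_has_csum => n; rewrite /f -/(bcoef sigma n); congr (_ * _ * _).
congr csum; apply/funext => k.
by rewrite /lerch_coef aE -kE cpow_natD// [(_ * _ ^+ n)^-1]invfM !mulrA.
Qed.
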